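(* For every $0 < \gamma \le 1$ and $c > 0$, there exists $\alpha > 0$ such that the following holds. Let $\delta = \delta(n)$ be any function of $n$ with $n^{-\alpha} < \delta \le 1 - c$ for all sufficiently large $n \in \mathbb{N}$, and let $S \subseteq [n]$ be a $\delta$-random set. Then $$\mathbb{P}\Big(\text{there exist } A, B \subseteq \mathbb{N} \text{ with } \min\{|A|, |B|\} \ge k \text{ and } A + B \subseteq S\Big) \to 0$$ as $n \to \infty$, where $k = (3 + \gamma) \log n / \log (1 / \delta)$.
   Context: $\mathbb{N} = \{1, 2, 3, \ldots\}$ and $[n] = \{1, \ldots, n\}$. For sets $A, B$, the sumset is $A + B = \{a + b : a \in A,\ b \in B\}$. A $\delta$-random set $S \subseteq [n]$ is a random subset of $[n]$ in which each element of $[n]$ is included independently with probability $\delta$. $\log$ is the natural logarithm. *)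

(* Defs.v *)
From HB Require Import structures.
From mathcomp Require Import all_boot all_order all_algebra finmap.
From mathcomp Require Import all_classical all_reals all_analysis.

Set Implicit Arguments.
Unset Strict Implicit.
Unset Printing Implicit Defensive.

Import Order.TTheory GRing.Theory Num.Theory.
Import numFieldNormedType.Exports.

Local Open Scope classical_set_scope.
Local Open Scope ring_scope.

Definition posnats : set nat := [set i | (0 < i)%N].

(* [n] = {1, ..., n} *)
Definition interval1 (n : nat) : set nat := [set i | (1 <= i <= n)%N].

Definition sumset (A B : set nat) : set nat :=
  [set (a + b)%N | a in A & b in B].

Definition mutually_independent (R : realType) (d : measure_display)
    (T : measurableType d) (P : probability T R) (I : choiceType)
    (D : set I) (E : I -> set T) : Prop :=
  forall F : {fset I}, [set` F] `<=` D ->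
    (P (\bigcap_(i in [set` F]) E i) = \prod_(i <- F) P (E i))%E.

Definition random_subset (R : realType) (d : measure_display)
    (T : measurableType d) (P : probability T R) (n : nat) (delta : R)
    (S : T -> set nat) : Prop :=
  [/\ forall w, S w `<=` interval1 n,
      forall i, interval1 n i -> measurable [set w | S w i],
      forall i, interval1 n i -> P [set w | S w i] = delta%:E
    & mutually_independent P (interval1 n) (fun i => [set w | S w i])].

(* [counting A] is the cardinality of [A], equal to +oo when [A] is infinite. *)
Definition contains_large_sumset (R : realType) (k : R) (X : set nat) : Prop :=
  exists A B : set nat,
    [/\ A `<=` posnats, B `<=` posnats,
        (k%:E <= mine (counting A) (counting B))%E
      & sumset A B `<=` X].

(* Main.v *)
(* A union bound over witnesses: if |A| = |B| = k and A + B is contained in S then so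
   is some U, a sumset of subsets of A and B, taken from a family which for |U| = s
   has at most exp (eps s) n^r members with r k <= (3 + eps) s.  Since
   k = (3 + gamma) log n / log (1/delta), the sum of |family| delta^s over s >= k/4
   is then a negative power of n.
   To describe U, prune A and B so that most sums are popular, and choose by
   greedy hitting sets a dictionary of o(k) elements such that all popular sums
   are sums of two of them.  The dictionary is determined by the additive relations
   which it satisfies and by r of its entries; choosing the relations costs
   exp (o(k)) and the entries cost n^r.
   The bound r k <= (3 + eps) s comes from geometry: the universal model of A and B
   has dimension at least r - 2, and two sets of k vectors whose differences span
   dimension d have at least (d + 2) k / 3 sums by Freiman's lemma, a bound which
   is shown to survive when only the sums in the dictionary are counted. *)

Require Import Defs.
From HB Require Import structures.
From mathcomp Require Import all_boot all_order all_algebra finmap.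
From mathcomp Require Import all_classical all_reals all_analysis.
From mathcomp Require Import zify ring lra.

Set Implicit Arguments.
Unset Strict Implicit.
Unset Printing Implicit Defensive.

Import Order.TTheory GRing.Theory Num.Theory.
Import numFieldNormedType.Exports.

Local Open Scope fset_scope.
Local Open Scope ring_scope.

(** Since delta may stay near 1 - c, [delta ^ s] only pays for [exp (eps s)] choices. When |A + B|
    is of order k, even choosing A and B inside a known set of size O(k) costs exp (C k), which is
    too much. This is why the witness is built from o(k) elements and need not be all of A + B. The
    price is that Freiman's lemma is needed with up to e sums missing in every row and column. Its
    usual proof deletes one point at a time and would pay for the missing sums at each deletion. The
    robust version pays them only boundedly often: once for each dimension of V, or once for each
    pair of cosets of V met by the two sets. The constant 3 is forced by the two bounds of
    [freiman], roughly d k - d^2 / 2 and d^2 / 4 for the number of sums: they cross at d = 4 k / 3,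
    where both equal d k / 3. The bound n^(-alpha) < delta enters by making k exceed the constant
    beyond which the combinatorial part holds. *)

Definition fsum (V : nmodType) (A B : {fset V}) : {fset V} :=
  [fset a + b | a in A, b in B].

Lemma fsumP (V : nmodType) (A B : {fset V}) (z : V) :
  reflect (exists a b, [/\ a \in A, b \in B & z = a + b]) (z \in fsum A B).
Proof.
apply: (iffP idP).
  by move/imfset2P => [a aA [b bB ->]]; exists a, b.
by move=> [a [b [aA bB ->]]]; apply/imfset2P; exists a => //; exists b.
Qed.

Lemma mem_fsum (V : nmodType) (A B : {fset V}) (a b : V) :
  a \in A -> b \in B -> a + b \in fsum A B.
Proof. by move=> aA bB; apply/fsumP; exists a, b. Qed.

Lemma fsumS (V : nmodType) (A A' B B' : {fset V}) :
  A `<=` A' -> B `<=` B' -> fsum A B `<=` fsum A' B'.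
Proof.
move=> /fsubsetP sA /fsubsetP sB; apply/fsubsetP => z /fsumP[a [b [aA bB ->]]].
by apply: mem_fsum; [exact: sA | exact: sB].
Qed.

Lemma fsumC (V : nmodType) (A B : {fset V}) : fsum A B = fsum B A.
Proof.
by apply/fsetP => z; apply/fsumP/fsumP => -[x [y [xA yB ->]]];
  exists y, x; rewrite addrC.
Qed.

(** * Freiman's lemma *)

Section Freiman.
Variables (F : realFieldType) (m : nat).
Implicit Types (A B : {fset 'rV[F]_m}) (c : 'cV[F]_m).

(** The two sets may be translated independently without changing the number of sums, so the
    dimension of the pair counts only differences inside A and inside B. *)
Definition dirmx A B : 'M[F]_m :=
  ((\sum_(p : A * A) <<val p.1 - val p.2>>) +
   (\sum_(p : B * B) <<val p.1 - val p.2>>))%MS.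

Lemma dirmxP A B (n : nat) (W : 'M[F]_(n, m)) :
  reflect ((forall a a', a \in A -> a' \in A -> (a - a' <= W)%MS) /\
           (forall b b', b \in B -> b' \in B -> (b - b' <= W)%MS))
    (dirmx A B <= W)%MS.
Proof.
rewrite /dirmx addsmx_sub; apply: (iffP andP).
  move=> [/sumsmx_subP hA /sumsmx_subP hB]; split.
    by move=> a a' aA a'A; have := hA ([` aA], [` a'A]) isT; rewrite genmxE.
  by move=> b b' bB b'B; have := hB ([` bB], [` b'B]) isT; rewrite genmxE.
move=> [hA hB]; split; apply/sumsmx_subP => p _; rewrite genmxE.
  exact: hA (valP p.1) (valP p.2).
exact: hB (valP p.1) (valP p.2).
Qed.

Lemma dirmx_subl A B a a' : a \in A -> a' \in A -> (a - a' <= dirmx A B)%MS.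
Proof. by move=> aA a'A; have /dirmxP[h _] := submx_refl (dirmx A B); apply: h. Qed.

Lemma dirmx_subr A B b b' : b \in B -> b' \in B -> (b - b' <= dirmx A B)%MS.
Proof. by move=> bB b'B; have /dirmxP[_ h] := submx_refl (dirmx A B); apply: h. Qed.

Definition ht c (x : 'rV[F]_m) : F := (x *m c) 0 0.

Lemma htD c x y : ht c (x + y) = ht c x + ht c y.
Proof. by rewrite /ht mulmxDl mxE. Qed.

Lemma htN c x : ht c (- x) = - ht c x.
Proof. by rewrite /ht mulNmx mxE. Qed.

Lemma htB c x y : ht c (x - y) = ht c x - ht c y.
Proof. by rewrite htD htN. Qed.

Lemma ht0 c : ht c 0 = 0.
Proof. by rewrite /ht mul0mx mxE. Qed.

Lemma ht_eq0 c x : (ht c x == 0) = (x *m c == 0).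
Proof.
rewrite /ht; apply/eqP/eqP => [h|->]; last by rewrite mxE.
by apply/matrixP => i j; rewrite !ord1 h mxE.
Qed.

Lemma fset_min (T : choiceType) (f : T -> F) (X : {fset T}) :
  X != fset0 -> exists2 a, a \in X & forall x, x \in X -> f a <= f x.
Proof.
move=> /fset0Pn[x0 x0X].
case: (@arg_minP _ _ _ [` x0X] predT (fun x : X => f (val x)) isT) => i _ h.
by exists (val i) => [|x xX]; [exact: valP | exact: (h [` xX])].
Qed.

(* Some functional is injective on a given finite set: evaluate the rows, seen
   as polynomials, at a point which is a root of none of them. *)
Lemma separating_functional (X : seq 'rV[F]_m) :
  exists c, forall x, x \in X -> x != 0 -> ht c x != 0.
Proof.
pose p : {poly F} := \prod_(x <- X | x != 0) rVpoly x.
have p0 : p != 0.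
  rewrite /p big_seq_cond prodf_seq_neq0; apply/allP => x _; apply/implyP.
  move=> /andP[_]; apply: contraNneq => h.
  by rewrite -(rVpolyK x) h linear0.
have [t nroot] : exists t : F, ~~ root p t.
  pose s := [seq i%:R | i <- iota 0 (size p)] : seq F.
  apply: contrapT => h.
  have : all (root p) s.
    by apply/allP => t _; apply: contrapT => /negP ?; apply: h; exists t.
  move=> /(max_poly_roots p0); rewrite /s size_map size_iota ltnn => h'.
  suff /h' : uniq s by [].
  rewrite map_inj_uniq ?iota_uniq // => i j /eqP.
  by rewrite eqr_nat => /eqP.
exists (\col_i t ^+ i) => x xX x0.
have -> : ht (\col_i t ^+ i) x = (rVpoly x).[t].
  rewrite /ht mxE horner_poly; apply: eq_bigr => i _.
  by rewrite mxE insubT //= => hi; congr (x _ _ * _); apply: val_inj.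
move: nroot; rewrite /root /p big_seq_cond horner_prod prodf_seq_neq0.
by move=> /allP /(_ x xX); rewrite xX x0.
Qed.

Definition spanfs (X : {fset 'rV[F]_m}) : 'M[F]_m :=
  (\sum_(x : X) <<val x>>)%MS.

Lemma mem_spanfs (X : {fset 'rV[F]_m}) x : x \in X -> (x <= spanfs X)%MS.
Proof.
move=> xX; apply: (submx_trans (B := <<val [` xX]>>%MS)).
  by rewrite genmxE.
exact: (sumsmx_sup [` xX]).
Qed.

Lemma rank_spanfs (X : {fset 'rV[F]_m}) : (\rank (spanfs X) <= #|` X|)%N.
Proof.
rewrite cardfE -sum1_card /spanfs.
apply: (big_ind2 (fun (C : 'M[F]_m) r => \rank C <= r)%N).
- by rewrite mxrank0.
- by move=> C1 r1 C2 r2 h1 h2; exact: leq_trans (mxrank_adds_leqif C1 C2) (leq_add h1 h2).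
- by move=> x _; rewrite mxrank_gen rank_leq_row.
Qed.

Definition lost_sums A B (a b : 'rV[F]_m) :=
  fsum A B `\` fsum (A `\ a) (B `\ b).

(* If a + z + b is not lost then z splits as a sum of two strictly smaller
   differences, so the lost sums generate all the differences. *)
Lemma rank_dirmx_lt_lost c A B a b :
  a \in A -> b \in B ->
  (forall x, x \in A -> x != a -> ht c a < ht c x) ->
  (forall x, x \in B -> x != b -> ht c b < ht c x) ->
  (\rank (dirmx A B) < #|` lost_sums A B a b|)%N.
Proof.
move=> aA bB amin bmin; set L := lost_sums A B a b.
(* Every sum avoiding both a and b is strictly higher than [a + b]. This lost sum gives the zero
   difference, so discarding it yields the strict inequality. *)
have abL : a + b \in L.
  rewrite /L in_fsetD (mem_fsum aA bB) andbT; apply/negP => /fsumP[x [y [xA yB e]]].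
  move: xA yB; rewrite !inE => /andP[xa xA] /andP[yb yB].
  have := ltrD (amin _ xA xa) (bmin _ yB yb).
  by rewrite -!htD e ltxx.
pose X := [fset z - (a + b) | z in L `\ (a + b)].
have cX : (#|` X| < #|` L|)%N.
  rewrite (cardfsD1 (a + b) L) abL add1n ltnS.
  exact: leq_imfset_card.
apply: leq_ltn_trans cX; apply: leq_trans (rank_spanfs X).
apply: mxrankS.
have key : forall (z : 'rV[F]_m), (a + z \in A) || (b + z \in B) ->
    (z <= spanfs X)%MS.
  (* Heights lie in a field, which is not well-founded; the induction runs instead on the number of
     differences from a or b that lie below z. *)
  pose below z := [fset x in [fset x - a | x in A] `|` [fset x - b | x in B]
                    | ht c x < ht c z].
  move=> z; have [n] := ubnP #|` below z|.
  elim: n z => // n IH z cz hz.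
  have [->|z0] := eqVneq z 0; first exact: sub0mx.
  have sz : a + b + z \in fsum A B.
    case/orP: hz => hz.
      by rewrite addrAC mem_fsum.
    by rewrite -addrA mem_fsum.
  have [zL|] := boolP (a + b + z \in L).
    apply: mem_spanfs; apply/imfsetP; exists (a + b + z).
      rewrite /= in_fsetD1 zL andbT -subr_eq0 addrAC subrr add0r //.
    by rewrite addrAC subrr add0r.
  rewrite /L in_fsetD sz andbT negbK => /fsumP[x [y [+ + e]]].
  rewrite !inE => /andP[xa xA] /andP[yb yB].
  have ez : z = (x - a) + (y - b).
    by rewrite addrACA -e -opprD addrAC subrr add0r.
  have px : 0 < ht c (x - a) by rewrite htB subr_gt0 amin.
  have py : 0 < ht c (y - b) by rewrite htB subr_gt0 bmin.
  have aux : forall u, (a + u \in A) || (b + u \in B) ->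
     ht c u < ht c z -> (u <= spanfs X)%MS.
    move=> u hu lu; apply: IH => //.
    rewrite ltnS in cz; apply: leq_trans cz; apply: fproper_ltn_card.
    rewrite fproperE; apply/andP; split.
      apply/fsubsetP => w.
      by rewrite !inE /= => /andP[-> /=] /lt_trans; apply.
    apply/negP => /fsubsetP /(_ u); rewrite !inE /= ltxx andbF lu andbT.
    suff -> : (u \in [fset x - a | x in A]) || (u \in [fset x - b | x in B]).
      by move/(_ isT).
    apply/orP; case/orP: hu => hu.
      by left; apply/imfsetP; exists (a + u) => //; rewrite addrAC subrr add0r.
    by right; apply/imfsetP; exists (b + u) => //; rewrite addrAC subrr add0r.
  rewrite ez; apply: addmx_sub; apply: aux.
  - by rewrite (addrC a) subrK xA.
  - by rewrite ez (htD c (x - a)) ltrDl.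
  - by rewrite (addrC b) subrK yB orbT.
  - by rewrite ez (htD c (x - a)) ltrDr.
apply/dirmxP; split.
  move=> x x' xA x'A.
  have -> : x - x' = (x - a) - (x' - a) by rewrite opprB addrA subrK.
  by apply: addmx_sub; rewrite ?eqmx_opp; apply: key; rewrite (addrC a) subrK ?xA ?x'A.
move=> x x' xA x'A.
have -> : x - x' = (x - b) - (x' - b) by rewrite opprB addrA subrK.
by apply: addmx_sub; rewrite ?eqmx_opp; apply: key; rewrite (addrC b) subrK ?xA ?x'A orbT.
Qed.

Lemma card_translate (X : {fset 'rV[F]_m}) a : #|` [fset a + x | x in X]| = #|` X|.
Proof. by apply: card_imfset; exact: addrI. Qed.

Lemma lost_sumsC A B a b : lost_sums A B a b = lost_sums B A b a.
Proof. by rewrite /lost_sums fsumC [fsum (A `\ a) _]fsumC. Qed.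

Lemma dirmxC A B : dirmx A B = dirmx B A.
Proof. exact: addsmxC. Qed.

(** A second representation a + y = a' + b' gives a - a1 = (b' - y) + (a' - a1), a direction of the
    remaining sets. For y = b there is no such direction, and extremality of a and b is used
    instead. *)
Lemma lost_translate c A B a b a1 :
  a \in A -> b \in B -> a1 \in A `\ a ->
  (forall x, x \in A -> x != a -> ht c a < ht c x) ->
  (forall x, x \in B -> x != b -> ht c b < ht c x) ->
  ~~ (a - a1 <= dirmx (A `\ a) (B `\ b))%MS ->
  [fset a + y | y in B] `<=` lost_sums A B a b.
Proof.
move=> aA bB a1A amin bmin ha; apply/fsubsetP => z /imfsetP[y /= yB ->].
rewrite in_fsetD (mem_fsum aA yB) andbT; apply/negP => /fsumP[a' [b' [a'A b'B e]]].
have [yb|yb] := eqVneq y b.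
  move: a'A b'B e; rewrite yb !inE => /andP[xa xA] /andP[xb xB] e.
  have := ltrD (amin _ xA xa) (bmin _ xB xb).
  by rewrite -!htD e ltxx.
case/negP: ha.
have -> : a - a1 = (b' - y) + (a' - a1).
  have -> : a = a' + b' - y by rewrite -e addrK.
  by apply/matrixP => i j; rewrite !mxE; ring.
apply: addmx_sub; first by apply: dirmx_subr => //; rewrite in_fsetD1 yb.
exact: dirmx_subl.
Qed.

(** Both a + B and b + A are lost. A common element other than a + b would put b - b1 into the span
    of D and a - a1; the element a + b itself is counted once by removing a from A. *)
Lemma lost_ge_two c A B a b a1 b1 :
  a \in A -> b \in B -> a1 \in A `\ a -> b1 \in B `\ b ->
  (forall x, x \in A -> x != a -> ht c a < ht c x) ->
  (forall x, x \in B -> x != b -> ht c b < ht c x) ->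
  let D := dirmx (A `\ a) (B `\ b) in
  ~~ (a - a1 <= D)%MS -> ~~ (b - b1 <= D + <<a - a1>>)%MS ->
  (#|` B| + #|` A `\ a| <= #|` lost_sums A B a b|)%N.
Proof.
move=> aA bB a1A b1B amin bmin D ha hb.
have sA := lost_translate aA bB a1A amin bmin ha.
have sB : [fset b + x | x in A `\ a] `<=` lost_sums A B a b.
  apply: (@fsubset_trans _ [fset b + x | x in A]).
    by apply/fsubsetP => z /imfsetP[x /= + ->]; rewrite in_fsetD1 => /andP[_ xA];
      apply/imfsetP; exists x.
  rewrite lost_sumsC; apply: (lost_translate bB aA b1B bmin amin).
  apply: contra hb => hb; apply: submx_trans (addsmxSl _ _).
  by rewrite /D dirmxC.
have dis : fdisjoint [fset a + y | y in B] [fset b + x | x in A `\ a].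
  apply/fdisjointP => z /imfsetP[y /= yB ->]; apply/negP => /imfsetP[x /= xA e].
  have [yb|yb] := eqVneq y b.
    move: xA; rewrite in_fsetD1 => /andP[/eqP + _]; apply.
    by apply: (addrI b); rewrite -e yb addrC.
  case/negP: hb.
  have -> : b - b1 = (y - b1) + (a1 - x) + (a - a1).
    have -> : b = a + y - x by rewrite e addrK.
    by apply/matrixP => i j; rewrite !mxE; ring.
  apply: addmx_sub; last by rewrite (submx_trans _ (addsmxSr _ _)) ?genmxE.
  apply: submx_trans (addsmxSl _ _); apply: addmx_sub.
    by apply: dirmx_subr => //; rewrite in_fsetD1 yb.
  exact: dirmx_subl.
have sAB : [fset a + y | y in B] `|` [fset b + x | x in A `\ a] `<=` lost_sums A B a b.
  by rewrite fsubUset sA sB.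
apply: leq_trans (fsubset_leq_card sAB).
by rewrite cardfsU (disjoint_fsetI0 dis) cardfs0 subn0 !card_translate.
Qed.

Lemma dirmx_remove_sub A B a b a1 b1 n (W : 'M[F]_(n, m)) :
  a1 \in A `\ a -> b1 \in B `\ b ->
  (dirmx (A `\ a) (B `\ b) <= W)%MS -> (a - a1 <= W)%MS -> (b - b1 <= W)%MS ->
  (dirmx A B <= W)%MS.
Proof.
move=> a1A b1B hD ha hb; apply/dirmxP.
have aux (X : {fset 'rV[F]_m}) (x0 x1 : 'rV[F]_m) :
    (forall x x', x \in X `\ x0 -> x' \in X `\ x0 -> (x - x' <= W)%MS) ->
    x1 \in X `\ x0 -> (x0 - x1 <= W)%MS ->
    forall x x', x \in X -> x' \in X -> (x - x' <= W)%MS.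
  move=> h x1X h01.
  have h1 x : x \in X -> (x - x1 <= W)%MS.
    move=> xX; have [->//|xx0] := eqVneq x x0.
    by apply: h => //; rewrite in_fsetD1 xx0.
  move=> x x' xX x'X.
  have -> : x - x' = (x - x1) - (x' - x1) by rewrite opprB addrA subrK.
  by apply: addmx_sub; rewrite ?eqmx_opp; apply: h1.
have /dirmxP[hA hB] := hD.
split; first exact: aux hA a1A ha.
exact: aux hB b1B hb.
Qed.

(* Freiman's lemma, together with a second bound which is the stronger one when
   the dimension exceeds 4/3 of the common size of the two sets. *)
Theorem freiman A B k :
  #|` A| = k.+1 -> #|` B| = k.+1 ->
  let d := \rank (dirmx A B) in
  ((d.+1 * k.+1).*2 <= (#|` fsum A B|).*2 + d * d.+1)%N /\
  (d.+2 * d.+2 <= 4 * #|` fsum A B|)%N.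
Proof.
have [c sep] := separating_functional
  [seq x - y | x <- A ++ B : seq 'rV[F]_m, y <- A ++ B].
have inj X : {subset X <= (A ++ B : seq 'rV[F]_m)} ->
    {in X &, injective (ht c)}.
  move=> sX x y xX yX e; apply/eqP; rewrite -subr_eq0; apply/negPn/negP => nz.
  have /sep /(_ nz) : x - y \in [seq x - y | x <- A ++ B : seq 'rV[F]_m, y <- A ++ B].
    by apply: allpairs_f; apply: sX.
  by rewrite htB e subrr eqxx.
have injA : {in A &, injective (ht c)} by apply: inj => x xA; rewrite mem_cat xA.
have injB : {in B &, injective (ht c)}.
  by apply: inj => x xB; rewrite mem_cat xB orbT.
move: injA injB => {sep inj}.
elim: k A B => [|k IH] A B injA injB cA cB.
  have [/cardfs1P[a Aa] /cardfs1P[b Bb]] : #|` A| == 1%N /\ #|` B| == 1%N.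
    by rewrite cA cB.
  have -> : \rank (dirmx A B) = 0%N.
    apply/eqP; rewrite mxrank_eq0 -submx0; apply/dirmxP.
    by rewrite Aa Bb; split => x y /fset1P -> /fset1P ->; rewrite subrr sub0mx.
  have : (0 < #|` fsum A B|)%N.
    rewrite cardfs_gt0; apply/fset0Pn; exists (a + b).
    by apply: mem_fsum; rewrite ?Aa ?Bb !inE.
  by move: #|` _| => s h d; rewrite /d; split; lia.
have mn (X : {fset 'rV[F]_m}) : {in X &, injective (ht c)} -> #|` X| = k.+2 ->
   exists2 a, a \in X & forall x, x \in X -> x != a -> ht c a < ht c x.
  move=> injX cX.
  have [|a aX amin] := @fset_min _ (ht c) X; first by rewrite -cardfs_gt0 cX.
  exists a => // x xX xa; rewrite lt_neqAle amin // andbT.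
  by apply: contraNneq xa => e; apply/eqP; apply: injX.
have [a aA amin] := mn A injA cA.
have [b bB bmin] := mn B injB cB.
have cA' : #|` A `\ a| = k.+1 by move: cA; rewrite (cardfsD1 a) aA => -[].
have cB' : #|` B `\ b| = k.+1 by move: cB; rewrite (cardfsD1 b) bB => -[].
have [||h1 h2] := IH (A `\ a) (B `\ b) _ _ cA' cB'.
- by move=> x y; rewrite !in_fsetD1 => /andP[_ xA] /andP[_ yA]; apply: injA.
- by move=> x y; rewrite !in_fsetD1 => /andP[_ xB] /andP[_ yB]; apply: injB.
have [a1 a1A] : exists a1, a1 \in A `\ a.
  by apply/fset0Pn; rewrite -cardfs_gt0 cA'.
have [b1 b1B] : exists b1, b1 \in B `\ b.
  by apply/fset0Pn; rewrite -cardfs_gt0 cB'.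
have lost := rank_dirmx_lt_lost aA bB amin bmin.
have cS : #|` fsum A B| = (#|` fsum (A `\ a) (B `\ b)| + #|` lost_sums A B a b|)%N.
  rewrite cardfsDS ?subnKC //; last by apply: fsumS; exact: fsubD1set.
  by apply: fsubset_leq_card; apply: fsumS; exact: fsubD1set.
move: h1 h2 lost; rewrite cS; set D' := dirmx (A `\ a) (B `\ b).
set s' := #|` fsum (A `\ a) (B `\ b)|; set L := #|` lost_sums A B a b|.
have rk1 (x : 'rV[F]_m) : (\rank <<x>>%MS <= 1)%N.
  by rewrite mxrank_gen rank_leq_row.
have up n (W : 'M[F]_(n, m)) r : (D' <= W)%MS -> (a - a1 <= W)%MS -> (b - b1 <= W)%MS ->
   (\rank W <= r)%N -> (\rank (dirmx A B) <= r)%N.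
  move=> w1 w2 w3; move/(leq_trans _); apply; apply: mxrankS.
  exact: (dirmx_remove_sub a1A b1B w1 w2 w3).
have radd (W W' : 'M[F]_m) : (\rank (W + W')%MS <= \rank W + \rank W')%N.
  by have [] := mxrank_adds_leqif W W'.
set d := \rank (dirmx A B); set d' := \rank D'.
(* Restoring a and b raises the dimension by 0, 1 or 2, and each rise is paid for by a lost
   translate. The bound d < L from [rank_dirmx_lt_lost] handles the case of equal dimension, and it
   alone carries the second inequality, exactly so when the dimension rises by two. *)
have : (d <= d' \/ (d <= d'.+1 /\ k.+2 <= L) \/ (d <= d'.+2 /\ k.+2 + k.+1 <= L))%N.
  have [ha|ha] := boolP (a - a1 <= D')%MS.
    have [hb|hb] := boolP (b - b1 <= D')%MS; first by left; apply: (up _ D').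
    right; left; split.
      apply: (up _ (D' + <<b - b1>>)%MS); rewrite ?addsmxSl //.
      - exact: submx_trans ha (addsmxSl _ _).
      - by rewrite (submx_trans _ (addsmxSr _ _)) ?genmxE.
      - by apply: leq_trans (radd _ _) (leq_trans (leq_add (leqnn _) (rk1 _)) _); rewrite addn1.
    rewrite -cA -(card_translate A b) /L lost_sumsC; apply: fsubset_leq_card.
    by apply: (lost_translate bB aA b1B bmin amin); rewrite dirmxC.
  have [hb|hb] := boolP (b - b1 <= D' + <<a - a1>>)%MS.
    right; left; split.
      apply: (up _ (D' + <<a - a1>>)%MS); rewrite ?addsmxSl //.
      - by rewrite (submx_trans _ (addsmxSr _ _)) ?genmxE.
      - by apply: leq_trans (radd _ _) (leq_trans (leq_add (leqnn _) (rk1 _)) _); rewrite addn1.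
    rewrite -cB -(card_translate B a); apply: fsubset_leq_card.
    exact: (lost_translate aA bB a1A amin bmin).
  right; right; split.
    apply: (up _ (D' + <<a - a1>> + <<b - b1>>)%MS).
    - exact: submx_trans (addsmxSl _ _) (addsmxSl _ _).
    - by rewrite (submx_trans _ (addsmxSl _ _)) // (submx_trans _ (addsmxSr _ _)) ?genmxE.
    - by rewrite (submx_trans _ (addsmxSr _ _)) ?genmxE.
    - apply: leq_trans (radd _ _) (leq_trans (leq_add (radd _ _) (rk1 _)) _).
      by apply: leq_trans (leq_add (leq_add (leqnn _) (rk1 _)) (leqnn _)) _; rewrite !addn1.
  by rewrite -cB -cA'; apply: lost_ge_two a1A b1B amin bmin ha hb.
have dd : (d' <= d)%N.
  apply: mxrankS; apply/dirmxP; split=> x y; rewrite !in_fsetD1 => /andP[_ ?] /andP[_ ?].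
    exact: dirmx_subl.
  exact: dirmx_subr.
move: dd; clear; clearbody d d' s' L; move=> dd hd h1 h2 hL.
have [e|[e|e]] : d = d' \/ d = d'.+1 \/ d = d'.+2 by lia.
- by subst d; split; nia.
- by subst d; split; nia.
- by subst d; split; nia.
Qed.

End Freiman.

(** * Robust versions of Freiman's lemma *)

Section Extremes.
Variables (R : realType) (m : nat).
Implicit Types (X Y : {fset 'rV[R]_m}) (c : 'cV[R]_m).

(** The default 0 is harmless on sets containing 0, where this is the true maximum. *)
Definition top c X : R := \big[Order.max/0]_(x <- X) ht c x.

Lemma le_top c X x : x \in X -> ht c x <= top c X.
Proof. by move=> xX; apply: le_bigmax_seq xX _. Qed.

Lemma top_attained c X : 0 \in X -> exists2 a, a \in X & ht c a = top c X.
Proof.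
move=> X0; have [|a aX amin] := @fset_min _ _ (fun x => - ht c x) X.
  by apply/fset0Pn; exists 0.
exists a => //; apply/eqP; rewrite eq_le le_top //=.
rewrite /top big_seq; apply: bigmax_le => [|x xX]; last by rewrite -lerN2 amin.
by rewrite -(ht0 c) -lerN2 amin.
Qed.

Lemma ht_comb c1 c2 (a b : R) (x : 'rV[R]_m) :
  ht (a *: c1 + b *: c2) x = a * ht c1 x + b * ht c2 x.
Proof. by rewrite /ht mulmxDr -!scalemxAr !mxE. Qed.

Lemma htNc c (x : 'rV[R]_m) : ht (- c) x = - ht c x.
Proof. by rewrite /ht mulmxN mxE. Qed.

Lemma top_continuous c1 c2 X :
  continuous (fun s : R => top ((1 - s) *: c1 + s *: c2) X).
Proof.
rewrite /top; elim: (X : seq _) => [|x r IH].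
  under [X in continuous X]eq_fun do rewrite big_nil.
  by move=> s; apply: cvg_cst.
under [X in continuous X]eq_fun do rewrite big_cons.
move=> s; apply: (@continuous_max R R _ _ s _ (IH s)).
under [X in {for s, continuous X}]eq_fun do rewrite ht_comb.
apply: cvgD; apply: cvgM; try exact: cvg_cst; last exact: cvg_id.
by apply: cvgB; [exact: cvg_cst | exact: cvg_id].
Qed.

Lemma top_crossing c1 c2 X Y :
  top c1 Y <= top c1 X -> top c2 X <= top c2 Y ->
  exists2 s : R, 0 <= s <= 1 &
    top ((1 - s) *: c1 + s *: c2) X = top ((1 - s) *: c1 + s *: c2) Y.
Proof.
move=> h1 h2.
pose f s := top ((1 - s) *: c1 + s *: c2) X - top ((1 - s) *: c1 + s *: c2) Y.
have [||s] := @IVT R f 0 1 0 ler01.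
- apply: continuous_subspaceT => s.
  by apply: cvgB; apply: top_continuous.
- have e0 : (1 - 0) *: c1 + 0 *: c2 = c1 by rewrite subr0 scale1r scale0r addr0.
  have e1 : (1 - 1) *: c1 + 1 *: c2 = c2 by rewrite subrr scale1r scale0r add0r.
  by rewrite /f e0 e1 ge_min le_max !subr_ge0 !subr_le0 h1 h2 orbT.
- by rewrite in_itv /= => s01 /eqP; rewrite subr_eq0 => /eqP e; exists s.
Qed.

(* Moving through the pencil from c1 to - c1, the difference of the two tops
   either changes sign, or is of constant sign at both c1 and - c1. *)
Lemma common_extremes c1 c2 X Y :
  exists a b : R, [/\ (a != 0) || (b != 0) &
    let c := a *: c1 + b *: c2 in
    (top c Y <= top c X /\ top (- c) Y <= top (- c) X) \/
    (top c X <= top c Y /\ top (- c) X <= top (- c) Y)].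
Proof.
have fin a b (c := a *: c1 + b *: c2) : (a != 0) || (b != 0) ->
   top c X = top c Y -> exists a b : R, [/\ (a != 0) || (b != 0) &
    let c := a *: c1 + b *: c2 in
    (top c Y <= top c X /\ top (- c) Y <= top (- c) X) \/
    (top c X <= top c Y /\ top (- c) X <= top (- c) Y)].
  move=> nz e; exists a, b; split => //=; rewrite -/c e !lexx.
  by have [h|/ltW h] := leP (top (- c) Y) (top (- c) X); [left | right].
have cross u v : (forall s : R, exists a b : R,
      (0 <= s <= 1 -> (a != 0) || (b != 0)) /\
      (1 - s) *: u + s *: v = a *: c1 + b *: c2) ->
    (top u Y <= top u X /\ top v X <= top v Y) \/
    (top u X <= top u Y /\ top v Y <= top v X) ->
    exists a b : R, [/\ (a != 0) || (b != 0) &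
    let c := a *: c1 + b *: c2 in
    (top c Y <= top c X /\ top (- c) Y <= top (- c) X) \/
    (top c X <= top c Y /\ top (- c) X <= top (- c) Y)].
  move=> huv [[h1 h2]|[h1 h2]].
    have [s s01 e] := top_crossing h1 h2.
    have [a [b [nz eab]]] := huv s.
    by apply: (fin a b (nz s01)); rewrite -eab.
  have [s s01 e] := top_crossing h1 h2.
  have [a [b [nz eab]]] := huv s.
  by apply: (fin a b (nz s01)); rewrite -eab.
(* The segment from c1 to - c1 passes through 0, so the path goes round by c2. Either the order of
   the tops changes on one of the two legs, or it is the same at c1, c2 and - c1. *)
have [h1|/ltW h1] := leP (top c1 Y) (top c1 X); have [h2|/ltW h2] := leP (top c2 Y) (top c2 X);
  have [h3|/ltW h3] := leP (top (- c1) Y) (top (- c1) X).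
- by exists 1, 0; rewrite oner_eq0 scale1r scale0r addr0; split => //; left.
- apply: (cross c2 (- c1)); last by left.
  move=> s; exists (- s), (1 - s); split; last by rewrite addrC scaleNr scalerN.
  by move=> /andP[s0 s1]; rewrite oppr_eq0; have [->|//] := eqVneq s 0; rewrite subr0 oner_eq0.
- apply: (cross c1 c2); last by left.
  move=> s; exists (1 - s), s; split => //.
  by move=> /andP[s0 s1]; have [->|//] := eqVneq s 0; rewrite ?subr0 ?oner_eq0 // orbT.
- apply: (cross c1 c2); last by left.
  move=> s; exists (1 - s), s; split => //.
  by move=> /andP[s0 s1]; have [->|//] := eqVneq s 0; rewrite ?subr0 ?oner_eq0 // orbT.
- apply: (cross c1 c2); last by right.
  move=> s; exists (1 - s), s; split => //.
  by move=> /andP[s0 s1]; have [->|//] := eqVneq s 0; rewrite ?subr0 ?oner_eq0 // orbT.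
- apply: (cross c1 c2); last by right.
  move=> s; exists (1 - s), s; split => //.
  by move=> /andP[s0 s1]; have [->|//] := eqVneq s 0; rewrite ?subr0 ?oner_eq0 // orbT.
- apply: (cross c2 (- c1)); last by right.
  move=> s; exists (- s), (1 - s); split; last by rewrite addrC scaleNr scalerN.
  by move=> /andP[s0 s1]; rewrite oppr_eq0; have [->|//] := eqVneq s 0; rewrite subr0 oner_eq0.
- by exists 1, 0; rewrite oner_eq0 scale1r scale0r addr0; split => //; right.
Qed.

End Extremes.

(** * Growth of the sumset in non-degenerate directions *)

Section LightGrowth.
Variables (R : realType) (m : nat).
Implicit Types (X Y Z U : {fset 'rV[R]_m}) (c : 'cV[R]_m) (V W : 'M[R]_m).

Definition nearly_full (T : nmodType) (X Y Z : {fset T}) (e : nat) :=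
  (forall x, x \in X -> (#|` [fset y in Y | (x + y)%R \notin Z]| <= e)%N) /\
  (forall y, y \in Y -> (#|` [fset x in X | (x + y)%R \notin Z]| <= e)%N).

Lemma nearly_fullC (T : nmodType) (X Y Z : {fset T}) e :
  nearly_full X Y Z e -> nearly_full Y X Z e.
Proof.
move=> [h1 h2]; split => x xX.
  apply: leq_trans (h2 x xX); apply: fsubset_leq_card.
  by apply/fsubsetP => y; rewrite !inE addrC.
apply: leq_trans (h1 x xX); apply: fsubset_leq_card.
by apply/fsubsetP => y; rewrite !inE addrC.
Qed.

(* The state of a greedy construction: U is a set of sums which, modulo a space W
   of dimension j, lies over X and Y, and which is nearly contained in Z. *)
Definition grown X Y Z (e k l j : nat) W U : Prop :=
  [/\ (\rank W <= j)%N, U `<=` fsum X Y,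
      forall z, z \in U -> exists2 u, u \in X `|` Y & (z - u <= W)%MS,
      (#|` U `\` Z| <= j.+1 * e)%N &
      (k.*2 + j * (k - l) <= (#|` U|).*2)%N].

Lemma grownC X Y Z e k l j W U : grown X Y Z e k l j W U -> grown Y X Z e k l j W U.
Proof. by rewrite /grown fsumC fsetUC. Qed.

(** The functional c vanishes on W, so every element of U has the height of some point of X or Y, at
    most that of x0. The sums x0 + y with y of positive height are strictly higher, hence new;
    modulo W and x0 they lie over y. *)
Lemma grow_one X Y Z e k l j W U c x0 :
  nearly_full X Y Z e -> grown X Y Z e k l j W U ->
  W *m c = 0 -> x0 \in X ->
  (forall u, u \in X `|` Y -> ht c u <= ht c x0) ->
  (k - l <= (#|` [fset y in Y | (0 < ht c y)%R]|).*2)%N ->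
  exists W' U', grown X Y Z e k l j.+1 W' U'.
Proof.
move=> [hX _] [rW sU mU cZ cU] Wc x0X max0; set Yp := [fset y in Y | _] => hYp.
pose N := [fset x0 + y | y in Yp].
exists (W + <<x0>>)%MS, (U `|` N).
have dis : fdisjoint U N.
  apply/fdisjointP => z zU; apply/negP => /imfsetP[y /= yP ez].
  have [u uXY zu] := mU z zU.
  have : ht c (z - u) = 0.
    by have /submxP[D ->] := zu; apply/eqP; rewrite ht_eq0 -mulmxA Wc mulmx0.
  move: yP; rewrite !inE => /andP[_ yp].
  move=> /eqP; rewrite htB ez htD subr_eq0 => /eqP e1.
  have := max0 u uXY; rewrite -e1 => /(lt_le_trans _).
  by move=> /(_ (ht c x0)); rewrite ltrDl yp => /(_ isT); rewrite ltxx.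
have subN : N `<=` fsum X Y.
  apply/fsubsetP => z /imfsetP[y /= + ->].
  by rewrite !inE => /andP[yY _]; apply: mem_fsum.
split.
- have [h _] := mxrank_adds_leqif W <<x0>>%MS.
  apply: leq_trans h (leq_trans (leq_add rW (_ : _ <= 1)%N) _).
    by rewrite mxrank_gen rank_leq_row.
  by rewrite addn1.
- by rewrite fsubUset sU.
- move=> z; rewrite in_fsetU => /orP[/mU[u uXY zu]|].
    by exists u => //; apply: submx_trans zu (addsmxSl _ _).
  move=> /imfsetP[y /= + ->]; rewrite !inE => /andP[yY _]; exists y.
    by rewrite in_fsetU yY orbT.
  by rewrite addrK (submx_trans _ (addsmxSr _ _)) ?genmxE.
- have sub : (U `|` N) `\` Z `<=` (U `\` Z) `|` [fset x0 + y | y in [fset y in Y | x0 + y \notin Z]].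
    apply/fsubsetP => z; rewrite in_fsetD in_fsetU => /andP[zZ /orP[zU|]].
      by rewrite in_fsetU in_fsetD zZ zU.
    move=> /imfsetP[y /= + ez]; rewrite !inE => /andP[yY _].
    rewrite zZ /=; apply/orP; right; apply/imfsetP; exists y => //=.
    by rewrite !inE yY -ez.
  apply: leq_trans (fsubset_leq_card sub) _.
  apply: leq_trans (leq_card_fsetU _ _) _.
  rewrite [X in (_ <= X)%N]mulSn addnC leq_add //.
  by rewrite card_translate hX.
- rewrite cardfsU (disjoint_fsetI0 dis) cardfs0 subn0 card_translate.
  by rewrite doubleD mulSn addnCA addnC leq_add.
Qed.

(** Functionals vanishing on V are exempt: in the application X and Y meet few cosets of V, so such
    a functional may well vanish on many points. *)
Definition light V X (l : nat) := forall c, V *m c != 0 ->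
  (#|` [fset x in X | ht c x == 0%R]| <= l)%N.

Lemma signs_split c Y k l : #|` Y| = k -> (#|` [fset y in Y | ht c y == 0%R]| <= l)%N ->
  (k - l <= (#|` [fset y in Y | (0 < ht c y)%R]|).*2 \/
   k - l <= (#|` [fset y in Y | (0 < ht (- c) y)%R]|).*2)%N.
Proof.
move=> cY hl.
have : (#|` Y| <= #|` [fset y in Y | ht c y == 0%R]| +
   (#|` [fset y in Y | (0 < ht c y)%R]| + #|` [fset y in Y | (0 < ht (- c) y)%R]|))%N.
  apply: leq_trans (leq_add (leqnn _) (leq_card_fsetU _ _)).
  apply: leq_trans (leq_card_fsetU _ _); apply: fsubset_leq_card.
  apply/fsubsetP => y yY; rewrite !inE yY /= htNc oppr_gt0.
  by case: ltgtP.
rewrite cY; move: hl; set a := #|` _|; set b := #|` _|; set d := #|` _|.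
by clearbody a b d => h1 h2; case: (leqP d b) => h; [left | right]; lia.
Qed.

(** Two spare dimensions of V beyond W are required, in order to have a whole pencil of functionals
    that kill W and of which no nonzero member kills V. This is why the growth stops at
    [(\rank V).-1] steps. *)
Lemma grow_step X Y Z e k l j V W U :
  nearly_full X Y Z e -> 0 \in X -> 0 \in Y -> #|` X| = k -> #|` Y| = k ->
  light V X l -> light V Y l -> (j.+1 < \rank V)%N ->
  grown X Y Z e k l j W U -> exists W' U', grown X Y Z e k l j.+1 W' U'.
Proof.
move=> nf X0 Y0 cX cY lX lY jV g; have [rW _ _ _ _] := g.
pose N := V *m cokermx W.
have rN : (1 < \rank N)%N.
  have e1 := mxrank_mul_ker V (cokermx W).
  have e2 : (\rank (V :&: kermx (cokermx W)) <= j)%N.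
    apply: leq_trans (_ : \rank (kermx (cokermx W)) <= _)%N.
      by apply: mxrankS; apply: capmxSr.
    by rewrite mxrank_ker mxrank_coker subKn // rank_leq_col.
  rewrite -(leq_add2r (\rank (V :&: kermx (cokermx W)))) /N e1.
  exact: leq_trans (leq_add (leqnn 2) e2) jV.
have [c1 [c2 [W1 W2 ind]]] : exists c1 c2 : 'cV_m, [/\ W *m c1 = 0, W *m c2 = 0 &
    forall a b : R, (a != 0) || (b != 0) -> V *m (a *: c1 + b *: c2) != 0].
  have [j1 hj1] : exists j1, row j1 N^T != 0.
    apply: contrapT => h; move: rN; suff -> : N = 0 by rewrite mxrank0.
    apply: trmx_inj; rewrite trmx0; apply/row_matrixP => i; rewrite row0.
    by apply: contrapT => /eqP ?; apply: h; exists i.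
  have [j2 hj2] : exists j2, ~~ (row j2 N^T <= row j1 N^T)%MS.
    apply: contrapT => h; move: rN; rewrite -mxrank_tr ltnNge => /negP; apply.
    apply: leq_trans (rank_leq_row (row j1 N^T)); apply: mxrankS.
    apply/row_subP => i; apply: contrapT => /negP ?; apply: h; by exists i.
  have cm (A : 'M[R]_m) j' : A *m col j' (cokermx W) = col j' (A *m cokermx W).
    by rewrite !colE mulmxA.
  exists (col j1 (cokermx W)), (col j2 (cokermx W)).
  rewrite !cm mulmx_coker !colE !mul0mx; split => // a b nz.
  rewrite mulmxDr -!scalemxAr -!colE !cm -/N; apply/negP => /eqP h.
  have {}h : a *: row j1 N^T + b *: row j2 N^T = 0.
    by have := congr1 trmx h; rewrite linearD !linearZ /= !tr_col trmx0.
  have [b0|b0] := eqVneq b 0.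
    move: nz h; rewrite b0 eqxx orbF scale0r addr0 => a0 /eqP.
    by rewrite scaler_eq0 (negPf a0) (negPf hj1).
  case/negP: hj2; rewrite -(scale1r (row j2 _)) -(mulVf b0) -scalerA.
  move/eqP: h; rewrite addrC addr_eq0 => /eqP ->.
  by rewrite scalemx_sub // eqmx_opp scalemx_sub.
(* Which of c and - c is positive on half of the other set cannot be prescribed, so one and the same
   set must contain the highest points for both c and - c. *)
have [a [b [nz hc]]] := common_extremes c1 c2 X Y.
move: hc; set c := a *: c1 + b *: c2.
have Wc : W *m c = 0 by rewrite mulmxDr -!scalemxAr W1 W2 !scaler0 addr0.
have Wnc : W *m (- c) = 0 by rewrite mulmxN Wc oppr0.
have Vc := ind a b nz.
have side (X' Y' : {fset 'rV[R]_m}) : nearly_full X' Y' Z e -> 0 \in X' -> #|` Y'| = k ->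
   light V Y' l -> grown X' Y' Z e k l j W U ->
   top c Y' <= top c X' -> top (- c) Y' <= top (- c) X' ->
   exists W' U', grown X' Y' Z e k l j.+1 W' U'.
  move=> nf' X'0 cY' lY' g' h1 h2.
  have aux c' : W *m c' = 0 -> top c' Y' <= top c' X' ->
     (k - l <= (#|` [fset y in Y' | (0 < ht c' y)%R]|).*2)%N ->
     exists W' U', grown X' Y' Z e k l j.+1 W' U'.
    move=> Wc' h hp; have [x0 x0X ex0] := top_attained c' X'0.
    apply: (grow_one nf' g' Wc' x0X _ hp) => u; rewrite ex0 in_fsetU => /orP[uX|uY].
      exact: le_top.
    exact: le_trans (le_top c' uY) h.
  by case: (signs_split cY' (lY' c Vc)) => hp; [apply: (aux c) | apply: (aux (- c))].
move=> [[h1 h2]|[h1 h2]]; first exact: side.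
have [W' [U' gU']] := side Y X (nearly_fullC nf) Y0 cX lX (grownC g) h1 h2.
by exists W', U'; apply: grownC.
Qed.

(* In the directions of V the dense pieces of X and Y are not degenerate, and
   each further dimension yields a half translate of new sums. *)
Theorem light_growth X Y Z e k l V :
  nearly_full X Y Z e -> 0 \in X -> 0 \in Y -> #|` X| = k -> #|` Y| = k ->
  light V X l -> light V Y l -> (0 < \rank V)%N ->
  (k.*2 + (\rank V).-1 * (k - l) <= (#|` Z| + \rank V * e).*2)%N.
Proof.
move=> nf X0 Y0 cX cY lX lY V0.
suff [W [U [_ _ _ h1 h2]]] : exists W U, grown X Y Z e k l (\rank V).-1 W U.
  apply: leq_trans h2 _; rewrite leq_double.
  rewrite -(cardfsID Z U) leq_add //; last by rewrite prednK in h1.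
  by apply: fsubset_leq_card; apply: fsubsetIr.
have : ((\rank V).-1 < \rank V)%N by rewrite ltn_predL.
elim: (_.-1) => [|j IH] hj.
  exists 0, [fset 0 + y | y in Y]; split; rewrite ?mxrank0 //.
  - by apply/fsubsetP => z /imfsetP[y /= yY ->]; apply: mem_fsum.
  - move=> z /imfsetP[y /= yY ->]; exists y; first by rewrite in_fsetU yY orbT.
    by rewrite add0r subrr sub0mx.
  - rewrite mul1n; apply: leq_trans (nf.1 0 X0).
    rewrite -(card_translate [fset y in Y | 0 + y \notin Z] 0).
    apply: fsubset_leq_card; apply/fsubsetP => z; rewrite in_fsetD => /andP[zZ].
    by move=> /imfsetP[y /= yY ez]; apply/imfsetP; exists y; rewrite //= !inE yY -ez.
  - by rewrite card_translate cY mul0n addn0.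
have [W [U g]] := IH (ltnW hj).
exact: (grow_step nf X0 Y0 cX cY lX lY hj g).
Qed.

End LightGrowth.

(** * Compression of fibres over a quotient *)

Lemma card_fset_fibers (T I : choiceType) (f : T -> I) (A : {fset T}) :
  #|` A| = (\sum_(z <- [fset f x | x in A]) #|` [fset x in A | f x == z]|)%N.
Proof.
rewrite card_fset_sum1 (partition_big_imfset _ f) /=.
apply: eq_fbig => // z _; rewrite card_fset_sum1 big_fset_condE.
by apply: eq_fbigl => x; rewrite !inE.
Qed.

Lemma card_imfset2_le (T1 T2 T : choiceType) (f : T1 -> T2 -> T) (A : {fset T1}) (B : {fset T2}) :
  (#|` [fset f a b | a in A, b in B]| <= #|` A| * #|` B|)%N.
Proof.
pose S := [fset z in [seq f a b | a <- A, b <- B]].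
apply: (@leq_trans #|` S|).
  apply: fsubset_leq_card; apply/fsubsetP => z /imfset2P[a aA [b bB ->]].
  by rewrite in_fset /=; apply: allpairs_f.
by rewrite card_fseq (leq_trans (size_undup _)) // size_allpairs.
Qed.

Lemma card_fsum_le (V : nmodType) (A B : {fset V}) :
  (#|` fsum A B| <= #|` A| * #|` B|)%N.
Proof. exact: card_imfset2_le. Qed.

Lemma card_fset_fibers_le (T I : choiceType) (f : T -> I) (A : {fset T}) (L : {fset I}) :
  (\sum_(z <- L) #|` [fset x in A | f x == z]| <= #|` A|)%N.
Proof.
have -> : (\sum_(z <- L) #|` [fset x in A | f x == z]| =
           \sum_(z <- L) \sum_(x <- A) (f x == z))%N.
  apply: eq_fbigr => z _ _; rewrite card_fset_sum1 -big_fset_condE /=.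
  by rewrite big_mkcond; apply: eq_fbigr => x _ _; case: eqP.
rewrite exchange_big /= card_fset_sum1; apply: leq_sum => x _.
have [xL|xL] := boolP (f x \in L).
  rewrite (big_fsetD1 (f x)) //= eqxx big_seq big1 ?addn0 // => z.
  by rewrite in_fsetD1 eq_sym => /andP[/negPf ->].
by rewrite big_seq big1 // => z zL; case: eqP => // e; move: xL; rewrite e zL.
Qed.

Section Fibers.
Variables (R : realFieldType) (m : nat).
Implicit Types (X Y Z : {fset 'rV[R]_m}) (V : 'M[R]_m).

Definition fiber V X (u : 'rV[R]_m) := [fset x in X | x *m cokermx V == u].

Variables (c : 'cV[R]_m) (V : 'M[R]_m).

Definition fiber_index X x : nat :=
  #|` [fset x' in fiber V X (x *m cokermx V) | ht c x' < ht c x]|.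

(* The fibres of X over the quotient by V are replaced by initial segments of
   a new coordinate axis. *)
Definition compression X : {fset 'rV[R]_(m + 1)} :=
  [fset row_mx (x *m cokermx V) (fiber_index X x)%:R%:M | x in X].

Lemma fiber_index_lt X x : x \in X ->
  (fiber_index X x < #|` fiber V X (x *m cokermx V)|)%N.
Proof.
move=> xX; apply: fproper_ltn_card; rewrite fproperE; apply/andP; split.
  by apply/fsubsetP => y; rewrite !inE => /andP[].
by apply/negP => /fsubsetP /(_ x); rewrite !inE xX eqxx ltxx => /(_ isT).
Qed.

Lemma compression_inj X : {in X &, injective (ht c)} ->
  {in X &, injective (fun x => row_mx (x *m cokermx V) (fiber_index X x)%:R%:M : 'rV[R]_(m + 1))}.
Proof.
move=> inj x y xX yX /eq_row_mx[e1 e2].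
have {}e2 : fiber_index X x = fiber_index X y.
  have := congr1 (fun A : 'M[R]_1 => A 0 0) e2; rewrite !mxE eqxx !mulr1n.
  by move/eqP; rewrite eqr_nat => /eqP.
apply: inj => //; apply/eqP; move: e2; apply: contra_eqT.
wlog lt : x y xX yX e1 / ht c x < ht c y.
  move=> h; case: ltgtP => // lt _; last by rewrite eq_sym (h y x) // lt_eqF.
  by rewrite (h x y) // lt_eqF.
move=> _; rewrite neq_ltn; apply/orP; left; apply: fproper_ltn_card.
rewrite fproperE; apply/andP; split.
  by apply/fsubsetP => z; rewrite !inE e1 => /andP[-> /= /lt_trans]; apply.
by apply/negP => /fsubsetP /(_ x); rewrite !inE xX e1 eqxx ltxx lt => /(_ isT).
Qed.

Lemma card_compression X : {in X &, injective (ht c)} -> #|` compression X| = #|` X|.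
Proof. by move=> inj; rewrite card_in_imfset //; apply: compression_inj. Qed.

Lemma fset_max (T : choiceType) (f : T -> R) (X : {fset T}) :
  X != fset0 -> exists2 a, a \in X & forall x, x \in X -> f x <= f a.
Proof.
move=> /(fset_min (fun x => - f x))[a aX h]; exists a => // x xX.
by rewrite -lerN2; apply: h.
Qed.

(* A least element x0 of one fibre and a greatest element y1 of the other:
   the row of x0 and the column of y1 meet only in x0 + y1. *)
Lemma fiber_sums X Y Z e x y :
  {in X &, injective (ht c)} -> {in Y &, injective (ht c)} ->
  nearly_full X Y Z e -> x \in X -> y \in Y ->
  (#|` fiber V X (x *m cokermx V)| + #|` fiber V Y (y *m cokermx V)| <=
   #|` fiber V Z ((x + y) *m cokermx V)| + e.*2 + 1)%N.
Proof.
move=> injX injY [nfX nfY] xX yY.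
set A := fiber V X _; set B := fiber V Y _.
have xA : x \in A by rewrite !inE xX eqxx.
have yB : y \in B by rewrite !inE yY eqxx.
have [|x0 x0A x0min] := @fset_min _ _ (ht c) A; first by apply/fset0Pn; exists x.
have [|y1 y1B y1max] := @fset_max _ (ht c) B; first by apply/fset0Pn; exists y.
have AX w : w \in A -> w \in X by rewrite !inE => /andP[].
have BY w : w \in B -> w \in Y by rewrite !inE => /andP[].
pose S1 := [fset x0 + y | y in B]; pose S2 := [fset y1 + x | x in A `\ x0].
have dis : fdisjoint S1 S2.
  apply/fdisjointP => z /imfsetP[y' /= y'B ->]; apply/negP => /imfsetP[x' /=].
  rewrite in_fsetD1 => /andP[x'x x'A] e1.
  have lt : ht c x0 < ht c x'.
    rewrite lt_neqAle x0min // andbT; apply: contra_neq x'x => e2.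
    by apply: injX; rewrite ?AX.
  have := y1max y' y'B; rewrite -(lerD2l (ht c x0)) -htD e1 htD addrC.
  by rewrite lerD2r leNgt lt.
have cS : (#|` S1 `|` S2|.+1 = #|` A| + #|` B|)%N.
  rewrite cardfsU (disjoint_fsetI0 dis) cardfs0 subn0 !card_translate.
  by rewrite (cardfsD1 x0 A) x0A add1n addSn addnC.
have bad : (#|` (S1 `|` S2) `\` Z| <= e.*2)%N.
  have sub : (S1 `|` S2) `\` Z `<=`
     [fset x0 + y | y in [fset y in Y | x0 + y \notin Z]] `|`
     [fset y1 + x | x in [fset x in X | x + y1 \notin Z]].
    apply/fsubsetP => z; rewrite in_fsetD in_fsetU => /andP[zZ /orP[|]].
      move=> /imfsetP[y' /= y'B ez]; rewrite in_fsetU; apply/orP; left.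
      by apply/imfsetP; exists y' => //=; rewrite !inE BY // -ez.
    move=> /imfsetP[x' /=]; rewrite in_fsetD1 => /andP[_ x'A] ez.
    rewrite in_fsetU; apply/orP; right.
    by apply/imfsetP; exists x' => //=; rewrite !inE AX // addrC -ez.
  apply: leq_trans (fsubset_leq_card sub) _.
  apply: leq_trans (leq_card_fsetU _ _) _.
  by rewrite !card_translate -addnn leq_add // ?nfX ?nfY ?AX ?BY.
have good : (#|` (S1 `|` S2) `&` Z| <= #|` fiber V Z ((x + y) *m cokermx V)|)%N.
  apply: fsubset_leq_card; apply/fsubsetP => z; rewrite in_fsetI => /andP[+ zZ].
  rewrite !inE zZ /= mulmxDl => /orP[|].
    move=> /imfsetP[y' /= y'B ->]; rewrite mulmxDl.
    by move: x0A y'B; rewrite !inE => /andP[_ /eqP ->] /andP[_ /eqP ->].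
  move=> /imfsetP[x' /=]; rewrite in_fsetD1 => /andP[_ x'A] ->.
  rewrite mulmxDl addrC.
  by move: x'A y1B; rewrite !inE => /andP[_ /eqP ->] /andP[_ /eqP ->].
rewrite -cS -(cardfsID Z (S1 `|` S2)) -[X in (X <= _)%N]addn1 leq_add2r.
exact: leq_add.
Qed.

(** Compressed fibres are initial segments, so all pairs of fibres over the same label have nested
    sums and only the largest pair counts. [fiber_sums] compares it with the fibre of Z, and the
    error [e.*2] is paid once per label. *)
Lemma compression_sums X Y Z e :
  {in X &, injective (ht c)} -> {in Y &, injective (ht c)} ->
  nearly_full X Y Z e ->
  (#|` fsum (compression X) (compression Y)| <=
   #|` Z| + #|` [fset x *m cokermx V | x in X]| * #|` [fset y *m cokermx V | y in Y]| * e.*2)%N.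
Proof.
move=> injX injY nf; set T := fsum _ _; pose lab (p : 'rV[R]_(m + 1)) := lsubmx p.
rewrite (card_fset_fibers lab T).
set L := [fset lab p | p in T].
have cL : (#|` L| <= #|` [fset x *m cokermx V | x in X]| * #|` [fset y *m cokermx V | y in Y]|)%N.
  apply: leq_trans (_ : #|` fsum [fset x *m cokermx V | x in X] [fset y *m cokermx V | y in Y]| <= _)%N.
    apply: fsubset_leq_card; apply/fsubsetP => z /imfsetP[p /= + ->].
    move=> /fsumP[x1 [y1 [/imfsetP[x /= xX ->] /imfsetP[y /= yY ->] ->]]].
    rewrite /lab add_row_mx row_mxKl; apply: mem_fsum.
      by apply/imfsetP; exists x.
    by apply/imfsetP; exists y.
  exact: card_fsum_le.
have key z : z \in L -> (#|` [fset p in T | lab p == z]| <= #|` fiber V Z z| + e.*2)%N.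
  move=> /imfsetP[p0 /= p0T ez].
  pose a x := #|` fiber V X (x *m cokermx V)|.
  pose b y := #|` fiber V Y (y *m cokermx V)|.
  have coord p : p \in T -> exists x y, [/\ x \in X, y \in Y,
      lab p = (x + y) *m cokermx V &
      p = row_mx ((x + y) *m cokermx V) (fiber_index X x + fiber_index Y y)%:R%:M].
    move=> /fsumP[_ [_ [/imfsetP[x /= xX ->] /imfsetP[y /= yY ->] ->]]].
    exists x, y; rewrite /lab add_row_mx row_mxKl mulmxDl; split => //.
    by rewrite natrD -raddfD.
  pose N := \max_(q : X * Y | (val q.1 + val q.2) *m cokermx V == z) (a (val q.1) + b (val q.2)).-1.
  have upper : (#|` [fset p in T | lab p == z]| <= N)%N.
    pose tgt := [fset p in [seq (row_mx z (t%:R%:M) : 'rV[R]_(m + 1)) | t <- iota 0 N]].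
    apply: (@leq_trans #|` tgt|).
      apply: fsubset_leq_card; apply/fsubsetP => p; rewrite !inE => /andP[pT /eqP lp].
      have [x [y [xX yY l1 ->]]] := coord p pT.
      apply/mapP; exists (fiber_index X x + fiber_index Y y)%N; last by rewrite -l1 lp.
      rewrite mem_iota /= add0n.
      have hq : (val [` xX] + val [` yY]) *m cokermx V == z by rewrite /= -l1 lp.
      apply: leq_trans (@leq_bigmax_cond _ _ _ ([` xX], [` yY]) hq) => /=.
      have := fiber_index_lt xX; have := fiber_index_lt yY; rewrite -/(a x) -/(b y); lia.
    by rewrite card_fseq (leq_trans (size_undup _)) // size_map size_iota.
  apply: leq_trans upper _; apply/bigmax_leqP => -[[x xX] [y yY]] /= /eqP <-.
  rewrite -subn1 leq_subLR [X in (_ <= X)%N]addnC.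
  exact: (fiber_sums injX injY nf xX yY).
apply: leq_trans (_ : \sum_(z <- L) (#|` fiber V Z z| + e.*2) <= _)%N.
  by rewrite !big_seq; apply: leq_sum => z; exact: key.
rewrite big_split /=; apply: leq_add; first exact: card_fset_fibers_le.
by rewrite big_const_seq count_predT iter_addn_0 mulnC leq_mul2r cL orbT.
Qed.

(** Passing to the quotient costs at most [\rank V] dimensions. The new axis gives one back: by
    pigeonhole two points of X share a fibre, and their images differ along that axis. *)
Lemma rank_dirmx_compression X Y :
  {in X &, injective (ht c)} ->
  (#|` [fset x *m cokermx V | x in X]| < #|` X|)%N ->
  (\rank (dirmx X Y) - \rank V < \rank (dirmx (compression X) (compression Y)))%N.
Proof.
move=> inj small; set D := dirmx X Y; set D' := dirmx _ _.
pose P : 'M[R]_(m + 1, m) := col_mx 1%:M 0.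
pose v : 'rV[R]_(m + 1) := row_mx 0 1%:M.
have vP : v *m P = 0 by rewrite mul_row_col mul0mx mulmx0 addr0.
have comp (X' : {fset 'rV[R]_m}) x : x \in X' ->
   row_mx (x *m cokermx V) (fiber_index X' x)%:R%:M \in compression X'.
  by move=> xX; apply/imfsetP; exists x.
have vD : (v <= D')%MS.
  have [x [y [xX yX xy e1]]] : exists x y, [/\ x \in X, y \in X, x != y &
      x *m cokermx V = y *m cokermx V].
    apply: contrapT => h; move: small; rewrite ltnNge => /negP; apply.
    rewrite card_in_imfset // => x y xX yX e1; apply: contrapT => /eqP ?.
    by apply: h; exists x, y.
  have e2 : (fiber_index X x)%:R - (fiber_index X y)%:R != 0 :> R.
    rewrite subr_eq0; apply: contra_neq xy => e2; apply: (compression_inj inj) => //.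
    by rewrite e1 e2.
  have := dirmx_subl (compression Y) (comp _ _ xX) (comp _ _ yX).
  rewrite opp_row_mx add_row_mx e1 subrr -raddfB /= => h.
  have -> : v = ((fiber_index X x)%:R - (fiber_index X y)%:R)^-1 *:
     row_mx 0 ((fiber_index X x)%:R - (fiber_index X y)%:R)%:M.
    by rewrite scale_row_mx scaler0 scale_scalar_mx mulVf.
  exact: scalemx_sub.
have DP : (D *m cokermx V <= D' *m P)%MS.
  have : (D <= kermx (cokermx V *m cokermx (D' *m P)))%MS.
    have aux (A : 'M[R]_(1, m)) : (A *m cokermx V <= D' *m P)%MS ->
      (A <= kermx (cokermx V *m cokermx (D' *m P)))%MS.
      by rewrite submxE => /eqP h; apply/sub_kermxP; rewrite mulmxA.
    apply/dirmxP; split => x y xX yX; apply: aux.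
      have := dirmx_subl (compression Y) (comp _ _ xX) (comp _ _ yX).
      move=> /(submxMr P); rewrite mulmxBl !mul_row_col !mulmx0 !addr0 !mulmx1.
      by rewrite mulmxBl.
    have := dirmx_subr (compression X) (comp _ _ xX) (comp _ _ yX).
    move=> /(submxMr P); rewrite mulmxBl !mul_row_col !mulmx0 !addr0 !mulmx1.
    by rewrite mulmxBl.
  by move=> /sub_kermxP h; rewrite submxE -mulmxA h.
have e1 := mxrank_mul_ker D' P.
have h1 : (0 < \rank (D' :&: kermx P))%N.
  rewrite lt0n mxrank_eq0; apply/negP => /eqP h0.
  have : (v <= D' :&: kermx P)%MS.
    by rewrite sub_capmx vD; apply/sub_kermxP.
  rewrite h0 submx0 => /eqP /(congr1 (@rsubmx _ _ _ _)) /eqP.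
  by rewrite row_mxKr linear0 oner_eq0.
have e2 := mxrank_mul_ker D (cokermx V).
have h2 : (\rank (D :&: kermx (cokermx V)) <= \rank V)%N.
  apply: leq_trans (_ : \rank (kermx (cokermx V)) <= _)%N.
    by apply: mxrankS; apply: capmxSr.
  by rewrite mxrank_ker mxrank_coker subKn // rank_leq_col.
have h3 := mxrankS DP.
rewrite -e1 -e2; move: h1 h2 h3.
move: (\rank _) (\rank _) (\rank _) (\rank _) (\rank _) => r1 r2 r3 r4 r5; lia.
Qed.

End Fibers.

Theorem fiber_growth (R : realFieldType) (m : nat) (X Y Z : {fset 'rV[R]_m}) (V : 'M[R]_m)
    (e k M q : nat) :
  nearly_full X Y Z e -> #|` X| = k -> #|` Y| = k ->
  (#|` [fset x *m cokermx V | x in X]| <= M)%N ->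
  (#|` [fset y *m cokermx V | y in Y]| <= M)%N ->
  (M < k)%N -> (q <= \rank (dirmx X Y) - \rank V)%N -> (4 * q.+2 <= k)%N ->
  ((q.+2 * k).*2 <= (#|` Z| + M * M * e.*2).*2 + q.+1 * q.+2)%N.
Proof.
move=> nf cX cY hX hY Mk hq hk.
have [c sep] := separating_functional
  [seq x - y | x <- X ++ Y : seq 'rV[R]_m, y <- X ++ Y].
have inj A : {subset A <= (X ++ Y : seq 'rV[R]_m)} -> {in A &, injective (ht c)}.
  move=> sA x y xA yA e1; apply/eqP; rewrite -subr_eq0; apply/negPn/negP => nz.
  have /sep /(_ nz) : x - y \in [seq x - y | x <- X ++ Y : seq 'rV[R]_m, y <- X ++ Y].
    by apply: allpairs_f; apply: sA.
  by rewrite htB e1 subrr eqxx.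
have injX : {in X &, injective (ht c)} by apply: inj => x xX; rewrite mem_cat xX.
have injY : {in Y &, injective (ht c)}.
  by apply: inj => x xY; rewrite mem_cat xY orbT.
have rk := rank_dirmx_compression Y injX (V := V).
rewrite cX in rk; have {}rk := rk (leq_ltn_trans hX Mk).
have up := compression_sums V injX injY nf.
have {}up : (#|` fsum (compression c V X) (compression c V Y)| <= #|` Z| + M * M * e.*2)%N.
  apply: leq_trans up _; rewrite leq_add2l leq_mul2r; apply/orP; right.
  exact: leq_mul.
case: k cX cY Mk hk rk => // k cX cY Mk hk rk.
have [] := @freiman _ _ (compression c V X) (compression c V Y) k.
- by rewrite card_compression.
- by rewrite card_compression.
have {hq}rk := leq_ltn_trans hq rk.
move: rk up; set d := \rank _; set s := #|` _|; set x := (M * M * _)%N; set z := #|` _|.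
clearbody d s x z => rk up f1 f2.
(* The first bound of [freiman] increases with d only up to about k. Beyond that the quadratic bound
   exceeds the target, because 4 (q + 2) <= k. *)
have [dk|dk] := leqP d k; first by clear -rk up f1 hk dk; nia.
by clear -up f2 hk dk; nia.
Qed.

(** The linear bound serves while 3 (d + 2) <= 4 k and the quadratic one afterwards; the factor 1/3
    is what both give at the crossing. *)
Lemma freiman_third (F : realFieldType) (m : nat) (A B : {fset 'rV[F]_m}) k :
  #|` A| = k -> #|` B| = k -> (0 < k)%N ->
  ((\rank (dirmx A B)).+2 * k <= 3 * #|` fsum A B|)%N.
Proof.
case: k => // k cA cB _; have [] := freiman cA cB.
set d := \rank _; set s := #|` _|; clearbody d s => h1 h2.
have [h|h] := leqP (3 * d.+2) (4 * k.+1); first by clear h2; nia.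
by clear h1; nia.
Qed.

(** * Dense cosets *)

Section Dense.
Variables (R : realType) (m : nat) (X Y : {fset 'rV[R]_m}) (k T : nat).
Implicit Types (V : 'M[R]_m).

Let d := \rank (dirmx X Y).

Definition coset_part V (A : {fset 'rV[R]_m}) p := [fset x in A | (x - p <= V)%MS].

(** The threshold drops by a factor T with each dimension lost. A subspace too small to be dense
    therefore misses by T the density of the minimal V, and T is chosen to outweigh the number of
    cosets. *)
Definition dense V (A : {fset 'rV[R]_m}) :=
  exists p, (k <= T ^ (d - \rank V) * #|` coset_part V A p|)%N.

Definition dense_rank (j : nat) :=
  exists V, [/\ \rank V = j, (V <= dirmx X Y)%MS & dense V X \/ dense V Y].

Lemma dense_rank_full : #|` X| = k -> (0 < k)%N -> dense_rank d.
Proof.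
move=> cX k0; exists (dirmx X Y); split => //; left.
have [p pX] : exists p, p \in X by apply/fset0Pn; rewrite -cardfs_gt0 cX.
exists p; rewrite subnn expn0 mul1n -cX; apply: fsubset_leq_card.
by apply/fsubsetP => x xX; rewrite !inE xX /=; apply: dirmx_subl.
Qed.

Lemma dense_rank0 : (T ^ d < k)%N -> ~ dense_rank 0.
Proof.
move=> Tk [V [rV _ h]].
have aux (A : {fset 'rV[R]_m}) : ~ dense V A.
  move=> [p]; rewrite leqNgt => /negP; apply.
  rewrite rV subn0; apply: leq_ltn_trans Tk.
  rewrite -[X in (_ <= X)%N]muln1 leq_mul2l; apply/orP; right.
  apply: (@leq_trans #|` [fset p]|); last by rewrite cardfs1.
  apply: fsubset_leq_card; apply/fsubsetP => x.
  rewrite !inE => /andP[_]; move/eqP: rV; rewrite mxrank_eq0 => /eqP ->.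
  by rewrite submx0 subr_eq0.
by case: h; exact: aux.
Qed.

Lemma coset_partE V (A : {fset 'rV[R]_m}) p :
  coset_part V A p = fiber V A (p *m cokermx V).
Proof.
apply/fsetP => x; rewrite !inE submxE mulmxBl subr_eq0 //.
Qed.

(** For each coset met by B, one translate of the part of A lies in A + B, and translates for
    distinct cosets are disjoint. *)
Lemma card_labels V (A B : {fset 'rV[R]_m}) p :
  (#|` coset_part V A p| * #|` [fset y *m cokermx V | y in B]| <= #|` fsum A B|)%N.
Proof.
set L := [fset _ | y in B].
pose lab (z : 'rV[R]_m) := (z - p) *m cokermx V.
apply: leq_trans (card_fset_fibers_le lab (fsum A B) L).
apply: (@leq_trans (\sum_(z <- L) #|` coset_part V A p|)).
  by rewrite big_const_seq count_predT iter_addn_0 leq_mul2l; apply/orP; right; exact: leqnn.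
rewrite !big_seq; apply: leq_sum => z /imfsetP[y /= yB ->].
rewrite -(card_translate _ y); apply: fsubset_leq_card; apply/fsubsetP => w.
move=> /imfsetP[x /=]; rewrite !inE => /andP[xA xp] ->.
rewrite addrC mem_fsum //= /lab addrAC mulmxDl.
by move: xp; rewrite submxE => /eqP ->; rewrite add0r.
Qed.

Lemma large_coset V (A : {fset 'rV[R]_m}) : (0 < #|` A|)%N ->
  exists2 p, p \in A &
    (#|` A| <= #|` coset_part V A p| * #|` [fset y *m cokermx V | y in A]|)%N.
Proof.
move=> A0; rewrite cardfs_gt0 in A0.
have [p pA pmax] := fset_max (fun p => (#|` coset_part V A p|)%:R : R) A0.
exists p => //; rewrite {1}(card_fset_fibers (fun y => y *m cokermx V) A).
apply: (@leq_trans (\sum_(z <- [fset y *m cokermx V | y in A]) #|` coset_part V A p|)).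
  rewrite !big_seq; apply: leq_sum => z /imfsetP[y /= yA ->].
  by rewrite -/(fiber V A _) -coset_partE -(ler_nat R) pmax.
by rewrite big_const_seq count_predT iter_addn_0.
Qed.

(** Small doubling is used twice: a dense coset in one set limits the cosets met by the other, which
    then has a large coset by pigeonhole, and this limits the cosets met by the first. *)
Lemma few_labels V K : (0 < K)%N -> #|` X| = k -> #|` Y| = k -> (0 < k)%N ->
  (#|` fsum X Y| <= K * k)%N -> dense V X \/ dense V Y ->
  (#|` [fset x *m cokermx V | x in X]| <= K * (K * T ^ (d - \rank V)) /\
   #|` [fset x *m cokermx V | x in Y]| <= K * (K * T ^ (d - \rank V)))%N.
Proof.
move=> K0 cX cY k0 hK.
have aux (A B : {fset 'rV[R]_m}) : #|` A| = k -> #|` B| = k ->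
    (#|` fsum A B| <= K * k)%N -> dense V A ->
  (#|` [fset x *m cokermx V | x in A]| <= K * (K * T ^ (d - \rank V)) /\
   #|` [fset x *m cokermx V | x in B]| <= K * (K * T ^ (d - \rank V)))%N.
  move=> cA cB hAB [p hp].
  have hB := leq_trans (card_labels V A B p) hAB.
  have [|p' _ hp'] := @large_coset V B; first by rewrite cB.
  have hA : (#|` coset_part V B p'| * #|` [fset x *m cokermx V | x in A]| <= K * k)%N.
    by apply: leq_trans (card_labels V B A p') _; rewrite fsumC.
  rewrite cB in hp'; move: hp hB hp' hA.
  set t := (T ^ _)%N; set a := #|` coset_part _ A _|; set b := #|` coset_part _ B _|.
  set lb := #|` _|; set la := #|` _|; clearbody t a b la lb => h1 h2 h3 h4.
  have hlb : (lb <= K * t)%N.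
    have : (0 < a)%N by case: (a) h1; rewrite ?muln0 ?leqn0 => // /eqP; lia.
    by move=> a0; rewrite -(leq_pmul2l a0); clear -h1 h2; nia.
  have hla : (la <= K * lb)%N.
    have : (0 < b)%N by case: (b) h3; rewrite ?mul0n ?leqn0 => // /eqP; lia.
    by move=> b0; rewrite -(leq_pmul2l b0); clear -h3 h4; nia.
  split; first by apply: leq_trans hla _; rewrite leq_mul2l hlb orbT.
  by apply: leq_trans hlb _; rewrite leq_mul2l leq_pmull ?orbT.
case => h; first exact: aux.
have hK' : (#|` fsum Y X| <= K * k)%N by rewrite fsumC.
by have [] := aux Y X cY cX hK' h.
Qed.

(** Within a coset of V, the zeros of c lie in a coset of the intersection of V with the kernel of
    c. This space has smaller rank, hence no dense coset, so each part is small; the parts are then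
    summed over the few cosets of V. *)
Lemma light_of_minimal V K l : (0 < T)%N ->
  (forall j, dense_rank j -> (\rank V <= j)%N) -> (V <= dirmx X Y)%MS ->
  (#|` [fset x *m cokermx V | x in X]| <= K * T ^ (d - \rank V) /\
   #|` [fset x *m cokermx V | x in Y]| <= K * T ^ (d - \rank V))%N ->
  (forall s, T * s <= K * k -> s <= l)%N -> light V X l /\ light V Y l.
Proof.
move=> T0 vmin VD lab hl.
have aux (A : {fset 'rV[R]_m}) : (A = X \/ A = Y) ->
   (#|` [fset x *m cokermx V | x in A]| <= K * T ^ (d - \rank V))%N -> light V A l.
  move=> hA hlab c Vc; set B := [fset x in A | _].
  rewrite (card_fset_fibers (fun y => y *m cokermx V) B).
  set L := [fset _ | _ in B].
  have cL : (#|` L| <= K * T ^ (d - \rank V))%N.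
    apply: leq_trans hlab; apply: fsubset_leq_card; apply/fsubsetP => z.
    by move=> /imfsetP[x /=]; rewrite !inE => /andP[xA _] ->; apply/imfsetP; exists x.
  pose V' := (V :&: kermx c)%MS.
  have rV' : (\rank V' < \rank V)%N.
    rewrite -(mxrank_mul_ker V c) -[X in (X < _)%N]add0n ltn_add2r.
    by rewrite lt0n mxrank_eq0.
  have V'D : (V' <= dirmx X Y)%MS by apply: submx_trans VD; apply: capmxSl.
  have ndense : ~ dense V' A.
    move=> h; have : dense_rank (\rank V').
      by exists V'; split => //; case: hA h => ->; [left | right].
    by move=> /vmin; rewrite leqNgt rV'.
  have rVd : (\rank V <= d)%N by apply: mxrankS.
  have part z : z \in L -> (T ^ (d - \rank V).+1 * #|` [fset x in B | x *m cokermx V == z]| <= k)%N.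
    move=> /imfsetP[x0 /= x0B ->].
    have sub : [fset x in B | x *m cokermx V == x0 *m cokermx V] `<=` coset_part V' A x0.
      apply/fsubsetP => x; move: x0B; rewrite !inE => /andP[x0A /eqP h0] /andP[/andP[xA /eqP h1] h2].
      rewrite xA /= sub_capmx; apply/andP; split.
        by rewrite submxE mulmxBl subr_eq0.
      by apply/sub_kermxP/eqP; rewrite -ht_eq0 htB h0 h1 subrr.
    apply: leq_trans (_ : T ^ (d - \rank V') * #|` coset_part V' A x0| <= _)%N.
      apply: leq_mul; last exact: fsubset_leq_card.
      by rewrite leq_pexp2l //; clear -rV' rVd; lia.
    by rewrite leqNgt; apply/negP => /ltnW h; apply: ndense; exists x0.
  have : (T ^ (d - \rank V).+1 * \sum_(z <- L) #|` [fset x in B | x *m cokermx V == z]| <= #|` L| * k)%N.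
    rewrite big_distrr /= -[X in (_ <= X)%N]/(_ * _)%N.
    apply: (@leq_trans (\sum_(z <- L) k)%N).
      by rewrite !big_seq; apply: leq_sum => z; exact: part.
    by rewrite big_const_seq count_predT iter_addn_0 mulnC.
  set s := (\sum_(z <- L) _)%N; have : (0 < T ^ (d - \rank V))%N by rewrite expn_gt0 T0.
  move: cL; rewrite expnS; move: (T ^ (d - _))%N (#|` L|) => t a h1 h2 h3.
  have : (T * t * s <= K * t * k)%N.
    by apply: leq_trans h3 _; rewrite leq_mul2r h1 orbT.
  rewrite mulnAC [(K * t * k)%N]mulnAC leq_mul2r eqn0Ngt h2 /= => h4.
  exact: hl.
by case: lab => l1 l2; split; apply: aux; [left | | right | ].
Qed.

End Dense.

(** Up to factors close to 1, [fiber_growth] gives z >= (q + 2) k and [light_growth] gives z >= (v +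
    1) k / 2. With v + q = d, the first is at least (d + 2) k / 3 when v <= 2 q + 4, the second when
    v is larger. *)
Lemma robust_arith (N M D d v q k l e z : nat) :
  (0 < N)%N -> (0 < v)%N -> (v + q = d)%N -> (d.+2 <= D)%N -> (l * N <= k)%N ->
  (N * (2 * (M * M) + D) * e <= k)%N ->
  (M + (N + 12) * (D.+2 * D.+2) <= k)%N ->
  (k.*2 + v.-1 * (k - l) <= (z + v * e).*2)%N ->
  ((q.+2 * k).*2 <= (z + M * M * e.*2).*2 + q.+1 * q.+2)%N ->
  ((N - 3) * (d.+2 * k) <= 3 * N * z)%N.
Proof.
move=> N0 v0 <- hD hl he hk h2 h1.
have [N3|N3] := leqP N 3; first by rewrite (eqP N3) mul0n.
have [n eN] : exists n, N = (n + 3)%N by exists (N - 3)%N; lia.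
have e1 : (N * (2 * (M * M)) * e <= k)%N by clear -he; nia.
have e2 : (N * (v * e) <= k)%N.
  apply: leq_trans he; rewrite -mulnA leq_mul2l; apply/orP; right.
  by rewrite leq_mul2r; apply/orP; right; clear -hD; lia.
rewrite -(leq_pmul2l (isT : 0 < 2)%N).
have [hv|hv] := leqP v (2 * q + 4).
  have e3 : (N * (q.+1 * q.+2) <= k)%N.
    apply: leq_trans hk; apply: leq_trans (leq_addl _ _); apply: leq_mul; first exact: leq_addr.
    by apply: leq_mul; clear -hD; lia.
  have e4 : (6 * N * (q.+2 * k) <= 6 * N * z + 9 * k)%N.
    have := leq_mul (leqnn (3 * N)) h1; clear -e1 e3.
    rewrite -!muln2 => h; nia.
  have e5 : ((v + q).+2 * k <= 3 * (q.+2 * k))%N by rewrite mulnA leq_mul2r; apply/orP; right; clear -hv; lia.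
  have e6 : (2 * k <= (v + q).+2 * k)%N by rewrite leq_mul2r; apply/orP; right; lia.
  rewrite eN addnK; rewrite eN in e4; move: e4 e5 e6.
  set a := (q.+2 * k)%N; set b := ((v + q).+2 * k)%N; clearbody a b => e4 e5 e6.
  have e7 : (n * b <= n * (3 * a))%N by rewrite leq_mul2l e5 orbT.
  by clear -e4 e5 e6 e7; nia.
have e3 : ((v + q).+2 * 2 <= 3 * v.+1)%N by clear -hv; lia.
have [w ew] : exists w, v = w.+1 by exists v.-1; rewrite prednK.
have e4 : (N * (k - l) >= (N - 1) * k)%N.
  by rewrite mulnBr mulnBl mul1n leq_sub2l // mulnC.
have e5 : (2 * N * k + w * ((N - 1) * k) <= 2 * N * z + 2 * k)%N.
  have := leq_mul (leqnn N) h2; rewrite ew /= -!muln2 => h.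
  have : (w * ((N - 1) * k) <= w * (N * (k - l)))%N by rewrite leq_mul2l e4 orbT.
  rewrite ew in e2; clear -h e2.
  nia.
have e6 : (3 * ((N - 1) * (v.+1 * k)) <= 6 * N * z)%N.
  rewrite ew eN; rewrite eN in e5; have -> : (n + 3 - 1 = n + 2)%N by lia.
  have eq1 : (n + 3 - 1 = n + 2)%N by lia.
  rewrite eq1 in e5; clear -e5; nia.
have -> : (2 * (3 * N * z) = 6 * N * z)%N by rewrite !mulnA.
apply: leq_trans e6.
have : ((N - 3) * ((v + q).+2 * 2 * k) <= (N - 1) * (3 * v.+1 * k))%N.
  by apply: leq_mul; [lia | rewrite leq_mul2r e3 orbT].
set x := (N - 3)%N; set y := (v + q).+2; set x' := (N - 1)%N; set y' := v.+1.
by clearbody x y x' y'; clear; nia.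
Qed.

(* V is a subspace of least dimension v having a coset which is dense, on a scale
   depending geometrically on v, in one of the two sets.  Then X and Y are
   covered by boundedly many cosets of V but degenerate in no direction of V;
   fiber_growth handles a large codimension, light_growth a large v. *)
Theorem robust_freiman (R : realType) (K N : nat) : (0 < K)%N -> (0 < N)%N ->
  exists k0 C : nat, forall m (X Y Z : {fset 'rV[R]_m}) e k,
    (k0 <= k)%N -> (C * e <= k)%N -> nearly_full X Y Z e ->
    0 \in X -> 0 \in Y -> #|` X| = k -> #|` Y| = k ->
    (#|` fsum X Y| <= K * k)%N ->
    ((N - 3) * ((\rank (dirmx X Y)).+2 * k) <= 3 * N * #|` Z|)%N.
Proof.
(* There are at most K K T^(d - v) labels, so this T lets [light_of_minimal] conclude with
   [l = k %/ N]. *)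
move=> K0 N0; pose T := (K * K * N)%N; pose M := (K * (K * T ^ (3 * K)))%N.
have T0 : (0 < T)%N by rewrite !muln_gt0 K0 N0.
exists (M + (N + 12) * ((3 * K).+2 * (3 * K).+2))%N, (N * (2 * (M * M) + 3 * K))%N.
move=> m X Y Z e k hk he nf X0 Y0 cX cY hK.
have k0 : (0 < k)%N by clear -hk N0; nia.
have wk := freiman_third cX cY k0.
set d := \rank (dirmx X Y) in wk *.
(* Small doubling bounds d in terms of K alone, so the powers of T below are constants. *)
have hd : (d.+2 <= 3 * K)%N.
  by have := leq_trans wk (leq_mul (leqnn 3) hK); rewrite mulnA leq_mul2r eqn0Ngt k0.
have TM : (T ^ d <= M)%N.
  rewrite /M; apply: (@leq_trans (T ^ (3 * K))%N).
    by rewrite leq_pexp2l //; clear -hd; lia.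
  by rewrite mulnA leq_pmull // muln_gt0 K0.
have : exists j, `[< dense_rank X Y k T j >].
  by exists d; apply/asboolP; apply: dense_rank_full.
move=> /ex_minnP[v1 /asboolP[V [rV VD Vdense]] vmin].
have {}vmin j : dense_rank X Y k T j -> (\rank V <= j)%N.
  by move=> /asboolP; rewrite rV; apply: vmin.
have v0 : (0 < \rank V)%N.
  rewrite lt0n; apply/negP => /eqP e0; apply: (@dense_rank0 _ _ X Y k T).
    by apply: leq_ltn_trans TM _; clear -hk N0; nia.
  by exists V; rewrite e0.
have vd : (\rank V <= d)%N by apply: mxrankS.
have lab := few_labels K0 cX cY k0 hK Vdense.
have [lX lY] : light V X (k %/ N) /\ light V Y (k %/ N).
  apply: (light_of_minimal T0 vmin VD (K := K * K)); first by rewrite -!mulnA.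
  move=> s; rewrite /T -!mulnA !leq_mul2l !eqn0Ngt K0 /= => h.
  by rewrite leq_divRL // mulnC.
have h2 := light_growth nf X0 Y0 cX cY lX lY v0.
have labM : (K * (K * T ^ (d - \rank V)) <= M)%N.
  rewrite !leq_mul2l; apply/orP; right; apply/orP; right.
  by rewrite leq_pexp2l //; clear -hd; lia.
have [l1 l2] := lab.
have h1 := @fiber_growth _ _ X Y Z V e k M (d - \rank V) nf cX cY
  (leq_trans l1 labM) (leq_trans l2 labM).
apply: (robust_arith N0 v0 (subnKC vd) hd (leq_trunc_div k N) he hk h2).
by apply: h1 => //; clear -hk hd N0; nia.
Qed.

(** * Dictionaries *)

Lemma sum_fset_pred (T : choiceType) (S : {fset T}) (P : pred T) :
  (\sum_(z <- S) P z)%N = #|` [fset z in S | P z]|.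
Proof.
rewrite card_fset_sum1 -big_fset_condE /= [RHS]big_mkcond.
by apply: eq_fbigr => z _ _; case: (P z).
Qed.

Lemma fset_average (T : choiceType) (D : {fset T}) (a : T -> nat) (c : nat) :
  (0 < #|` D|)%N -> (\sum_(x <- D) a x <= #|` D| * c)%N ->
  exists2 x, x \in D & (a x <= c)%N.
Proof.
move=> D0 h; have Dn0 : D != fset0 by rewrite -cardfs_gt0.
have [x xD xmin] := fset_min (fun x => (a x)%:R : rat) Dn0.
exists x => //; rewrite -(leq_pmul2l D0); apply: leq_trans h.
apply: (@leq_trans (\sum_(y <- D) a x)%N).
  by rewrite big_const_seq count_predT iter_addn_0 mulnC.
by rewrite !big_seq; apply: leq_sum => y yD; have := xmin y yD; rewrite ler_nat.
Qed.

(* Greedy: some point of D hits a proportion p / |D| of the remaining sets. *)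
Lemma hitting (T I : choiceType) (D : {fset T}) (J : {fset I}) (f : I -> {fset T}) p t :
  (forall i, i \in J -> f i `<=` D /\ (p <= #|` f i|)%N) ->
  (#|` J| * (#|` D| - p) ^ t < #|` D| ^ t)%N ->
  exists H, [/\ H `<=` D, (#|` H| <= t)%N & forall i, i \in J -> exists2 x, x \in H & x \in f i].
Proof.
elim: t J => [|t IH] J hf.
  rewrite !expn0 muln1 ltnS leqn0 cardfs_eq0 => /eqP ->.
  by exists fset0; split; rewrite ?fsub0set ?cardfs0 // => i; rewrite inE.
rewrite !expnS => hc.
have [J0|[i0 i0J]] : J = fset0 \/ exists i, i \in J.
- by have [->|/fset0Pn] := eqVneq J fset0; [left | right].
- by exists fset0; split; rewrite ?J0 ?fsub0set ?cardfs0 // => i; rewrite inE.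
have D0 : (0 < #|` D|)%N.
  by rewrite lt0n; apply: contraTneq hc => ->; rewrite mul0n ltn0.
pose J' x := [fset i in J | x \notin f i].
have [x xD hx] : exists2 x, x \in D & (#|` D| * #|` J' x| <= #|` J| * (#|` D| - p))%N.
  have dc : (\sum_(x <- D) #|` J' x| = \sum_(i <- J) #|` D `\` f i|)%N.
    have -> : (\sum_(x <- D) #|` J' x| = \sum_(x <- D) \sum_(i <- J) (x \notin f i))%N.
      by apply: eq_fbigr => x _ _; rewrite sum_fset_pred.
    rewrite exchange_big /=; apply: eq_fbigr => i _ _.
    have -> : D `\` f i = [fset x in D | x \notin f i].
      by apply/fsetP => x; rewrite !inE andbC.
    by rewrite sum_fset_pred.
  apply: fset_average => //; rewrite -big_distrr /= leq_mul2l dc; apply/orP; right.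
  apply: (@leq_trans (\sum_(i <- J) (#|` D| - p))).
    rewrite !big_seq; apply: leq_sum => i iJ; have [sf cf] := hf i iJ.
    by rewrite cardfsDS // leq_sub2l.
  by rewrite big_const_seq count_predT iter_addn_0 mulnC.
have [||H [sH cH hH]] := IH (J' x).
- by move=> i; rewrite !inE => /andP[iJ _]; apply: hf.
- rewrite -(ltn_pmul2l D0); apply: leq_ltn_trans hc.
  by rewrite mulnA [X in (_ <= X)%N]mulnA leq_mul2r hx orbT.
exists (x |` H); split.
- by rewrite fsubUset sH fsub1set xD.
- by rewrite cardfsU1; case: (x \notin H) => //=; rewrite add0n leqW.
- move=> i iJ; have [xi|xi] := boolP (x \in f i).
    by exists x => //; rewrite fset1U1.
  have [|y yH yf] := hH i; first by rewrite !inE iJ.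
  by exists y => //; rewrite in_fsetU yH orbT.
Qed.

(** [hitting] is applied h times, each time to the sets stripped of the points already chosen; there
    are at most [h * t] of these, which is the margin in the hypothesis. *)
Lemma multi_hitting (T I : choiceType) (D : {fset T}) (J : {fset I})
    (f : I -> {fset T}) p t h :
  (forall i, i \in J -> f i `<=` D /\ (p + h * t <= #|` f i|)%N) ->
  (#|` J| * (#|` D| - p) ^ t < #|` D| ^ t)%N ->
  exists H, [/\ H `<=` D, (#|` H| <= h * t)%N &
    forall i, i \in J -> (h <= #|` f i `&` H|)%N].
Proof.
elim: h => [|h IH] hf hc.
  by exists fset0; split; rewrite ?fsub0set ?cardfs0.
have [|H [sH cH hH]] := IH _ hc.
  move=> i /hf[sf cf]; split=> //; apply: leq_trans cf.
  by rewrite leq_add2l leq_mul2r leqnSn orbT.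
have [|H' [sH' cH' hH']] := @hitting _ _ D J (fun i => f i `\` H) p t _ hc.
  move=> i /hf[sf cf]; split; first exact: fsubset_trans (fsubsetDl _ _) sf.
  rewrite cardfsD; apply: leq_trans (leq_sub2l _ (leq_trans (fsubset_leq_card (fsubsetIr _ _)) cH)).
  move: cf; rewrite mulSn; set a := #|` f i|; set b := (h * t)%N; clearbody a b; lia.
exists (H `|` H'); split.
- by rewrite fsubUset sH.
- by rewrite mulSn addnC; apply: leq_trans (leq_card_fsetU _ _) (leq_add _ _).
- move=> i iJ; have [x xH'] := hH' i iJ; rewrite in_fsetD => /andP[xH xf].
  have sub : x |` (f i `&` H) `<=` f i `&` (H `|` H').
    rewrite fsubUset fsub1set !inE xf xH' orbT /=; apply: fsetIS; exact: fsubsetUl.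
  apply: leq_trans (fsubset_leq_card sub).
  by rewrite cardfsU1 inE (negPf xH) andbF add1n ltnS hH.
Qed.

Definition rep (A B : {fset nat}) (z : nat) : nat :=
  #|` [fset a in A | (a <= z)%N && ((z - a)%N \in B)]|.

Definition popular (A B : {fset nat}) (t : nat) : {fset nat} :=
  [fset z in fsum A B | (t <= rep A B z)%N].

Lemma repC A B z : rep A B z = rep B A z.
Proof.
have aux A' B' : (rep A' B' z <= rep B' A' z)%N.
  rewrite /rep; set S := [fset a in A' | _].
  apply: (@leq_trans #|` [fset (z - a)%N | a in S]|); last first.
    apply: fsubset_leq_card; apply/fsubsetP => b /imfsetP[a /=].
    rewrite !inE => /and3P[aA az zB] ->.
    by rewrite zB leq_subr subKn //= aA.
  rewrite [X in (_ <= X)%N]card_in_imfset // => a a'; rewrite !inE => /and3P[_ az _] /and3P[_ az' _].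
  by move=> h; rewrite -(subKn az) -(subKn az') h.
by apply/eqP; rewrite eqn_leq !aux.
Qed.

Lemma popularC A B t : popular A B t = popular B A t.
Proof. by rewrite /popular fsumC; apply/fsetP => z; rewrite !inE repC. Qed.

Lemma rep_sub A A' B B' z : A' `<=` A -> B' `<=` B -> (rep A' B' z <= rep A B z)%N.
Proof.
move=> /fsubsetP sA /fsubsetP sB; apply: fsubset_leq_card; apply/fsubsetP => a.
by rewrite !inE => /and3P[/sA -> -> /sB ->].
Qed.

Lemma rep_remove A B a b : a \in A -> b \in B ->
  (rep (A `\ a) B (a + b)).+1 = rep A B (a + b).
Proof.
move=> aA bB; rewrite /rep [in RHS](cardfsD1 a) !inE aA leq_addr addKn bB add1n.
congr _.+1; congr #|` _|; apply/fsetP => x; rewrite !inE.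
by case: (x == a).
Qed.

(* Deleting a row with more than e unpopular entries lowers this potential,
   which is at most t times the number of sums, by at least e. *)
Definition capped_reps (S A B : {fset nat}) t := (\sum_(z <- S) minn t (rep A B z))%N.

Lemma capped_reps_sub S A A' B B' t : A' `<=` A -> B' `<=` B ->
  (capped_reps S A' B' t <= capped_reps S A B t)%N.
Proof.
move=> sA sB; apply: leq_sum => z _; have := rep_sub z sA sB.
by move: (rep A' _ _) (rep A _ _) => x y; lia.
Qed.

Lemma capped_repsC S A B t : capped_reps S A B t = capped_reps S B A t.
Proof. by apply: eq_fbigr => z _ _; rewrite repC. Qed.

Lemma capped_reps_remove S A B t e a : fsum A B `<=` S -> a \in A ->
  (e < #|` [fset b in B | (a + b)%R \notin popular A B t]|)%N ->
  (capped_reps S (A `\ a) B t + e <= capped_reps S A B t)%N.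
Proof.
move=> /fsubsetP sS aA; set Bad := [fset b in B | _] => he.
apply: (@leq_trans (\sum_(z <- S) (minn t (rep (A `\ a) B z) +
   (z \in [fset (a + b)%N | b in Bad])))).
  rewrite big_split /= leq_add2l.
  apply: (@leq_trans #|` [fset (a + b)%N | b in Bad]|).
    by rewrite card_imfset; [exact: ltnW | exact: addnI].
  rewrite sum_fset_pred; apply: fsubset_leq_card.
  apply/fsubsetP => z zB; rewrite !inE zB andbT; apply: sS.
  by move: zB => /imfsetP[b /=]; rewrite !inE => /andP[bB _] ->; apply: mem_fsum.
apply: leq_sum => z _; have := rep_sub z (fsubD1set A a) (fsubset_refl B).
have [/imfsetP[b /=]|_] := boolP (z \in _); last first.
  by move: (rep _ _ _) (rep _ _ _) => x y; lia.
rewrite !inE => /andP[bB]; rewrite mem_fsum //= -ltnNge => lt ez.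
move: lt; rewrite ez -(rep_remove aA bB).
by move: (rep _ _ _) => x; rewrite /GRing.add /=; lia.
Qed.

(** Deletions make other sums unpopular, so bad rows and columns are removed one at a time until
    none remains. A point of the other set goes with each, to keep the sizes equal. The number of
    rounds is bounded by the potential, initially at most t |A + B| and losing e per round. *)
Lemma prune A B k t e : #|` A| = k -> #|` B| = k ->
  exists A1 B1, [/\ A1 `<=` A, B1 `<=` B, #|` A1| = #|` B1|,
    ((k - #|` A1|) * e <= t * #|` fsum A B|)%N &
    nearly_full A1 B1 (popular A1 B1 t) e].
Proof.
move=> cA cB.
suff [A1 [B1 [h1 h2 h3 h4 h5]]] : exists A1 B1, [/\ A1 `<=` A, B1 `<=` B, #|` A1| = #|` B1|,
    ((k - #|` A1|) * e <= capped_reps (fsum A B) A B t)%N &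
    nearly_full A1 B1 (popular A1 B1 t) e].
  exists A1, B1; split => //; apply: leq_trans h4 _.
  rewrite /capped_reps; apply: (@leq_trans (\sum_(z <- fsum A B) t)%N).
    by apply: leq_sum => z _; rewrite geq_minl.
  by rewrite big_const_seq count_predT iter_addn_0 leq_mul2l leqnn orbT.
(* The potential is summed over the original sumset S, fixed while A and B shrink. *)
move: (fsubset_refl (fsum A B)); move: {-1}(fsum A B) => S.
elim: k A B cA cB => [|k IH] A B cA cB sS.
  exists A, B; rewrite cA cB; split => //.
  by rewrite (cardfs0_eq cA) (cardfs0_eq cB); split => x; rewrite inE.
have [nf|nf] := pselect (nearly_full A B (popular A B t) e).
  by exists A, B; rewrite cA cB subnn; split.
suff [A' [B' [sA sB cA' cB' hc]]] : exists A' B', [/\ A' `<=` A, B' `<=` B, #|` A'| = k,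
    #|` B'| = k & (capped_reps S A' B' t + e <= capped_reps S A B t)%N].
  have [|A1 [B1 [s1 s2 h3 h4 h5]]] := IH A' B' cA' cB'.
    exact: fsubset_trans (fsumS sA sB) sS.
  exists A1, B1; split => //; try exact: fsubset_trans s1 sA.
    exact: fsubset_trans s2 sB.
  have : (#|` A1| <= k)%N by rewrite -cA' fsubset_leq_card.
  move=> hk; rewrite subSn // mulSn addnC.
  by apply: leq_trans hc; rewrite leq_add2r.
have step (A0 B0 : {fset nat}) : #|` A0| = k.+1 -> #|` B0| = k.+1 -> fsum A0 B0 `<=` S ->
   (exists2 a, a \in A0 & (e < #|` [fset b in B0 | (a + b)%R \notin popular A0 B0 t]|)%N) ->
   exists A' B', [/\ A' `<=` A0, B' `<=` B0, #|` A'| = k,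
    #|` B'| = k & (capped_reps S A' B' t + e <= capped_reps S A0 B0 t)%N].
  move=> cA0 cB0 s0 [a aA he].
  have [b bB] : exists b, b \in B0 by apply/fset0Pn; rewrite -cardfs_gt0 cB0.
  exists (A0 `\ a), (B0 `\ b); split; try exact: fsubD1set.
  - by move: cA0; rewrite (cardfsD1 a) aA => -[].
  - by move: cB0; rewrite (cardfsD1 b) bB => -[].
  - apply: leq_trans (capped_reps_remove s0 aA he); rewrite leq_add2r.
    by apply: capped_reps_sub; rewrite ?fsubset_refl // fsubD1set.
have [hA|hA] := pselect (exists2 a, a \in A & (e < #|` [fset b in B | (a + b)%R \notin popular A B t]|)%N).
  exact: step.
have [hB|hB] := pselect (exists2 b, b \in B & (e < #|` [fset a in A | (b + a)%R \notin popular B A t]|)%N).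
  have [|B' [A' [s1 s2 h1 h2 h3]]] := step B A cB cA _ hB; first by rewrite fsumC.
  by exists A', B'; split => //; rewrite capped_repsC [X in (_ <= X)%N]capped_repsC.
case: nf; split=> x xA; rewrite leqNgt; apply/negP => h.
  by apply: hA; exists x.
apply: hB; exists x => //; apply: leq_trans h _; rewrite popularC.
have e1 a : (a + x = x + a)%R by rewrite addrC.
by apply: fsubset_leq_card; apply/fsubsetP => a; rewrite !inE e1.
Qed.

(* Write Z for the popular sums.  Then A is contained in Z - B0 and B in Z - A0.
   To have Z inside A1 + B1, first let A1 contain the first term of h solutions of
   a + b = z for each z in Z, and then let B1 hit the h corresponding second terms. *)
Lemma dictionary A B k t e p h t1 t2 L : #|` A| = k -> #|` B| = k ->
  nearly_full A B (popular A B t) e ->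
  (k * e ^ L < k ^ L)%N -> (e <= k)%N ->
  (p + h * t1 <= t)%N -> (k * k * (k - p) ^ t1 < k ^ t1)%N ->
  (k * k * (k - h) ^ t2 < k ^ t2)%N ->
  exists A0 B0 A1 B1, [/\ [/\ A0 `<=` A1, B0 `<=` B1, A1 `<=` A & B1 `<=` B],
    [/\ (#|` A0| <= L)%N, (#|` B0| <= L)%N, (#|` A1| <= L + h * t1)%N
     & (#|` B1| <= L + t2)%N],
    popular A B t `<=` fsum A1 B1,
    forall a, a \in A -> exists2 b, b \in B0 & (a + b)%N \in popular A B t &
    forall b, b \in B -> exists2 a, a \in A0 & (a + b)%N \in popular A B t].
Proof.
move=> cA cB [nfA nfB] hL ek hp hc1 hc2; set Z := popular A B t.
have ZS : Z `<=` fsum A B by apply/fsubsetP => z; rewrite !inE => /andP[].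
have cZ : (#|` Z| <= k * k)%N.
  apply: leq_trans (fsubset_leq_card ZS) _.
  by apply: leq_trans (card_fsum_le _ _) _; rewrite cA cB.
have [||B0 [sB0 cB0 hB0]] := @hitting _ _ B A (fun a => [fset b in B | (a + b)%R \in Z]) (k - e) L.
- move=> a aA; split; first by apply/fsubsetP => b; rewrite !inE => /andP[].
  rewrite leq_subLR; have := nfA a aA.
  have : (#|` B| <= #|` [fset b in B | (a + b)%R \notin Z]| + #|` [fset b in B | (a + b)%R \in Z]|)%N.
    apply: leq_trans (leq_card_fsetU _ _); apply: fsubset_leq_card.
    apply/fsubsetP => b bB; rewrite in_fsetU; apply/orP.
    have [h'|h'] := boolP ((a + b)%R \in Z); [right | left];
      by apply/imfsetP; exists b => //=; rewrite inE bB.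
  rewrite cB => h1 h2; apply: leq_trans h1 _; by rewrite leq_add2r.
- by rewrite cA cB subKn.
have [||A0 [sA0 cA0 hA0]] := @hitting _ _ A B (fun b => [fset a in A | (a + b)%R \in Z]) (k - e) L.
- move=> b bB; split; first by apply/fsubsetP => a; rewrite !inE => /andP[].
  rewrite leq_subLR; have := nfB b bB.
  have : (#|` A| <= #|` [fset a in A | (a + b)%R \notin Z]| + #|` [fset a in A | (a + b)%R \in Z]|)%N.
    apply: leq_trans (leq_card_fsetU _ _); apply: fsubset_leq_card.
    apply/fsubsetP => a aA; rewrite in_fsetU; apply/orP.
    have [h'|h'] := boolP ((a + b)%R \in Z); [right | left];
      by apply/imfsetP; exists a => //=; rewrite inE aA.
  rewrite cA => h1 h2; apply: leq_trans h1 _; by rewrite leq_add2r.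
- by rewrite cB cA subKn.
pose f z := [fset a in A | (a <= z)%N && ((z - a)%N \in B)].
have [||A' [sA' cA' hA']] := @multi_hitting _ _ A Z f p t1 h.
- move=> z; rewrite !inE => /andP[_ hz]; split; last exact: leq_trans hp hz.
  by apply/fsubsetP => a; rewrite !inE => /andP[].
- by rewrite cA; apply: leq_ltn_trans hc1; rewrite leq_mul2r cZ orbT.
pose g z := [fset (z - a)%N | a in f z `&` A'].
have [||Q [sQ cQ hQ]] := @hitting _ _ B Z g h t2.
- move=> z zZ; split.
    apply/fsubsetP => b /imfsetP[a /=]; rewrite in_fsetI => /andP[+ _].
    by rewrite !inE => /and3P[_ _ ?] ->.
  rewrite /g card_in_imfset; first exact: hA'.
  move=> a a'; rewrite !in_fsetI => /andP[+ _] /andP[+ _].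
  rewrite !inE => /and3P[_ az _] /and3P[_ az' _] => e1.
  by rewrite -(subKn az) -(subKn az') e1.
- by rewrite cB; apply: leq_ltn_trans hc2; rewrite leq_mul2r cZ orbT.
exists A0, B0, (A0 `|` A'), (B0 `|` Q); split.
- by split; rewrite ?fsubsetUl // fsubUset ?sA0 ?sA' ?sB0 ?sQ.
- split=> //; apply: leq_trans (leq_card_fsetU _ _) _; exact: leq_add.
- apply/fsubsetP => z zZ; have [b bQ /imfsetP[a /=]] := hQ z zZ.
  rewrite in_fsetI => /andP[+ aA'].
  rewrite !inE => /and3P[aA az zB] eb.
  have -> : z = (a + b)%R by rewrite eb /GRing.add /= subnKC.
  by apply: mem_fsum; rewrite in_fsetU ?aA' ?bQ orbT.
- by move=> a /hB0[b bB0]; rewrite !inE => /andP[_ h']; exists b; rewrite // !inE.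
- by move=> b /hA0[a aA0]; rewrite !inE => /andP[_ h']; exists a; rewrite // !inE.
Qed.

(** * Freiman models and counting of dictionaries *)

Section Counting.
Variables (R : realFieldType) (m n : nat).
Implicit Types (g : {ffun 'I_m -> 'I_n}) (M : 'M[R]_m).

Definition point g : 'cV[R]_m := \col_i (g i).+1%:R.

Lemma point_inj : injective point.
Proof.
move=> g g' h; apply/ffunP => i; apply: val_inj.
have /matrixP /(_ i 0) := h; rewrite !mxE => /eqP.
by rewrite eqr_nat eqSS => /eqP.
Qed.

(** On the kernel of M, some [m - \rank M] coordinates determine the whole vector, and each takes n
    values. *)
Lemma card_points_kernel M :
  (#|[set g | M *m point g == 0%R]| <= n ^ (m - \rank M))%N.
Proof.
pose K := row_base (kermx M^T).
have rK : \rank (kermx M^T) = (m - \rank M)%N by rewrite mxrank_ker mxrank_tr.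
have Kfull : row_full K^T.
  by rewrite /row_full mxrank_tr -/(row_free K) row_base_free.
pose f := fullrankfun Kfull.
pose restr (g : {ffun 'I_m -> 'I_n}) := [ffun i => g (f i)].
have inj : {in [set g | M *m point g == 0] &, injective restr}.
  move=> g g'; rewrite !inE => /eqP hg /eqP hg' e1; apply: point_inj; apply/eqP.
  rewrite -subr_eq0; set x := point g - point g'.
  have : (x^T <= K)%MS.
    rewrite eq_row_base; apply/sub_kermxP.
    by rewrite -trmx_mul mulmxBr hg hg' subrr trmx0.
  move=> /submxP[D hD].
  have xD : x = K^T *m D^T by rewrite -trmx_mul -hD trmxK.
  have x0 : rowsub f K^T *m D^T = 0.
    have -> : rowsub f K^T *m D^T = rowsub f x.
      rewrite xD; apply/matrixP => i j; rewrite [LHS]mxE [RHS]mxE [RHS]mxE.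
      by apply: eq_bigr => k _; rewrite [X in X * _]mxE.
    apply/matrixP => i j; rewrite !mxE.
    have -> : g (f i) = g' (f i).
      by have /ffunP /(_ i) := e1; rewrite !ffunE.
    by rewrite subrr.
  have D0 : D^T = 0.
    by rewrite -(mulKmx (fullrowsub_unit Kfull) D^T) x0 mulmx0.
  by rewrite xD D0 mulmx0.
rewrite -rK -[X in (X ^ _)%N]card_ord -[X in (_ ^ X)%N]card_ord -card_ffun.
rewrite -(card_in_imset inj); exact: max_card.
Qed.

(* The elements of A and B are words x_i + x_j - x_l in a dictionary x; only the
   additive coincidences w1 + w2 = w3 + w4 between words matter, so that a
   dictionary is determined by its relations and free_rank many entries. *)
Definition word : Type := ('I_m * 'I_m * 'I_m)%type.
HB.instance Definition _ := Finite.on word.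
Definition relation : Type := (word * word * (word * word))%type.
HB.instance Definition _ := Finite.on relation.

Definition word_vec (w : word) : 'rV[R]_m :=
  delta_mx 0 w.1.1 + delta_mx 0 w.1.2 - delta_mx 0 w.2.

Definition relation_vec (p : relation) : 'rV[R]_m :=
  word_vec p.1.1 + word_vec p.1.2 - word_vec p.2.1 - word_vec p.2.2.

Definition valid g (p : relation) := relation_vec p *m point g == 0.

Definition relation_space g : 'M[R]_m :=
  (\sum_(p : relation | valid g p) <<relation_vec p>>)%MS.

Definition free_rank g := (m - \rank (relation_space g))%N.

(** The exponent 12 stands for four words of three letters each. *)
Lemma card_relation : #|{: relation}| = (m ^ 12)%N.
Proof. by rewrite !card_prod card_ord !expnS expn0; ring. Qed.

(** A basis of relations is padded with a trivial one to length exactly m, so that its choice costs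
    a power of the number of relations. *)
Lemma relation_space_basis g : (0 < m)%N ->
  exists L : {ffun 'I_m -> relation},
    (relation_space g :=: \matrix_i relation_vec (L i))%MS /\ forall i, valid g (L i).
Proof.
move=> m0; pose i0 := Ordinal m0; pose w0 : word := (i0, i0, i0).
pose p0 : relation := (w0, w0, (w0, w0)).
have vec0 : relation_vec p0 = 0 by rewrite /relation_vec /= addrK subrr.
have valid0 : valid g p0 by rewrite /valid vec0 mul0mx.
pose fix_ p := if valid g p then p else p0.
have vfix p : valid g (fix_ p) by rewrite /fix_; case: ifP.
pose big : 'M[R]_(#|{: relation}|, m) := \matrix_i relation_vec (fix_ (enum_val i)).
have eqbig : (relation_space g :=: big)%MS.
  apply/eqmxP/andP; split.
    apply/sumsmx_subP => p vp; rewrite genmxE.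
    have -> : relation_vec p = row (enum_rank p) big.
      by rewrite rowK enum_rankK /fix_ vp.
    exact: row_sub.
  apply/row_subP => i; rewrite rowK; apply: submx_trans (_ : _ <= <<relation_vec (fix_ (enum_val i))>>)%MS _.
    by rewrite genmxE.
  exact: (sumsmx_sup (fix_ (enum_val i))).
pose f := maxrankfun big.
pose Lf (i : 'I_m) : relation := if insub (val i) is Some j then fix_ (enum_val (f j)) else p0.
pose L : {ffun 'I_m -> relation} := finfun Lf.
exists L; split; last by move=> i; rewrite ffunE /Lf; case: insub.
apply: (eqmx_trans eqbig); apply: (eqmx_trans (eqmx_sym (eq_maxrowsub big))).
apply/eqmxP/andP; split.
  apply/row_subP => j.
  have jm : (j < m)%N by apply: leq_trans (ltn_ord j) (rank_leq_col big).
  have -> : row j (rowsub (maxrankfun big) big) = row (Ordinal jm) (\matrix_i relation_vec (L i)).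
    rewrite row_rowsub !rowK ffunE /Lf /= insubT //= => hj.
    by congr (relation_vec (fix_ (enum_val (f _)))); apply: val_inj.
  exact: row_sub.
rewrite eq_maxrowsub; apply/row_subP => i; rewrite rowK ffunE /Lf.
case: insub => [j|]; last by rewrite vec0 sub0mx.
have -> : relation_vec (fix_ (enum_val (f j))) = row (f j) big by rewrite rowK.
exact: row_sub.
Qed.

(** Once a spanning list of relations is fixed, g lies in the kernel of a matrix of rank m - r. *)
Lemma card_free_rank r : (0 < m)%N ->
  (#|[set g | free_rank g == r]| <= (m ^ 12) ^ m * n ^ r)%N.
Proof.
move=> m0.
pose mxL (L : {ffun 'I_m -> relation}) : 'M[R]_m := \matrix_i relation_vec (L i).
pose T L := [set g | (m - \rank (mxL L) == r)%N && (mxL L *m point g == 0)].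
apply: (@leq_trans #|\bigcup_L T L|).
  apply: subset_leq_card; apply/fintype.subsetP => g; rewrite inE => /eqP hg.
  have [L [eL vL]] := relation_space_basis g m0.
  apply/bigcupP; exists L => //; rewrite inE -hg /free_rank eL eqxx /=.
  by apply/eqP/row_matrixP => i; rewrite row_mul rowK row0; apply/eqP/vL.
apply: (@leq_trans (\sum_L #|T L|)).
  apply: (big_ind2 (fun (A : {set {ffun 'I_m -> 'I_n}}) k => #|A| <= k)%N).
  - by rewrite cards0.
  - move=> A k A' k' h h'; apply: leq_trans (leq_add h h').
    by rewrite cardsU leq_subr.
  - by [].
apply: (@leq_trans (\sum_(L : {ffun 'I_m -> relation}) n ^ r)).
  apply: leq_sum => L _.
  have [e|ne] := eqVneq (m - \rank (mxL L))%N r.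
    rewrite -[X in (_ ^ X)%N]e; apply: leq_trans (card_points_kernel _).
    by apply: subset_leq_card; apply/fintype.subsetP => g; rewrite !inE => /andP[].
  have -> : T L = finset.set0 by apply/setP => g; rewrite /T !inE (negPf ne).
  by rewrite cards0.
by rewrite sum_nat_const card_ffun card_relation card_ord.
Qed.

End Counting.

(** * The universal model of a pair of sets *)

Section Model.
Variables (R : realType) (m n : nat) (g : {ffun 'I_m -> 'I_n}).
Implicit Types (A B Z : {fset nat}) (w : word m).

Local Notation C := (cokermx (relation_space R g)).

Definition word_val w : R := ht (point R g) (word_vec R w).
Definition lift w : 'rV[R]_m := word_vec R w *m C.

(** A coincidence of values is a valid relation, hence killed in the quotient. Conversely, every
    vector of the relation space vanishes on the point of g, being a combination of valid
    relations. *)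
Lemma lift_relation w1 w2 w3 w4 :
  lift w1 + lift w2 = lift w3 + lift w4 <->
  word_val w1 + word_val w2 = word_val w3 + word_val w4.
Proof.
pose p : relation m := (w1, w2, (w3, w4)).
have e1 : lift w1 + lift w2 = lift w3 + lift w4 <-> relation_vec R p *m C = 0.
  have -> : relation_vec R p *m C = lift w1 + lift w2 - (lift w3 + lift w4).
    rewrite /lift -!mulmxDl -mulmxBl; congr (_ *m _).
    by rewrite opprD addrA.
  by split => [->|/eqP]; rewrite ?subrr // subr_eq0 => /eqP.
have e2 : word_val w1 + word_val w2 = word_val w3 + word_val w4 <->
    ht (point R g) (relation_vec R p) = 0.
  have -> : ht (point R g) (relation_vec R p) =
      word_val w1 + word_val w2 - (word_val w3 + word_val w4).
    rewrite /word_val -!htD -htB; congr (ht _ _).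
    by rewrite opprD addrA.
  by split => [->|/eqP]; rewrite ?subrr // subr_eq0 => /eqP.
apply: (iff_trans e1); apply: iff_trans (iff_sym e2).
split => [/eqP h|/eqP].
  move: h; rewrite -submxE => h; apply/eqP; rewrite ht_eq0.
  have h0 : (relation_space R g <= kermx (point R g))%MS.
    by apply/sumsmx_subP => q vq; rewrite genmxE; apply/sub_kermxP/eqP.
  by apply/eqP/sub_kermxP; apply: submx_trans h h0.
rewrite ht_eq0 => h; apply/eqP; rewrite -submxE.
apply: (submx_trans (B := <<relation_vec R p>>%MS)); first by rewrite genmxE.
exact: (sumsmx_sup p).
Qed.

(** The quotient by the relations has dimension [free_rank] and is spanned by the lifts of the
    dictionary entries. Each is a difference of phi or psi values plus the lift of a0 or of b0;
    these two base points account for the loss of 2. *)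
Lemma freiman_model A B a0 b0 :
  a0 \in A -> b0 \in B ->
  (forall a, a \in A -> exists w, word_val w = a%:R) ->
  (forall b, b \in B -> exists w, word_val w = b%:R) ->
  (forall i, ((g i).+1 \in A) || ((g i).+1 \in B)) ->
  exists phi psi : nat -> 'rV[R]_m,
  [/\ forall a a' b b', a \in A -> a' \in A -> b \in B -> b' \in B ->
        (phi a + psi b = phi a' + psi b' <-> (a + b = a' + b')%N),
      phi a0 = 0, psi b0 = 0 &
      (free_rank R g <= (\rank (dirmx [fset phi a | a in A] [fset psi b | b in B])).+2)%N].
Proof.
move=> a0A b0B hA hB hg.
have choose_word (D : {fset nat}) : (forall a, a \in D -> exists w, word_val w = a%:R) ->
    a0 \in A -> exists f : nat -> word m, forall a, a \in D -> word_val (f a) = a%:R.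
  move=> hD _; have [w0 _] := hA a0 a0A.
  have [f hf] : {f : nat -> word m & forall a, a \in D -> word_val (f a) = a%:R}.
    apply: (@choice _ _ (fun a w => a \in D -> word_val w = a%:R)) => a.
    by have [/hD[w hw]|_] := boolP (a \in D); [exists w | exists w0].
  by exists f.
have [f hf] := choose_word A hA a0A; have [h hh] := choose_word B hB a0A.
pose phi a := lift (f a) - lift (f a0); pose psi b := lift (h b) - lift (h b0).
exists phi, psi; split; rewrite /phi /psi ?subrr //.
  move=> a a' b b' aA a'A bB b'B.
  have eL x y : lift (f x) + lift (h y) =
      lift (f x) - lift (f a0) + (lift (h y) - lift (h b0)) + (lift (f a0) + lift (h b0)).
    by apply/matrixP => i j; rewrite !mxE; ring.
  have rel := lift_relation (f a) (h b) (f a') (h b').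
  rewrite !hf // !hh // -!natrD in rel; split => [e1|e1].
    have /rel /eqP : lift (f a) + lift (h b) = lift (f a') + lift (h b').
      by rewrite eL e1 -eL.
    by rewrite eqr_nat => /eqP.
  have /rel : (a + b)%:R = (a' + b')%:R :> R by rewrite e1.
  by rewrite eL [RHS]eL => /addIr.
set D := dirmx _ _.
have lift_i i : word_vec R (i, i, i) = delta_mx 0 i by rewrite /word_vec /= addrK.
have val_i i : word_val (i, i, i) = (g i).+1%:R.
  by rewrite /word_val lift_i /ht -rowE !mxE.
have same w w' : word_val w = word_val w' -> lift w = lift w'.
  by move=> e1; apply: (addIr (lift w)); apply/lift_relation; rewrite e1.
have CW : (C <= D + <<lift (f a0)>> + <<lift (h b0)>>)%MS.
  apply/row_subP => i; have -> : row i C = lift (i, i, i) by rewrite /lift lift_i -rowE.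
  case/orP: (hg i) => hi.
    have -> : lift (i, i, i) = (phi (g i).+1 - phi a0) + lift (f a0).
      rewrite /phi subrr subr0 subrK; apply: same; by rewrite val_i hf.
    apply: submx_trans (addsmxSl _ _); apply: addmx_sub.
      apply: submx_trans (addsmxSl _ _); apply: dirmx_subl.
        by apply/imfsetP; exists (g i).+1.
      by apply/imfsetP; exists a0.
    by apply: submx_trans (addsmxSr _ _); rewrite genmxE.
  have -> : lift (i, i, i) = (psi (g i).+1 - psi b0) + lift (h b0).
    rewrite /psi subrr subr0 subrK; apply: same; by rewrite val_i hh.
  apply: addmx_sub.
    apply: submx_trans (addsmxSl _ _); apply: submx_trans (addsmxSl _ _); apply: dirmx_subr.
      by apply/imfsetP; exists (g i).+1.
    by apply/imfsetP; exists b0.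
  by apply: submx_trans (addsmxSr _ _); rewrite genmxE.
have rk1 (x : 'rV[R]_m) : (\rank <<x>>%MS <= 1)%N by rewrite mxrank_gen rank_leq_row.
have radd (W W' : 'M[R]_m) : (\rank (W + W')%MS <= \rank W + \rank W')%N.
  by have [] := mxrank_adds_leqif W W'.
rewrite /free_rank -mxrank_coker; apply: leq_trans (mxrankS CW) _.
apply: leq_trans (radd _ _) (leq_trans (leq_add (radd _ _) (rk1 _)) _).
by apply: leq_trans (leq_add (leq_add (leqnn _) (rk1 _)) (leqnn _)) _; rewrite !addn1.
Qed.

Section Transfer.
Variables (A B : {fset nat}) (phi psi : nat -> 'rV[R]_m).
Hypothesis iso : forall a a' b b', a \in A -> a' \in A -> b \in B -> b' \in B ->
        (phi a + psi b = phi a' + psi b' <-> (a + b = a' + b')%N).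
Let X := [fset phi a | a in A].
Let Y := [fset psi b | b in B].

Lemma model_injl b0 : b0 \in B -> {in A &, injective phi}.
Proof.
move=> b0B a a' aA a'A e1; apply: (@addIn b0).
by apply/(iso aA a'A b0B b0B); rewrite e1.
Qed.

Lemma model_injr a0 : a0 \in A -> {in B &, injective psi}.
Proof.
move=> a0A b b' bB b'B e1; apply: (@addnI a0).
by apply/(iso a0A a0A bB b'B); rewrite e1.
Qed.

Definition model_sums Z : {fset 'rV[R]_m} :=
  [fset p.1 + p.2 | p in [seq (phi a, psi b) | a <- A, b <- [fset b in B | (a + b)%N \in Z]]].

Lemma model_sumsP Z a b : a \in A -> b \in B ->
  (phi a + psi b \in model_sums Z) = ((a + b)%N \in Z).
Proof.
move=> aA bB; apply/imfsetP/idP.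
  move=> [_ /= /allpairsPdep[a' [b' [a'A + ->]]]]; rewrite !inE => /andP[b'B zZ] /=.
  by move=> /(iso aA a'A bB b'B) ->.
move=> zZ; exists (phi a, psi b) => //=; apply/allpairsPdep; exists a, b; split => //.
by rewrite !inE bB.
Qed.

Lemma model_sums_inv Z z : z \in model_sums Z ->
  exists a b, [/\ a \in A, b \in B, (a + b)%N \in Z & z = phi a + psi b].
Proof.
move=> /imfsetP[_ /= /allpairsPdep[a' [b' [a'A + ->]]]]; rewrite !inE => /andP[b'B zZ] ->.
by exists a', b'.
Qed.

(** By [iso], phi a + psi b depends only on a + b, so the model sums are an image of Z. *)
Lemma card_model_sums Z : (#|` model_sums Z| <= #|` Z|)%N.
Proof.
have [s hs] : {s : nat -> 'rV[R]_m & forall z a b, a \in A -> b \in B ->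
    (a + b = z)%N -> s z = phi a + psi b}.
  apply: (@choice _ _ (fun z x => forall a b, a \in A -> b \in B ->
    (a + b = z)%N -> x = phi a + psi b)) => z.
  have [[a [b [aA bB e1]]]|h] := pselect (exists a b, [/\ a \in A, b \in B & (a + b = z)%N]).
    exists (phi a + psi b) => a' b' a'A b'B e2; apply/iso => //; by rewrite e1 e2.
  by exists 0 => a b aA bB e1; case: h; exists a, b.
apply: (@leq_trans #|` [fset s z | z in Z]|); last exact: leq_imfset_card.
apply: fsubset_leq_card; apply/fsubsetP => z /model_sums_inv[a [b [aA bB zZ ->]]].
by apply/imfsetP; exists (a + b)%N => //; rewrite (hs _ a b).
Qed.

Lemma card_model_fsum : (#|` fsum X Y| <= #|` fsum A B|)%N.
Proof.
apply: leq_trans (card_model_sums (fsum A B)); apply: fsubset_leq_card.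
apply/fsubsetP => z /fsumP[_ [_ [/imfsetP[a /= aA ->] /imfsetP[b /= bB ->] ->]]].
by rewrite model_sumsP //; apply: (mem_fsum aA bB).
Qed.

Lemma model_nearly_full Z e : nearly_full A B Z e -> nearly_full X Y (model_sums Z) e.
Proof.
move=> [nA nB]; split=> [_ /imfsetP[a /= aA ->]|_ /imfsetP[b /= bB ->]].
  apply: leq_trans (nA a aA); apply: (@leq_trans #|` [fset psi b | b in [fset b in B | (a + b)%R \notin Z]]|);
    last exact: leq_imfset_card.
  apply: fsubset_leq_card; apply/fsubsetP => y; rewrite !inE => /andP[/imfsetP[b /= bB ->]].
  by rewrite model_sumsP // => h; apply/imfsetP; exists b => //=; rewrite !inE bB.
apply: leq_trans (nB b bB); apply: (@leq_trans #|` [fset phi a | a in [fset a in A | (a + b)%R \notin Z]]|);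
  last exact: leq_imfset_card.
apply: fsubset_leq_card; apply/fsubsetP => y; rewrite !inE => /andP[/imfsetP[a /= aA ->]].
by rewrite model_sumsP // => h; apply/imfsetP; exists a => //=; rewrite !inE aA.
Qed.

End Transfer.

Variables (A B : {fset nat}) (k : nat).
Hypotheses (cA : #|` A| = k) (cB : #|` B| = k) (k0 : (0 < k)%N).
Hypothesis wA : forall a, a \in A -> exists w, word_val w = a%:R.
Hypothesis wB : forall b, b \in B -> exists w, word_val w = b%:R.
Hypothesis gAB : forall i, ((g i).+1 \in A) || ((g i).+1 \in B).

Lemma free_rank_third : (free_rank R g * k <= 3 * #|` fsum A B|)%N.
Proof.
have [a0 a0A] : exists a, a \in A by apply/fset0Pn; rewrite -cardfs_gt0 cA.
have [b0 b0B] : exists b, b \in B by apply/fset0Pn; rewrite -cardfs_gt0 cB.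
have [phi [psi [iso p0 q0 hr]]] := freiman_model a0A b0B wA wB gAB.
apply: leq_trans (leq_mul hr (leqnn k)) _.
apply: leq_trans (_ : _ <= 3 * #|` fsum [fset phi a | a in A] [fset psi b | b in B]|)%N _.
  apply: freiman_third => //.
    by rewrite card_in_imfset ?cA //; apply: (model_injl iso b0B).
  by rewrite card_in_imfset ?cB //; apply: (model_injr iso a0A).
by rewrite leq_mul2l /=; apply: card_model_fsum.
Qed.

End Model.

Lemma free_rank_robust (R : realType) (K N : nat) : (0 < K)%N -> (0 < N)%N ->
  exists k0 C : nat, forall m n (g : {ffun 'I_m -> 'I_n}) (A B Z : {fset nat}) e k,
    (k0 <= k)%N -> (0 < k)%N -> (C * e <= k)%N -> #|` A| = k -> #|` B| = k ->
    (forall a, a \in A -> exists w, word_val R g w = a%:R) ->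
    (forall b, b \in B -> exists w, word_val R g w = b%:R) ->
    (forall i, ((g i).+1 \in A) || ((g i).+1 \in B)) ->
    nearly_full A B Z e -> (#|` fsum A B| <= K * k)%N ->
    ((N - 3) * (free_rank R g * k) <= 3 * N * #|` Z|)%N.
Proof.
move=> K0 N0; have [k0 [C h]] := @robust_freiman R K N K0 N0.
exists k0, C => m n g A B Z e k hk kp he cA cB wA wB gAB nf hS.
have [a0 a0A] : exists a, a \in A by apply/fset0Pn; rewrite -cardfs_gt0 cA.
have [b0 b0B] : exists b, b \in B by apply/fset0Pn; rewrite -cardfs_gt0 cB.
have [phi [psi [iso p0 q0 hr]]] := freiman_model a0A b0B wA wB gAB.
apply: leq_trans (_ : _ <= 3 * N * #|` model_sums A B phi psi Z|)%N _; last first.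
  by rewrite leq_mul2l (card_model_sums iso) orbT.
apply: (@leq_trans ((N - 3) * ((\rank (dirmx [fset phi a | a in A] [fset psi b | b in B])).+2 * k))).
  by rewrite leq_mul2l leq_mul2r hr !orbT.
apply: (h _ _ _ _ e) => //.
- exact: model_nearly_full.
- by apply/imfsetP; exists a0.
- by apply/imfsetP; exists b0.
- by rewrite card_in_imfset ?cA //; apply: (model_injl iso b0B).
- by rewrite card_in_imfset ?cB //; apply: (model_injr iso a0A).
- by apply: leq_trans hS; apply: card_model_fsum.
Qed.

(** * Families of candidate witnesses *)

Lemma imfset_set (I : finType) (T : choiceType) (f : I -> T) (c : {set I}) :
  [fset f i | i in c] = [fset f i | i in [fset i in c]].
Proof.
by apply/fsetP => x; apply/imfsetP/imfsetP => -[i /= ic ->]; exists i;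
  rewrite //= !inE in ic *.
Qed.

Lemma card_imfset_set (I : finType) (T : choiceType) (f : I -> T) (c : {set I}) :
  injective f -> #|` [fset f i | i in c]| = #|c|.
Proof.
move=> inj; rewrite imfset_set (_ : #|c| = #|` [fset i in c]|); last by rewrite card_finset.
exact: card_imfset.
Qed.

Lemma card_imfset_set_le (I : finType) (T : choiceType) (f : I -> T) (c : {set I}) :
  (#|` [fset f i | i in c]| <= #|c|)%N.
Proof.
rewrite imfset_set (_ : #|c| = #|` [fset i in c]|); last by rewrite card_finset.
exact: leq_imfset_card.
Qed.

(* Values of g : 'I_m -> 'I_n are shifted by one, so as to range over 1, ..., n. *)
Definition pts (m n : nat) (g : {ffun 'I_m -> 'I_n}) (c : {set 'I_m}) : {fset nat} :=
  [fset (g i).+1 | i in c].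

Lemma enum_dictionary (D : {fset nat}) n : D != fset0 ->
  (forall x, x \in D -> (0 < x <= n)%N) ->
  exists g : {ffun 'I_#|` D| -> 'I_n}, [/\ forall i, (g i).+1 \in D,
    forall x, x \in D -> exists i, (g i).+1 = x &
    forall E : {fset nat}, E `<=` D -> exists2 c, pts g c = E & #|c| = #|` E|].
Proof.
move=> /fset0Pn[x0 x0D] hD; pose s : seq nat := D.
case: n hD => [|n] hD.
  by have := hD _ x0D; rewrite leqn0 => /andP[+ /eqP e0]; rewrite e0.
pose g : {ffun 'I_#|` D| -> 'I_n.+1} := [ffun i : 'I_#|` D| => inord (nth x0 s i).-1].
have gE (i : 'I_#|` D|) : (g i).+1 = nth x0 s i.
  have iD : nth x0 s i \in D by apply: mem_nth.
  rewrite ffunE; case: (nth x0 s i) (hD _ iD) => //= x hx.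
  by rewrite inordK.
have gD (i : 'I_#|` D|) : (g i).+1 \in D by rewrite gE; apply: mem_nth.
have gsurj x : x \in D -> exists i, (g i).+1 = x.
  move=> xD; have xs : (index x s < #|` D|)%N by rewrite index_mem.
  by exists (Ordinal xs); rewrite gE nth_index.
have ginj : injective (fun i => (g i).+1).
  move=> i j; rewrite !gE => /eqP; rewrite nth_uniq ?fset_uniq // => /eqP h.
  exact: val_inj.
exists g; split => // E sE; pose c := [set i : 'I_#|` D| | (g i).+1 \in E].
have pc : pts g c = E.
  apply/fsetP => x; apply/imfsetP/idP => [[i /=]|xE]; first by rewrite inE => ? ->.
  have [i hi] := gsurj x (fsubsetP sE _ xE).
  by exists i; rewrite //= inE hi.
by exists c => //; rewrite -pc card_imfset_set.
Qed.

Definition draws (D : {fset nat}) (j : nat) : {fset {fset nat}} :=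
  [fset X in fpowerset D | #|` X| == j].

Lemma mem_draws D j X : (X \in draws D j) = (X `<=` D) && (#|` X| == j).
Proof. by rewrite !inE fpowersetE. Qed.

Lemma card_draws_le D j N : (#|` D| <= N)%N -> (#|` draws D j| <= 'C(N, j))%N.
Proof.
move=> hN; apply: (@leq_trans 'C(#|` D|, j)); last exact: leq_bin2l.
pose f (X : {fset nat}) : {set D} := [set x | val x \in X].
have sub X : X `<=` D -> [fset val x | x in f X] = X.
  move=> sX; apply/fsetP => x; apply/imfsetP/idP => [[y /=]|xX]; first by rewrite inE => ? ->.
  by exists [` fsubsetP sX x xX]; rewrite //= inE.
have inj : {in draws D j &, injective f}.
  move=> X Y; rewrite !mem_draws => /andP[sX _] /andP[sY _] e1.
  by rewrite -(sub X sX) e1 sub.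
have -> : 'C(#|` D|, j) = #|[set A : {set D} | #|A| == j]|.
  by rewrite card_draws cardfE.
have <- : #|` [fset f X | X in draws D j]| = #|` draws D j| by rewrite card_in_imfset.
rewrite -card_finset.
apply: fsubset_leq_card; apply/fsubsetP => c /imfsetP[X /=].
rewrite mem_draws => /andP[sX /eqP cX] ->; rewrite !inE.
by rewrite -cX -[in X in _ == X](sub X sX) card_imfset_set //; apply: val_inj.
Qed.

Lemma card_bigfcup (T : choiceType) (I : finType) (P : pred I) (F : I -> {fset T}) c :
  (forall i, P i -> #|` F i| <= c)%N -> (#|` \big[fsetU/fset0]_(i | P i) F i| <= #|P| * c)%N.
Proof.
move=> h; rewrite -sum_nat_const.
apply: (big_ind2 (fun (A : {fset T}) k => #|` A| <= k)%N) => //.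
move=> A k A' k' hA hA'; apply: leq_trans (leq_card_fsetU _ _) _; exact: leq_add.
Qed.

Lemma mem_bigfcup (T : choiceType) (I : finType) (P : pred I) (F : I -> {fset T}) i x :
  P i -> x \in F i -> x \in \big[fsetU/fset0]_(i | P i) F i.
Proof.
by move=> Pi xF; apply/bigfcupP; exists i; rewrite ?mem_index_enum.
Qed.

Section Families.
Variables (R : realType) (n k : nat).

(* c selects the two sets whose sum is taken from a dictionary g. *)
Definition dictionary_sumsets (m r : nat) : {fset {fset nat}} :=
  \big[fsetU/fset0]_(g : {ffun 'I_m -> 'I_n} | free_rank R g == r)
   \big[fsetU/fset0]_(c : {set 'I_m} * {set 'I_m}) [fset fsum (pts g c.1) (pts g c.2)].

Lemma card_dictionary_sumsets m r : (0 < m)%N ->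
  (#|` dictionary_sumsets m r| <= ((m ^ 12) ^ m * n ^ r) * 4 ^ m)%N.
Proof.
move=> m0; apply: (leq_trans (card_bigfcup (c := 4 ^ m) _)).
  move=> g _; apply: (leq_trans (card_bigfcup (c := 1) _)).
    by move=> c _; rewrite cardfs1.
  by rewrite muln1 card_prod -cardsT -powersetT card_powerset cardsT card_ord -expnMn.
rewrite leq_mul2r; apply/orP; right; apply: leq_trans (card_free_rank R n r m0).
by rewrite cardsE.
Qed.

Definition fdiff (A B : {fset nat}) := [fset (a - b)%N | a in A, b in B].

(* Here the sums of the dictionary only provide a small superset, out of which
   the two sets are drawn; truncated subtraction in fdiff does no harm. *)
Definition sampled_sumsets (L s m r k1 : nat) : {fset {fset nat}} :=
  \big[fsetU/fset0]_(g : {ffun 'I_m -> 'I_n} | free_rank R g == r)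
   \big[fsetU/fset0]_(c : ({set 'I_m} * {set 'I_m}) * ({set 'I_m} * {set 'I_m}) |
      [&& #|` fsum (pts g c.1.1) (pts g c.1.2)| <= s, #|c.2.1| <= L & #|c.2.2| <= L]%N)
     [fset fsum X Y
      | X in draws (fdiff (fsum (pts g c.1.1) (pts g c.1.2)) (pts g c.2.2)) k1,
        Y in draws (fdiff (fsum (pts g c.1.1) (pts g c.1.2)) (pts g c.2.1)) k1].

Lemma card_pts_le m (g : {ffun 'I_m -> 'I_n}) c : (#|` pts g c| <= #|c|)%N.
Proof. exact: card_imfset_set_le. Qed.

Lemma card_sampled_sumsets L s m r k1 : (0 < m)%N ->
  (#|` sampled_sumsets L s m r k1| <= ((m ^ 12) ^ m * n ^ r) * (16 ^ m * 'C(s * L, k1) ^ 2))%N.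
Proof.
move=> m0; apply: (leq_trans (card_bigfcup (c := 16 ^ m * 'C(s * L, k1) ^ 2) _)).
  move=> g _; apply: (leq_trans (card_bigfcup (c := 'C(s * L, k1) ^ 2) _)).
    move=> c /and3P[c1 c2 c3]; apply: leq_trans (card_imfset2_le _ _ _) _.
    rewrite -mulnn; apply: leq_mul; apply: card_draws_le;
    apply: leq_trans (card_imfset2_le _ _ _) _; apply: leq_mul => //;
    by apply: leq_trans (card_pts_le _ _) _.
  rewrite leq_mul2r; apply/orP; right; apply: leq_trans (max_card _) _.
  by rewrite !card_prod -cardsT -powersetT card_powerset cardsT card_ord -!expnMn.
rewrite leq_mul2r; apply/orP; right; apply: leq_trans (card_free_rank R n r m0).
by rewrite cardsE.
Qed.

End Families.

Lemma card_addset (a : nat) (B : {fset nat}) : #|` [fset (a + b)%N | b in B]| = #|` B|.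
Proof. by apply: card_imfset; exact: addnI. Qed.

Section Family.
Variables (R : realType) (n k L : nat) (E Q : nat -> nat).

(** The part of the count other than [n ^ r]: the relations, and then two subsets of the dictionary.
    In [sampled_cost] there are four subsets, and two draws from sets of at most [s * L]
    differences. *)
Definition dictionary_cost (m : nat) : nat := ((m ^ 12) ^ m * 4 ^ m)%N.
Definition sampled_cost (m s k1 : nat) : nat := ((m ^ 12) ^ m * (16 ^ m * 'C(s * L, k1) ^ 2))%N.

Definition family (s : nat) : {fset {fset nat}} :=
  [fset U in \big[fsetU/fset0]_(m < (2 * k).+1 | (0 < m)%N)
     \big[fsetU/fset0]_(r < (2 * k).+1 | (r <= Q s)%N)
       ((if (dictionary_cost m <= E s)%N then dictionary_sumsets R n m r else fset0) `|`
        \big[fsetU/fset0]_(j < k.+1 | (sampled_cost m s j <= E s)%N) sampled_sumsets R n L s m r j)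
  | #|` U| == s].

Lemma card_family s : (0 < n)%N ->
  (#|` family s| <= (2 * k).+1 * ((2 * k).+1 * (k.+2 * (E s * n ^ Q s))))%N.
Proof.
move=> n0.
apply: (@leq_trans #|` \big[fsetU/fset0]_(m < (2 * k).+1 | (0 < m)%N)
     \big[fsetU/fset0]_(r < (2 * k).+1 | (r <= Q s)%N)
       ((if (dictionary_cost m <= E s)%N then dictionary_sumsets R n m r else fset0) `|`
        \big[fsetU/fset0]_(j < k.+1 | (sampled_cost m s j <= E s)%N) sampled_sumsets R n L s m r j)|).
  by apply: fsubset_leq_card; apply/fsubsetP => U; rewrite !inE => /andP[].
apply: (leq_trans (card_bigfcup (c := (2 * k).+1 * (k.+2 * (E s * n ^ Q s))) _)); last first.
  by rewrite leq_mul2r; apply/orP; right; rewrite -[X in (_ <= X)%N]card_ord max_card.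
move=> m m0; apply: (leq_trans (card_bigfcup (c := k.+2 * (E s * n ^ Q s)) _)); last first.
  by rewrite leq_mul2r; apply/orP; right; rewrite -[X in (_ <= X)%N]card_ord max_card.
move=> r rQ; apply: leq_trans (leq_card_fsetU _ _) _; rewrite [X in (_ <= X)%N]mulSn.
have nr : (n ^ r <= n ^ Q s)%N by rewrite leq_pexp2l.
apply: leq_add.
  case: ifP => h; last by rewrite cardfs0.
  apply: leq_trans (card_dictionary_sumsets R n r m0) _; rewrite mulnAC; exact: leq_mul.
apply: (leq_trans (card_bigfcup (c := E s * n ^ Q s) _)); last first.
  by rewrite leq_mul2r; apply/orP; right; rewrite -[X in (_ <= X)%N]card_ord max_card.
move=> j hj; apply: leq_trans (card_sampled_sumsets R n L s r j m0) _.
by rewrite mulnAC; apply: leq_mul.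
Qed.

Lemma dictionary_in_family m (g : {ffun 'I_m -> 'I_n}) (c c' : {set 'I_m}) :
  let U := fsum (pts g c) (pts g c') in let s := #|` U| in
  (0 < m <= 2 * k)%N -> (free_rank R g <= Q s)%N -> (dictionary_cost m <= E s)%N ->
  U \in family s.
Proof.
move=> U s /andP[m0 mk] hr hc; rewrite !inE eqxx andbT.
have hm : (m < (2 * k).+1)%N by [].
apply: (mem_bigfcup (i := Ordinal hm)) => //=.
have hr2 : (free_rank R g < (2 * k).+1)%N.
  by rewrite ltnS; apply: leq_trans mk; apply: leq_subr.
apply: (mem_bigfcup (i := Ordinal hr2)) => //=.
rewrite in_fsetU hc; apply/orP; left.
apply: (mem_bigfcup (i := g)) => //=.
by apply: (mem_bigfcup (i := (c, c'))) => //=; rewrite inE.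
Qed.

Lemma sampled_in_family m (g : {ffun 'I_m -> 'I_n}) (c c' a b : {set 'I_m}) (X Y : {fset nat}) :
  let U := fsum X Y in let s := #|` U| in
  (0 < m <= 2 * k)%N -> (free_rank R g <= Q s)%N -> (sampled_cost m s #|` X| <= E s)%N ->
  (#|` X| <= k)%N -> #|` Y| = #|` X| ->
  (#|` fsum (pts g c) (pts g c')| <= s)%N -> (#|a| <= L)%N -> (#|b| <= L)%N ->
  X `<=` fdiff (fsum (pts g c) (pts g c')) (pts g b) ->
  Y `<=` fdiff (fsum (pts g c) (pts g c')) (pts g a) ->
  U \in family s.
Proof.
move=> U s /andP[m0 mk] hr hc hX hY hs ha hb sX sY; rewrite !inE eqxx andbT.
have hm : (m < (2 * k).+1)%N by [].
apply: (mem_bigfcup (i := Ordinal hm)) => //=.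
have hr2 : (free_rank R g < (2 * k).+1)%N.
  by rewrite ltnS; apply: leq_trans mk; apply: leq_subr.
apply: (mem_bigfcup (i := Ordinal hr2)) => //=.
rewrite in_fsetU; apply/orP; right.
have hj : (#|` X| < k.+1)%N by [].
apply: (mem_bigfcup (i := Ordinal hj)) => //=.
apply: (mem_bigfcup (i := g)) => //=.
apply: (mem_bigfcup (i := ((c, c'), (a, b)))) => /=; first by rewrite hs ha hb.
by apply/imfset2P; exists X; [rewrite /= mem_draws sX eqxx | exists Y; rewrite //= mem_draws sY hY eqxx].
Qed.

Lemma word_val_dictionary m (g : {ffun 'I_m -> 'I_n}) (D : {fset nat}) a b c :
  (forall x, x \in D -> exists i, (g i).+1 = x :> nat) ->
  a \in D -> b \in D -> c \in D -> (c <= a + b)%N ->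
  exists w, word_val R g w = (a + b - c)%N%:R.
Proof.
move=> surj /surj[i <-] /surj[j <-] /surj[l <-] h; exists (i, j, l).
by rewrite /word_val /word_vec /= htB htD /ht -!rowE !mxE natrB // natrD.
Qed.

(* Three regimes.  If |A + B| > u k, all of A and B serve as a dictionary.  If not,
   A and B are pruned to A1 and B1; then either |A1 + B1| is more than K times
   |A1|, and A1, B1 are drawn from differences of the dictionary, or the sumset of
   the dictionary itself is the witness, being large by free_rank_robust. *)
Variables (u t e p h t1 t2 N K k0 C : nat).
Let M := (2 * L + h * t1 + t2)%N.

Hypothesis robust : forall m (g : {ffun 'I_m -> 'I_n}) (A B Z : {fset nat}) e k,
    (k0 <= k)%N -> (0 < k)%N -> (C * e <= k)%N -> #|` A| = k -> #|` B| = k ->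
    (forall a, a \in A -> exists w, word_val R g w = a%:R) ->
    (forall b, b \in B -> exists w, word_val R g w = b%:R) ->
    (forall i, ((g i).+1 \in A) || ((g i).+1 \in B)) ->
    nearly_full A B Z e -> (#|` fsum A B| <= K * k)%N ->
    ((N - 3) * (free_rank R g * k) <= 3 * N * #|` Z|)%N.

Hypothesis k_gt0 : (0 < k)%N.
Hypothesis e_gt0 : (0 < e)%N.
Hypothesis N_ge : (2 <= N)%N.
Hypothesis prune_few : (N * (t * u) <= e)%N.
Hypothesis M_small : (M <= 2 * k)%N.
Hypothesis rank_ok : forall s r j, (j <= k)%N -> (N * (k - j) <= k)%N ->
  ((N - 3) * (r * j) <= 3 * N * s)%N -> (r <= Q s)%N.
Hypothesis cost_large : forall s, (u * k < s)%N -> (dictionary_cost (2 * k) <= E s)%N.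
Hypothesis cost_small : forall s, (k <= 4 * s)%N -> (dictionary_cost M <= E s)%N.
Hypothesis cost_mid : forall s j, (j <= k)%N -> (k <= 2 * j)%N -> (K * j < s)%N ->
  (sampled_cost M s j <= E s)%N.
Hypothesis size_bounds : forall j, (j <= k)%N -> (k <= 2 * j)%N ->
  [/\ (j * e ^ L < j ^ L)%N, (2 * e <= j)%N, (k0 <= j)%N, (C * e <= j)%N &
      (j * j * (j - p) ^ t1 < j ^ t1)%N /\ (j * j * (j - h) ^ t2 < j ^ t2)%N].
Hypothesis p_ok : (p + h * t1 <= t)%N.

Lemma leq_self_exp (a b m m' : nat) : (0 < m)%N -> (m <= m')%N ->
  ((m ^ a) ^ m * b.+1 ^ m <= (m' ^ a) ^ m' * b.+1 ^ m')%N.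
Proof.
move=> m0 hm; apply: leq_mul; last by rewrite leq_pexp2l.
apply: (@leq_trans ((m' ^ a) ^ m)); first by rewrite leq_exp2r //; case: (a) => [|a']; rewrite ?expn0 // leq_exp2r.
by rewrite leq_pexp2l // expn_gt0 (leq_trans m0 hm).
Qed.

Lemma dictionary_cost_mono m m' : (0 < m)%N -> (m <= m')%N -> (dictionary_cost m <= dictionary_cost m')%N.
Proof. exact: leq_self_exp. Qed.

Lemma sampled_cost_mono m m' s j : (0 < m)%N -> (m <= m')%N -> (sampled_cost m s j <= sampled_cost m' s j)%N.
Proof.
move=> m0 hm; rewrite /sampled_cost [X in (X <= _)%N]mulnA [X in (_ <= X)%N]mulnA leq_mul2r; apply/orP; right.
exact: (@leq_self_exp 12 15).
Qed.

Theorem witness (A B : {fset nat}) : #|` A| = k -> #|` B| = k ->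
  (forall x, x \in A `|` B -> (0 < x <= n)%N) ->
  exists U, [/\ U `<=` fsum A B, (k <= 4 * #|` U|)%N, (#|` U| <= k * k)%N &
     U \in family #|` U|].
Proof.
move=> cA cB hAB.
have kk (A' B' : {fset nat}) : (#|` A'| <= k)%N -> (#|` B'| <= k)%N -> (#|` fsum A' B'| <= k * k)%N.
  by move=> h1 h2; apply: leq_trans (card_fsum_le _ _) (leq_mul h1 h2).
have row_le (A' B' : {fset nat}) : A' != fset0 -> (#|` B'| <= #|` fsum A' B'|)%N.
  move=> /fset0Pn[a aA]; rewrite -(card_addset a B').
  by apply: fsubset_leq_card; apply/fsubsetP => z /imfsetP[b /= bB ->]; apply: mem_fsum aA bB.
have An0 : A != fset0 by rewrite -cardfs_gt0 cA.
have [vh|] := ltnP (u * k) #|` fsum A B|.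
  have [|g [g1 g2 g3]] := enum_dictionary (D := A `|` B) (n := n) _ hAB.
    by apply: contraNneq An0 => e1; rewrite -fsubset0 -e1 fsubsetUl.
  have [cA' pA _] := g3 A (fsubsetUl _ _); have [cB' pB _] := g3 B (fsubsetUr _ _).
  have hm : (0 < #|` A `|` B| <= 2 * k)%N.
    rewrite cardfs_gt0; apply/andP; split.
      by apply: contraNneq An0 => e1; rewrite -fsubset0 -e1 fsubsetUl.
    by apply: leq_trans (leq_card_fsetU _ _) _; rewrite cA cB mul2n addnn.
  exists (fsum A B); split; rewrite ?fsubset_refl ?kk ?cA ?cB //.
    by rewrite -[X in (X <= _)%N]cB; apply: leq_trans (row_le A B An0) _; rewrite leq_pmull.
  have := @dictionary_in_family _ g cA' cB'; rewrite /= pA pB; apply => //.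
    apply: (@rank_ok _ _ k) => //; first by rewrite subnn muln0.
    have h3 : (free_rank R g * k <= 3 * #|` fsum A B|)%N.
      have word_of x : x \in A `|` B -> exists w, word_val R g w = x%:R.
        move=> xD; have [|w] := @word_val_dictionary _ g (A `|` B) x x x g2 xD xD xD _.
          by rewrite leq_addr.
        by rewrite addnK; exists w.
      apply: (free_rank_third cA cB k_gt0).
      - by move=> a aA; apply: word_of; rewrite in_fsetU aA.
      - by move=> b bB; apply: word_of; rewrite in_fsetU bB orbT.
      - by move=> i; have := g1 i; rewrite in_fsetU.
    apply: (@leq_trans (N * (3 * #|` fsum A B|))); last by rewrite mulnCA mulnA.
    by apply: leq_mul; first exact: leq_subr.
  apply: leq_trans (cost_large vh); case/andP: hm => m0 mk; exact: dictionary_cost_mono.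
move=> hS.
have [A1 [B1 [sA sB cAB hk nf]]] := prune t e cA cB.
set j := #|` A1| in cAB hk.
have jk : (j <= k)%N by rewrite -cA fsubset_leq_card.
(* Pruning discards at most a proportion 1 / N, because |A + B| <= u k and N t u <= e. *)
have kj : (N * (k - j) <= k)%N.
  rewrite -(leq_pmul2r e_gt0) -mulnA; apply: leq_trans (leq_mul (leqnn N) hk) _.
  apply: (@leq_trans (N * (t * (u * k)))); first by rewrite !leq_mul2l hS !orbT.
  by rewrite (mulnA t) (mulnA N) mulnC leq_mul2l prune_few orbT.
have k2j : (k <= 2 * j)%N by clear -kj jk N_ge; nia.
have [n1 n2 n3 n4 [n5 n6]] := size_bounds jk k2j.
have j0 : (0 < j)%N by clear -k2j k_gt0; lia.
have ej : (e <= j)%N by clear -n2; lia.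
have cA1 : #|` A1| = j by []. have cB1 : #|` B1| = j by rewrite -cAB.
set Z := popular A1 B1 t in nf.
have [A0 [B0 [A2 [B2 [[sA0 sB0 sA2 sB2] [c1 c2 c3 c4] sZ hA hB]]]]] :=
  dictionary cA1 cB1 nf n1 ej p_ok n5 n6.
have A1n0 : A1 != fset0 by rewrite -cardfs_gt0.
have [a0 a0A] := fset0Pn _ A1n0.
have [b0 b0B a0b0] := hA a0 a0A.
have D0 : A2 `|` B2 != fset0.
  by apply/fset0Pn; exists b0; rewrite in_fsetU (fsubsetP sB0 _ b0B) orbT.
have sAB : A2 `|` B2 `<=` A `|` B.
  by apply: fsetUSS; [exact: fsubset_trans sA2 sA | exact: fsubset_trans sB2 sB].
have [|g [g1 g2 g3]] := enum_dictionary (D := A2 `|` B2) (n := n) D0 _.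
  by move=> x xD; apply: hAB; apply: (fsubsetP sAB).
set m := #|` A2 `|` B2| in g g1 g2 g3.
have [cA' pA _] := g3 A2 (fsubsetUl _ _); have [cB' pB _] := g3 B2 (fsubsetUr _ _).
have mM : (m <= M)%N.
  apply: leq_trans (leq_card_fsetU _ _) _; apply: leq_trans (leq_add c3 c4) _.
  by rewrite /M; clear; lia.
have m0 : (0 < m)%N by rewrite cardfs_gt0.
have hm : (0 < m <= 2 * k)%N by rewrite m0 (leq_trans mM).
have ZA2 : forall z, z \in Z -> exists a b, [/\ a \in A2 `|` B2, b \in A2 `|` B2 & z = (a + b)%N].
  move=> z /(fsubsetP sZ) /fsumP[a [b [aA bB ->]]]; exists a, b.
  by rewrite !in_fsetU aA bB orbT.
(* Some b in B0 makes a + b popular, hence equal to a sum x + y of dictionary entries, and a is the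
   word x + y - b. *)
have wA a : a \in A1 -> exists w, word_val R g w = a%:R.
  move=> /hA[b bB0 /ZA2[x [y [xD yD e1]]]].
  have bD : b \in A2 `|` B2 by rewrite in_fsetU (fsubsetP sB0 _ bB0) orbT.
  have [|w hw] := @word_val_dictionary _ g (A2 `|` B2) x y b g2 xD yD bD _.
    by rewrite -e1 leq_addl.
  by exists w; rewrite hw -e1 addnK.
have wB b : b \in B1 -> exists w, word_val R g w = b%:R.
  move=> /hB[a aA0 /ZA2[x [y [xD yD e1]]]].
  have aD : a \in A2 `|` B2 by rewrite in_fsetU (fsubsetP sA0 _ aA0).
  have [|w hw] := @word_val_dictionary _ g (A2 `|` B2) x y a g2 xD yD aD _.
    by rewrite -e1 leq_addr.
  by exists w; rewrite hw -e1 addKn.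
have gAB i : ((g i).+1 \in A1) || ((g i).+1 \in B1).
  have := g1 i; rewrite in_fsetU => /orP[/(fsubsetP sA2) ->|/(fsubsetP sB2) ->] //.
  by rewrite orbT.
have sS : fsum A2 B2 `<=` fsum A1 B1 by apply: fsumS.
have [big|small] := ltnP (K * j) #|` fsum A1 B1|.
  exists (fsum A1 B1); split.
  - exact: fsumS.
  - have := row_le A1 B1 A1n0; rewrite cB1 => h1.
    by apply: leq_trans k2j _; apply: leq_mul.
  - by apply: kk; rewrite ?cB1 ?cA1.
  have [ca pa ea] := g3 A0 (fsubset_trans sA0 (fsubsetUl _ _)).
  have [cb pb eb] := g3 B0 (fsubset_trans sB0 (fsubsetUr _ _)).
  apply: (@sampled_in_family m g cA' cB' ca cb) => //; rewrite ?pA ?pB ?pa ?pb ?ea ?eb //.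
  - apply: (@rank_ok _ _ j) => //.
    have h3 := free_rank_third cA1 cB1 j0 wA wB gAB.
    apply: (@leq_trans (N * (3 * #|` fsum A1 B1|))); last by rewrite mulnCA mulnA.
    by apply: leq_mul; first exact: leq_subr.
  - by rewrite cA1; apply: leq_trans (cost_mid jk k2j big); apply: sampled_cost_mono.
  - exact: fsubset_leq_card.
  - apply/fsubsetP => a aA; have [b bB0 zZ] := hA a aA.
    by apply/imfset2P; exists (a + b)%N; [exact: (fsubsetP sZ) | exists b; rewrite // addnK].
  - apply/fsubsetP => b bB; have [a aA0 zZ] := hB b bB.
    by apply/imfset2P; exists (a + b)%N; [exact: (fsubsetP sZ) | exists a; rewrite // addKn].
(* A single row already has j - e popular sums, and j - e >= j / 2 >= k / 4. *)
have hZ : (k <= 4 * #|` Z|)%N.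
  have := nf.1 a0 a0A.
  have : (#|` B1| <= #|` [fset b in B1 | (a0 + b)%R \notin Z]| + #|` Z|)%N.
    apply: leq_trans (_ : _ <= #|` [fset b in B1 | (a0 + b)%R \notin Z]| + #|` [fset b in B1 | (a0 + b)%R \in Z]|)%N _.
      apply: leq_trans (leq_card_fsetU _ _); apply: fsubset_leq_card.
      apply/fsubsetP => b bB; rewrite in_fsetU; apply/orP.
      have [h'|h'] := boolP ((a0 + b)%R \in Z); [right | left];
        by apply/imfsetP; exists b => //=; rewrite inE bB.
    rewrite leq_add2l -(card_addset a0 [fset b in B1 | (a0 + b)%R \in Z]).
    by apply: fsubset_leq_card; apply/fsubsetP => z /imfsetP[b /=]; rewrite !inE => /andP[_ ?] ->.
  rewrite cB1; move: #|` _| #|` Z| => x y; clear -n2 k2j; lia.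
have cZ : (#|` Z| <= #|` fsum A2 B2|)%N by apply: fsubset_leq_card.
have hU : (k <= 4 * #|` fsum A2 B2|)%N by apply: leq_trans hZ _; rewrite leq_mul2l cZ orbT.
exists (fsum A2 B2); split => //.
- by apply: fsubset_trans sS _; apply: fsumS.
- by apply: kk; [rewrite -cA | rewrite -cB]; apply: fsubset_leq_card;
   [exact: fsubset_trans sA2 sA | exact: fsubset_trans sB2 sB].
have := @dictionary_in_family _ g cA' cB'; rewrite /= pA pB; apply => //.
- apply: (@rank_ok _ _ j) => //.
  apply: leq_trans (robust n3 j0 n4 cA1 cB1 wA wB gAB nf small) _.
  by rewrite leq_mul2l cZ orbT.
- by apply: leq_trans (cost_small hU); apply: dictionary_cost_mono.
Qed.

End Family.

(** * Choice of the parameters *)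

Section Numeric.
Variable R : realType.

Lemma poly_le_exp (a b c : nat) : (0 < c)%N ->
  exists u0 : nat, forall u, (u0 <= u)%N -> (a * u ^ b)%:R <= expR (u%:R / c%:R) :> R.
Proof.
move=> c0; pose d := (c * b.+1)%N; exists (a * d ^ b.+1)%N => u hu.
have d0 : 0 < d%:R :> R by rewrite ltr0n muln_gt0 c0.
have -> : u%:R / c%:R = (u%:R / d%:R) * b.+1%:R :> R.
  rewrite /d natrM; field.
  by rewrite addrC natr1 !pnatr_eq0 /= -lt0n.
rewrite expRM_natr.
apply: (@le_trans _ _ ((u%:R / d%:R) ^+ b.+1)); last first.
  rewrite lerXn2r ?nnegrE ?expR_ge0 ?divr_ge0 ?ler0n //.
  by apply: le_trans (expR_ge1Dx _); rewrite lerDr.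
rewrite expr_div_n ler_pdivlMr ?exprn_gt0 // -!natrX -natrM ler_nat.
by rewrite [X in (_ <= X)%N]expnSr mulnAC [X in (X <= _)%N]mulnC leq_mul2l hu orbT.
Qed.

Lemma linear_le_exp (a c : R) : 0 < a -> 0 < c ->
  exists x0 : nat, forall x, x0%:R <= x -> a * x <= expR (c * x).
Proof.
move=> a0 c0; exists (Num.truncn (4 * a / c ^+ 2)).+1 => x hx.
have x1 : 4 * a / c ^+ 2 <= x.
  by apply: le_trans hx; apply/ltW; apply: truncnS_gt.
have x0 : 0 <= x by apply: le_trans x1; rewrite divr_ge0 ?exprn_ge0 ?mulr_ge0 ?ltW.
apply: (@le_trans _ _ ((c * x / 2) ^+ 2)); last first.
  have -> : c * x = (c * x / 2) * 2%:R by field.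
  rewrite expRM_natr lerXn2r ?nnegrE ?expR_ge0 //.
    by rewrite !mulr_ge0 // ?ltW.
  have -> : c * x / 2 * 2 / 2 = c * x / 2 by field.
  by apply: le_trans (expR_ge1Dx _); rewrite lerDr.
move: x1; rewrite ler_pdivrMr ?exprn_gt0 // => x1.
have := ler_wpM2l x0 x1; rewrite expr_div_n exprMn ler_pdivlMr ?exprn_gt0 // => h.
nra.
Qed.

(** This is (1 - p / j)^t <= exp (- p t / j). *)
Lemma hitting_decay (j p t : nat) : (0 < j)%N -> (p <= j)%N ->
  (j * j)%:R < expR ((p * t)%:R / j%:R) :> R -> (j * j * (j - p) ^ t < j ^ t)%N.
Proof.
move=> j0 pj h; have j0' : 0 < j%:R :> R by rewrite ltr0n.
rewrite -(ltr_nat R) natrM !natrX natrB //.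
have -> : j%:R - p%:R = j%:R * (1 - p%:R / j%:R) :> R.
  by rewrite mulrBr mulr1 mulrC divfK // gt_eqF.
rewrite exprMn mulrCA gtr_pMr ?exprn_gt0 //.
apply: (@le_lt_trans _ _ ((j * j)%:R * expR (- ((p * t)%:R / j%:R)))).
  rewrite ler_wpM2l ?ler0n //.
  have -> : - ((p * t)%:R / j%:R) = (- (p%:R / j%:R)) * t%:R :> R.
    by rewrite natrM; field; rewrite gt_eqF.
  rewrite expRM_natr lerXn2r ?nnegrE ?expR_ge0 ?subr_ge0 //.
    by rewrite ler_pdivrMr // mul1r ler_nat.
  exact: expR_ge1Dx.
by rewrite expRN ltr_pdivrMr ?expR_gt0 // mul1r.
Qed.

(** The j-th term of (1 + j / a)^a is at most exp j. *)
Lemma bin_le_exp (a j : nat) : (0 < j <= a)%N ->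
  'C(a, j)%:R <= (expR 1 * (a%:R / j%:R)) ^+ j :> R.
Proof.
move=> /andP[j0 ja]; have a0 : (0 < a)%N by apply: leq_trans ja.
have j0' : 0 < j%:R :> R by rewrite ltr0n.
have a0' : 0 < a%:R :> R by rewrite ltr0n.
pose y : R := j%:R / a%:R; have y0 : 0 < y by rewrite divr_gt0.
have h : 'C(a, j)%:R * y ^+ j <= expR j%:R.
  apply: (@le_trans _ _ ((1 + y) ^+ a)).
    have ja' : (j < a.+1)%N by [].
    rewrite exprDn (bigD1 (Ordinal ja')) //= expr1n mul1r mulr_natl lerDl.
    by apply: sumr_ge0 => i _; rewrite expr1n mul1r mulrn_wge0 // exprn_ge0 // ltW.
  have -> : j%:R = y * a%:R by rewrite /y divfK // gt_eqF.
  by rewrite expRM_natr lerXn2r ?nnegrE ?expR_ge0 ?addr_ge0 ?(ltW y0) ?expR_ge1Dx.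
rewrite exprMn -expRM_natr mul1r -[a%:R / j%:R]invf_div exprVn ler_pdivlMr ?exprn_gt0 //.
Qed.

End Numeric.

Lemma twentieth_root : exists B : nat, (0 < B)%N /\ forall u0, exists k0,
  forall k, (k0 <= k)%N -> exists u, [/\ (u0 <= u)%N, (u ^ 20 <= k)%N & (k <= B * u ^ 20)%N].
Proof.
exists (2 ^ 20)%N; split=> [|u0]; first by rewrite expn_gt0.
exists (u0.+1 ^ 20)%N => k hk.
have ex : exists u, (u ^ 20 <= k)%N by exists u0.+1.
have bd u : (u ^ 20 <= k)%N -> (u <= k)%N.
  case: u => // u; apply: leq_trans.
  by rewrite -[X in (X <= _)%N]expn1 leq_pexp2l.
have [u hu umax] := ex_maxnP ex bd.
have u1 := umax _ hk.
exists u; split => //; first exact: ltnW.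
rewrite -expnMn; apply: (@leq_trans (u.+1 ^ 20)).
  by rewrite leqNgt; apply/negP => /ltnW /umax; rewrite ltnn.
by rewrite leq_exp2r //; clear -u1; lia.
Qed.

(** Eleven is the first exponent that leaves a power of u to spare: j^10 is at least u^200 / 2^10,
    against u^198. Then u^2 > 2^10 is needed, whence 33. *)
Lemma dictionary_scale (u j : nat) : (33 <= u)%N -> (u ^ 20 <= 2 * j)%N ->
  (j * (u ^ 18) ^ 11 < j ^ 11)%N.
Proof.
move=> hu hj; have u0 : (0 < u)%N by apply: leq_trans hu.
have j0 : (0 < j)%N.
  have : (0 < 2 * j)%N by apply: leq_trans hj; rewrite expn_gt0 u0.
  by rewrite muln_gt0.
rewrite (expnS j 10) ltn_pmul2l // -expnM (_ : (18 * 11)%N = 198%N) //.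
have h1 : (u ^ 200 <= 2 ^ 10 * j ^ 10)%N.
  by rewrite -expnMn (expnM u 20 10) leq_exp2r.
have h2 : (2 ^ 10 < u ^ 2)%N by apply: (@leq_trans (33 ^ 2)); rewrite ?leq_exp2r.
have h3 : (2 ^ 10 * u ^ 198 < 2 ^ 10 * j ^ 10)%N.
  apply: leq_trans h1; rewrite (expnD u 2 198) ltn_pmul2r //.
  by rewrite expn_gt0 u0.
by move: h3; rewrite ltn_pmul2l //.
Qed.

Section Main.
Variables (R : realType) (eps : R).
Hypotheses (eps_gt0 : 0 < eps) (eps_le1 : eps <= 1).

(** The losses 1 - 3 / N from robustness and 1 - 1 / N from pruning must fit into 3 + eps; 16 / eps
    suffices for N, since the cross terms cost at most 12 N + 4 eps N <= 16 N. *)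
Lemma rank_budget : exists N : nat, (4 <= N)%N /\ forall k s r j,
  (0 < k)%N -> (j <= k)%N -> (N * (k - j) <= k)%N ->
  ((N - 3) * (r * j) <= 3 * N * s)%N -> (r * k)%:R <= (3 + eps) * s%:R.
Proof.
exists (Num.truncn (16 / eps)).+4; split => //; set N := (_.+4)%N => k s r j k0 jk h1 h2.
have hN : 16 <= eps * N%:R.
  rewrite mulrC -ler_pdivrMr //; apply/ltW; apply: lt_le_trans (truncnS_gt _) _.
  by rewrite ler_nat /N; move: (Num.truncn _) => x; lia.
have N4 : 4 <= N%:R :> R by rewrite (ler_nat R 4).
have h3 : (N%:R - 1) * k%:R <= N%:R * j%:R :> R.
  have : (N * (k - j))%:R <= k%:R :> R by rewrite ler_nat.
  by rewrite natrM natrB // => h; lra.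
have h4 : (N%:R - 3) * (r%:R * j%:R) <= 3 * N%:R * s%:R :> R.
  by move: h2; rewrite -(ler_nat R) !natrM natrB.
have h5 : (N%:R - 3) * (N%:R - 1) * (r%:R * k%:R) <= 3 * N%:R ^+ 2 * s%:R :> R.
  have := ler_wpM2l (ler0n R N) h4.
  have r0 : 0 <= (N%:R - 3) * r%:R :> R by rewrite mulr_ge0 // subr_ge0; lra.
  have := ler_wpM2l r0 h3.
  by set a := N%:R; set b := r%:R; set c := k%:R; set d := j%:R; nra.
have h6 : 3 * N%:R ^+ 2 <= (3 + eps) * ((N%:R - 3) * (N%:R - 1)) :> R.
  by move: eps_le1 eps_gt0 hN N4; set a := N%:R; nra.
have p0 : 0 < (N%:R - 3) * (N%:R - 1) :> R by rewrite mulr_gt0 // subr_gt0; lra.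
rewrite natrM -(ler_pM2l p0); apply: le_trans h5 _.
by rewrite [X in _ <= X]mulrCA [X in _ <= X]mulrA; apply: ler_wpM2r.
Qed.

(** Both exponents, (u^16 - u^15) u^5 and u^10 u^11, are at least u^21 / 2. Divided by j = O(u^20)
    they are a multiple of u, whose exponential beats the factor j^2 = O(u^40). *)
Lemma decay_scale (B : nat) : (0 < B)%N -> exists u0, forall u j, (u0 <= u)%N ->
  (u ^ 20 <= 2 * j)%N -> (j <= B * u ^ 20)%N -> (u ^ 18 <= j)%N ->
  (j * j * (j - (u ^ 16 - u ^ 15)) ^ u ^ 5 < j ^ u ^ 5)%N /\
  (j * j * (j - u ^ 10) ^ u ^ 11 < j ^ u ^ 11)%N.
Proof.
move=> B0; have [u0 hu0] := @poly_le_exp R (B * B).+1 40 (2 * B) (ltac:(lia)).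
exists (u0 + 2)%N => u j hu hj jB uj.
have u2 : (2 <= u)%N by lia.
have up i : (0 < u ^ i)%N by rewrite expn_gt0; apply/orP; left; lia.
have j0 : (0 < j)%N by apply: leq_trans uj.
have ratio q : (u ^ 21 <= 2 * q)%N -> (j * j)%:R < expR (q%:R / j%:R) :> R.
  move=> hq; apply: (@lt_le_trans _ _ ((B * B).+1 * u ^ 40)%:R).
    rewrite ltr_nat; apply: leq_ltn_trans (leq_mul jB jB) _.
    by rewrite mulnACA -expnD ltn_pmul2r.
  apply: le_trans (hu0 u _) _; first by lia.
  rewrite ler_expR ler_pdivrMr ?ltr0n ?muln_gt0 ?B0 // mulrAC ler_pdivlMr ?ltr0n //.
  rewrite -!natrM ler_nat; apply: leq_trans (leq_mul (leqnn u) jB) _.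
  by rewrite mulnCA -expnS mulnA [(q * 2)%N]mulnC [X in (_ <= X)%N]mulnC leq_mul2l hq orbT.
have exps i : (i <= 18)%N -> (u ^ i <= j)%N.
  by move=> hi; apply: leq_trans uj; rewrite leq_pexp2l //; lia.
split; apply: (@hitting_decay R) => //; try exact: exps.
- by apply: leq_trans (leq_subr _ _) _; apply: exps.
- apply: ratio; rewrite mulnBl -!expnD mulnBr.
  have : (2 * u ^ 20 <= u ^ 21)%N by rewrite [X in (_ <= X)%N]expnS leq_mul2r u2 orbT.
  by move: (u ^ 20)%N (u ^ 21)%N => x y; lia.
- by apply: ratio; rewrite -expnD leq_pmull.
Qed.

Lemma expR_exp_le (a b x : R) (m q : nat) :
  0 <= a -> a <= expR b -> 0 <= b -> (m <= q)%N -> q%:R * b <= x -> a ^+ m <= expR x.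
Proof.
move=> a0 ab b0 mq h; apply: (@le_trans _ _ (expR b ^+ m)).
  by rewrite lerXn2r ?nnegrE ?expR_ge0.
rewrite -expRM_natr ler_expR mulrC; apply: le_trans h.
by rewrite ler_wpM2r // ler_nat.
Qed.

(** The cost is exp (O(k log k)), while s > u k with u a fixed root of k up to constants. *)
Lemma cost_large_scale (B : nat) : exists u0, forall u k s, (u0 <= u)%N ->
  (k <= B * u ^ 20)%N -> (u * k < s)%N -> (dictionary_cost (2 * k))%:R <= expR (eps * s%:R).
Proof.
pose c1 := (Num.truncn (2 / eps)).+1.
have hc1 : 2 <= eps * c1%:R.
  by rewrite mulrC -ler_pdivrMr //; apply/ltW; apply: truncnS_gt.
have [u0 hu0] := @poly_le_exp R ((2 * B) ^ 12 * 4) 240 c1 isT.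
exists u0 => u k s hu hk hs.
rewrite /dictionary_cost -expnMn natrX; apply: (@expR_exp_le _ (u%:R / c1%:R) _ _ (2 * k)) => //.
- apply: le_trans (hu0 u hu); rewrite ler_nat.
  rewrite mulnAC leq_mul2r /= (expnM u 20 12) -expnMn leq_exp2r //.
  by rewrite -mulnA leq_mul2l.
- rewrite mulrA ler_pdivrMr ?ltr0n //; apply: (@le_trans _ _ (2 * (u * k)%:R)).
    by rewrite -!natrM ler_nat; lia.
  apply: (@le_trans _ _ (2 * s%:R)); first by rewrite ler_pM2l ?ltr0n // ler_nat ltnW.
  by rewrite mulrAC; apply: ler_wpM2r.
Qed.

(** M log M is of order u^15 log u, against s >= u^20 / 4. The base 16 covers both kinds of cost,
    and half of eps is kept for the binomials. *)
Lemma cost_small_scale : exists u0, forall u k s M, (u0 <= u)%N ->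
  (M <= 2 * u ^ 15)%N -> (u ^ 20 <= k)%N -> (k <= 4 * s)%N ->
  ((M ^ 12) ^ M * 16 ^ M)%:R <= expR (eps / 2 * s%:R).
Proof.
have [a ha] : exists a, a = (2 ^ 12 * 16)%N by exists (2 ^ 12 * 16)%N.
have [u0 hu0] := @poly_le_exp R a 180 1 isT.
pose c1 := (Num.truncn (16 / eps)).+1.
have hc1 : 16 <= eps * c1%:R.
  by rewrite mulrC -ler_pdivrMr //; apply/ltW; apply: truncnS_gt.
exists (u0 + c1)%N => u k s M hu hM hk hs.
rewrite -expnMn natrX; apply: (@expR_exp_le _ u%:R _ _ (2 * u ^ 15)) => //.
  apply: (@le_trans _ _ (expR (u%:R / 1%:R))); last by rewrite divr1.
  apply: le_trans (hu0 u _); last by lia.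
  rewrite ler_nat ha mulnAC leq_mul2r /= (expnM u 15 12) -expnMn leq_exp2r //.
rewrite -natrM -mulnA -expnSr.
have h1 : (u ^ 16 * u <= 4 * s)%N.
  apply: leq_trans hs; apply: leq_trans hk; rewrite -expnSr leq_pexp2l //.
  by rewrite /c1 in hu; lia.
have h2 : 16 <= eps * u%:R.
  by apply: le_trans hc1 _; rewrite ler_pM2l // ler_nat; lia.
have h3 : (u ^ 16)%:R * u%:R <= 4 * s%:R :> R by rewrite -!natrM ler_nat.
rewrite natrM; have := ler0n R (u ^ 16).
by move: h1 h2 h3 eps_gt0; clear; set a := (u ^ 16)%:R; set b := u%:R; set c := s%:R; nra.
Qed.

(** With x = s / j, each binomial is at most (11 e x)^j, where e is the base of the logarithm;
    beyond K0 the linear 11 e x is below exp (eps x / 4). *)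
Lemma binomial_scale : exists K0 : nat, forall s j, (0 < j)%N -> (K0 * j <= s)%N ->
  ('C(s * 11, j) ^ 2)%:R <= expR (eps / 2 * s%:R).
Proof.
have e1_gt0 : 0 < expR 1 * 11 :> R by rewrite mulr_gt0 ?expR_gt0.
have eps4 : 0 < eps / 4 by rewrite divr_gt0.
have [K0 linK] := linear_le_exp e1_gt0 eps4.
exists K0.+1 => s j j0 hs.
have j0' : 0 < j%:R :> R by rewrite ltr0n.
have h1 : ('C(s * 11, j))%:R <= expR (eps / 4 * (s%:R / j%:R)) ^+ j.
  apply: le_trans (@bin_le_exp R _ _ _) _; first by rewrite j0 /=; nia.
  rewrite lerXn2r ?nnegrE ?expR_ge0 // ?mulr_ge0 ?expR_ge0 ?divr_ge0 ?ler0n //.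
  have -> : expR 1 * ((s * 11)%:R / j%:R) = expR 1 * 11 * (s%:R / j%:R) :> R.
    by rewrite natrM; ring.
  by apply: linK; rewrite ler_pdivlMr // -natrM ler_nat; nia.
rewrite natrX.
have -> : eps / 2 * s%:R = (eps / 4 * (s%:R / j%:R)) * j%:R * 2%:R.
  by field; rewrite gt_eqF.
by rewrite expRM_natr expRM_natr lerXn2r ?nnegrE ?exprn_ge0 ?expR_ge0.
Qed.

(* With k about u^20, the scales of pruning and of the dictionary are fixed powers
   of u, chosen so that a dictionary has at most 2 u^15 elements.  This makes the
   cost u^15 log u of all the non-free data negligible against eps k. *)
Theorem combinatorial_main : exists k0 : nat, forall k n, (k0 <= k)%N -> (0 < n)%N ->
  exists (W : nat -> {fset {fset nat}}) (Q : nat -> nat),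
  [/\ forall s U, U \in W s -> #|` U| = s,
      forall s, (Q s * k)%:R <= (3 + eps) * s%:R,
      forall s, (#|` W s|)%:R <= ((2 * k).+1 * ((2 * k).+1 * k.+2))%:R *
                   (expR (eps * s%:R) * n%:R ^+ Q s) :> R &
      forall A B : {fset nat}, #|` A| = k -> #|` B| = k ->
        (forall x, x \in A `|` B -> (0 < x <= n)%N) ->
        exists U, [/\ U `<=` fsum A B, (k <= 4 * #|` U|)%N, (#|` U| <= k * k)%N &
           U \in W #|` U|]].
Proof.
have [N [N4 rankN]] := rank_budget.
have [K0 binK] := binomial_scale.
have [k0 [C robust]] := @free_rank_robust R K0.+1 N isT (leq_trans (isT : 0 < 4)%N N4).
have [B [B0 root]] := twentieth_root.
have [u1 decayu] := decay_scale B0.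
have [u2 largeu] := cost_large_scale B.
have [u3 smallu] := cost_small_scale.
have [v0 rootv] := root (N + k0 + C + u1 + u2 + u3 + 33)%N.
exists v0 => k n /rootv[u [hu uk kB]] n0.
have u33 : (33 <= u)%N by lia.
have k_gt0 : (0 < k)%N by apply: leq_trans uk; rewrite expn_gt0; apply/orP; left; lia.
pose E (s : nat) := Num.truncn (expR (eps * s%:R)).
pose Q (s : nat) := Num.truncn ((3 + eps) * s%:R / k%:R).
have eps3 : 0 <= 3 + eps by rewrite addr_ge0 // ltW.
have leE s m : m%:R <= expR (eps * s%:R) -> (m <= E s)%N.
  by rewrite truncn_ge_nat ?expR_ge0.
have Qpos s : 0 <= (3 + eps) * s%:R / k%:R by rewrite divr_ge0 ?mulr_ge0 ?ler0n.
exists (family R n k 11 E Q), Q; split.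
- by move=> s U; rewrite !inE => /andP[_ /eqP].
- move=> s; rewrite natrM -ler_pdivlMr ?ltr0n //.
  by rewrite truncn_le.
- move=> s; have /(_ s n0) := @card_family R n k 11 E Q.
  rewrite -(ler_nat R) => /le_trans; apply.
  set b := (2 * k).+1; rewrite (_ : (b * (b * _) = b * (b * k.+2) * (E s * n ^ Q s))%N).
    rewrite natrM ler_wpM2l ?ler0n // natrM natrX ler_wpM2r ?exprn_ge0 ?ler0n //.
    by rewrite truncn_le expR_ge0.
  by rewrite !mulnA.
have u2k i : (i < 20)%N -> (2 * u ^ i <= k)%N.
  move=> hi; apply: leq_trans uk; apply: (@leq_trans (u ^ i.+1)).
    by rewrite expnS leq_mul2r; apply/orP; right; lia.
  by rewrite leq_pexp2l //; lia.
have M_le : (2 * 11 + u ^ 10 * u ^ 5 + u ^ 11 <= 2 * u ^ 15)%N.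
  have h1 : (u ^ 11 * u <= u ^ 15)%N by rewrite -expnSr leq_pexp2l //; lia.
  have h2 : (0 < u ^ 11)%N by rewrite expn_gt0; apply/orP; left; lia.
  by rewrite -expnD; move: h1 h2; move: (u ^ 11)%N (u ^ 15)%N => x y; nia.
(* With t = u^16 and e = u^18, N t u <= e as soon as u >= N; p + h t1 equals t exactly; and L = 11
   comes from [dictionary_scale]. The dictionary has at most 22 + u^15 + u^11 entries. *)
apply: (@witness R n k 11 E Q u (u ^ 16) (u ^ 18) (u ^ 16 - u ^ 15) (u ^ 10)
  (u ^ 5) (u ^ 11) N K0.+1 k0 C) => //.
- by move=> m g A D Z e j; apply: robust.
- by rewrite expn_gt0; apply/orP; left; lia.
- by lia.
- by rewrite -expnSr [X in (_ <= X)%N]expnS leq_mul2r; apply/orP; right; lia.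
- by apply: leq_trans M_le _; apply: leq_trans (u2k _ _) _ => //; lia.
- move=> s r j jk kj h; rewrite truncn_ge_nat //.
  by rewrite ler_pdivlMr ?ltr0n // -natrM; apply: rankN h.
- by move=> s hs; apply: leE; apply: largeu hs => //; lia.
- move=> s hs; apply: leE.
  apply: (@le_trans _ _ (expR (eps / 2 * s%:R))).
    apply: le_trans (smallu u k s _ _ M_le uk hs); last by lia.
    rewrite ler_nat leq_mul2l; apply/orP; right; rewrite leq_exp2r //.
  by rewrite ler_expR; apply: ler_wpM2r => //; set x := eps; have : 0 < x := eps_gt0; lra.
- move=> s j jk kj hs; apply: leE; have j0 : (0 < j)%N by clear -k_gt0 kj; lia.
  have h1 := binK s j j0 (leq_trans (leq_mul (leqnSn _) (leqnn _)) (ltnW hs)).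
  have ks : (k <= 4 * s)%N by clear -kj hs; nia.
  have h2 := smallu u k s _ (ltac:(clear -hu; lia)) M_le uk ks.
  rewrite /sampled_cost mulnA natrM.
  have -> : eps * s%:R = eps / 2 * s%:R + eps / 2 * s%:R by field.
  by rewrite expRD ler_pM ?ler0n.
- move=> j jk kj; have jB : (j <= B * u ^ 20)%N by apply: leq_trans jk kB.
  have uj : (u ^ 20 <= 2 * j)%N by apply: leq_trans uk kj.
  have hj : (2 * u ^ 19 <= u ^ 20)%N by rewrite [X in (_ <= X)%N]expnS leq_mul2r; apply/orP; right; lia.
  have {}hj : (u * u ^ 18 <= j)%N.
    by rewrite -expnS; move: hj uj; clear; move: (u ^ 19)%N (u ^ 20)%N => x y; lia.
  have u18 : (u <= u ^ 18)%N by rewrite -[X in (X <= _)%N]expn1 leq_pexp2l //; lia.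
  have le18 : (u ^ 18 <= j)%N by apply: leq_trans hj; apply: leq_pmull; lia.
  split.
  - exact: dictionary_scale.
  - by apply: leq_trans hj; rewrite leq_mul2r; apply/orP; right; clear -hu; lia.
  - by apply: leq_trans le18; apply: leq_trans u18; clear -hu; lia.
  - by apply: leq_trans hj; rewrite leq_mul2r; apply/orP; right; lia.
  - by apply: decayu => //; clear -hu; lia.
- by rewrite -expnD subnK // leq_pexp2l //; lia.
Qed.

End Main.

Local Close Scope fset_scope.
Local Open Scope classical_set_scope.
Local Open Scope ring_scope.

(** * The union bound *)

Section Probability.
Variables (R : realType) (d : measure_display) (T : measurableType d).
Variables (P : probability T R) (n : nat) (delta : R) (S : T -> set nat).
Hypothesis delta_ge0 : 0 <= delta.
Hypothesis hS : random_subset P n delta S.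

Lemma measurable_contains (U : {fset nat}) : measurable [set w | [set` U] `<=` S w].
Proof.
have [sub mS _ _] := hS.
rewrite (_ : [set w | _] = \bigcap_(i in [set` U]) [set w | S w i]); last first.
  by apply/seteqP; split => w h i; apply: h.
apply: fin_bigcap_measurable => // i _.
have [hi|hi] := pselect (interval1 n i); first exact: mS.
rewrite (_ : [set w | _] = set0) //.
by apply/seteqP; split => // w /= /sub.
Qed.

Lemma probability_contains (U : {fset nat}) :
  (P [set w | [set` U] `<=` S w] <= (delta ^+ #|` U|)%:E)%E.
Proof.
have [sub _ pS indep] := hS.
have [hU|hU] := pselect ([set` U] `<=` interval1 n); last first.
  rewrite (_ : [set w | _] = set0) ?measure0 ?lee_fin ?exprn_ge0 //.
  by apply/seteqP; split => // w h; apply: hU; apply: subset_trans h (sub w).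
rewrite (_ : [set w | _] = \bigcap_(i in [set` U]) [set w | S w i]); last first.
  by apply/seteqP; split => w h i; apply: h.
rewrite indep // (eq_big_seq (fun=> delta%:E)); last by move=> i iU; apply: pS; exact: hU.
by rewrite prodEFin big_const_seq count_predT iter_mulr_1.
Qed.

Lemma union_bound (I : Type) (r : seq I) (p : pred I) (F : I -> set T) (f : I -> R) :
  (forall i, p i -> measurable (F i) /\ (P (F i) <= (f i)%:E)%E) ->
  measurable (\big[setU/set0]_(i <- r | p i) F i) /\
  (P (\big[setU/set0]_(i <- r | p i) F i) <= (\sum_(i <- r | p i) f i)%:E)%E.
Proof.
move=> h.
apply: (big_ind2 (fun (X : set T) (y : R) => measurable X /\ (P X <= y%:E)%E)) => //.
- by rewrite measure0.
- move=> X x Y y [mX hX] [mY hY]; split; first exact: measurableU.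
  by apply: le_trans (measureU2 _ mX mY) _; rewrite EFinD leeD.
Qed.

End Probability.

Lemma counting_geP (R : realType) (X : set nat) (kappa : R) (k : nat) :
  (forall m : nat, (kappa <= m%:R) = (k <= m)%N) ->
  (kappa%:E <= counting X)%E <-> exists2 A : {fset nat}, [set` A] `<=` X & #|` A|%fset = k.
Proof.
move=> hk; split.
  move=> h.
  have [A0 sA hA] : exists2 A : {fset nat}, [set` A] `<=` X & (k <= #|` A|%fset)%N.
    have [fX|iX] := pselect (finite_set X); last exact: infinite_set_fset.
    exists (fset_set X); first by rewrite fset_setK.
    by move: h; rewrite /counting asboolT // lee_fin hk.
  exists [fset x in take k (enum_fset A0)]%fset.
    by move=> x /=; rewrite !inE => /mem_take xA; apply: sA.
  by rewrite card_fseq undup_id ?take_uniq ?fset_uniq // size_takel.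
move=> [A sA cA]; rewrite /counting; case: asboolP => fX; last by rewrite leey.
rewrite lee_fin hk -cA; apply: fsubset_leq_card; apply/fsubsetP => x xA.
by rewrite in_fset_set // inE; apply: sA.
Qed.

Lemma large_sumsetP (R : realType) (X : set nat) (kappa : R) (k : nat) :
  (forall m : nat, (kappa <= m%:R) = (k <= m)%N) ->
  contains_large_sumset kappa X <-> exists A B : {fset nat},
    [/\ #|` A|%fset = k, #|` B|%fset = k,
        forall x, x \in (A `|` B)%fset -> (0 < x)%N & [set` fsum A B] `<=` X].
Proof.
move=> hk; split.
  move=> [A [B [pA pB hAB sX]]]; move: hAB; rewrite le_min => /andP[hA hB].
  have [A' sA cA] := (counting_geP A hk).1 hA; have [B' sB cB] := (counting_geP B hk).1 hB.
  exists A', B'; split => //.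
    by move=> x; rewrite in_fsetU => /orP[/sA /pA|/sB /pB].
  by move=> _ /= /fsumP[a [b [aA bB ->]]]; apply: sX; exists a; [exact: sA | exists b; [exact: sB|]].
move=> [A [B [cA cB pos sX]]]; exists [set` A], [set` B]; split.
- by move=> x /= xA; apply: pos; rewrite in_fsetU xA.
- by move=> x /= xB; apply: pos; rewrite in_fsetU xB orbT.
- by rewrite le_min; apply/andP; split; apply/(counting_geP _ hk); [exists A | exists B].
- by move=> _ [a aA [b bB <-]]; apply: sX => /=; apply: mem_fsum.
Qed.

Section UnionBound.
Variables (R : realType) (d : measure_display) (T : measurableType d).
Variables (P : probability T R) (n : nat) (delta : R) (S : T -> set nat).
Hypothesis delta_ge0 : 0 <= delta.
Hypothesis hS : random_subset P n delta S.
Variables (kappa : R) (k : nat) (W : nat -> {fset {fset nat}}).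
Hypothesis k_gt0 : (0 < k)%N.
Hypothesis hk : forall m : nat, (kappa <= m%:R) = (k <= m)%N.
Hypothesis W_card : forall s U, U \in W s -> #|` U|%fset = s.
Hypothesis W_witness : forall A B : {fset nat}, #|` A|%fset = k -> #|` B|%fset = k ->
  (forall x, x \in (A `|` B)%fset -> (0 < x <= n)%N) ->
  exists U, [/\ (U `<=` fsum A B)%fset, (k <= 4 * #|` U|%fset)%N,
    (#|` U|%fset <= k * k)%N & U \in W #|` U|%fset].

(** Both sets can be cut down to exactly k elements, so the event is a countable union over pairs of
    finite sets. *)
Lemma measurable_large_sumset : measurable [set w | contains_large_sumset kappa (S w)].
Proof.
pose good (p : {fset nat} * {fset nat}) := [/\ #|` p.1|%fset = k, #|` p.2|%fset = k &
  forall x, x \in (p.1 `|` p.2)%fset -> (0 < x)%N].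
rewrite (_ : [set w | _] = \bigcup_p
    (if `[< good p >] then [set w | [set` fsum p.1 p.2] `<=` S w] else set0)).
  apply: countable_bigcupT_measurable => // p.
  by case: ifP => _ //; apply: measurable_contains hS _.
apply/seteqP; split => w.
  move=> /(large_sumsetP _ hk)[A [B [cA cB pos sX]]]; exists (A, B) => //.
  by rewrite asboolT.
move=> [[A B] _]; case: asboolP => // -[/= cA cB pos] sX.
by apply/(large_sumsetP _ hk); exists A, B.
Qed.

Lemma large_sumset_union_bound :
  (P [set w | contains_large_sumset kappa (S w)] <=
   (\sum_(s < (k * k).+1 | (k <= 4 * s)%N) (#|` W s|%fset)%:R * delta ^+ s)%:E)%E.
Proof.
have [sub _ _ _] := hS.
have [mU leU] : measurable (\big[setU/set0]_(s < (k * k).+1 | (k <= 4 * s)%N)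
      \big[setU/set0]_(U <- W s) [set w | [set` U] `<=` S w]) /\
  (P (\big[setU/set0]_(s < (k * k).+1 | (k <= 4 * s)%N)
      \big[setU/set0]_(U <- W s) [set w | [set` U] `<=` S w]) <=
   (\sum_(s < (k * k).+1 | (k <= 4 * s)%N) (#|` W s|%fset)%:R * delta ^+ s)%:E)%E.
  apply: union_bound => s _.
  rewrite (_ : (#|` W s|%fset)%:R * delta ^+ s = \sum_(U <- W s) delta ^+ s); last first.
    by rewrite big_const_seq count_predT iter_addr_0 mulr_natl.
  rewrite big_seq_cond [X in (_ <= X%:E)%E]big_seq_cond.
  apply: union_bound => U /andP[UW _]; split; first exact: measurable_contains hS _.
  by rewrite -(W_card UW); apply: probability_contains hS _.
apply: le_trans leU; apply: le_measure; rewrite ?inE //; first exact: measurable_large_sumset.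
move=> w /(large_sumsetP _ hk)[A [B [cA cB pos sX]]].
have A0 : A != fset0 by rewrite -cardfs_gt0 cA.
have B0 : B != fset0 by rewrite -cardfs_gt0 cB.
have [|U [UAB U4 Uk UW]] := W_witness cA cB.
  (* Elements of A and B are at most n, because adding an element of the other set gives a sum in
     [n]. *)
  move=> x xAB; rewrite pos //=; have [a0 a0A] := fset0Pn _ A0; have [b0 b0B] := fset0Pn _ B0.
  move: xAB; rewrite in_fsetU => /orP[xA|xB].
    have /sX /sub /andP[_] := mem_fsum xA b0B; apply: leq_trans; exact: leq_addr.
  have /sX /sub /andP[_] := mem_fsum a0A xB; apply: leq_trans; exact: leq_addl.
have hU : (#|` U|%fset < (k * k).+1)%N by [].
rewrite -bigcup_seq_cond; exists (Ordinal hU); first by rewrite /= mem_index_enum.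
rewrite -bigcup_seq; exists U => //= x xU; apply: sX; exact: (fsubsetP UAB).
Qed.

End UnionBound.

(** * Asymptotics of the union bound *)

Section Asymptotics.
Variable R : realType.

Lemma nat_ceil (x : R) : 0 <= x -> exists k : nat,
  (forall m : nat, (x <= m%:R) = (k <= m)%N) /\ k%:R <= x + 1.
Proof.
move=> x0; have ex : exists m : nat, x <= m%:R.
  by exists (Num.truncn x).+1; apply/ltW; apply: truncnS_gt.
have [k xk kmin] := ex_minnP ex; exists k; split.
  move=> m; apply/idP/idP => [/kmin //|km]; apply: le_trans xk _; by rewrite ler_nat.
case: k xk kmin => [|k] _ kmin; first by rewrite addr_ge0.
rewrite -natr1 lerD2r leNgt; apply/negP => /ltW /kmin; by rewrite ltnn.
Qed.

(** From Q <= (3 + eps) s / k and L / k <= lam / (3 + gamma), L Q is at most (3 + eps) / (3 + gamma)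
    times lam s. The factor c / (1 + c) in eps ensures both eps <= gamma / 16 and eps <= gamma lam /
    16, so a multiple of gamma lam s is saved; finally lam s >= lam k / 4 >= (3 + gamma) L / 4. *)
Lemma exponent_bound (gamma c lam L : R) (Q k s : nat) :
  0 < gamma <= 1 -> 0 < c <= lam -> 0 <= L -> (3 + gamma) * L <= lam * k%:R ->
  (k <= 4 * s)%N -> (Q * k)%:R <= (3 + gamma * c / (16 * (1 + c))) * s%:R ->
  gamma * c / (16 * (1 + c)) * s%:R + L * Q%:R - lam * s%:R <= - (gamma / 8 * L).
Proof.
move=> /andP[g0 g1] /andP[c0 cl] L0 hL ks.
have c1 : 0 < 16 * (1 + c) by rewrite mulr_gt0 // addr_gt0.
set eps := gamma * c / (16 * (1 + c)).
have e1 : eps <= gamma / 16.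
  rewrite ler_pdivrMr // (_ : gamma / 16 * _ = gamma * (1 + c)); last by field.
  by rewrite ler_pM2l // lerDr.
have e2 : eps <= gamma / 16 * lam.
  apply: (@le_trans _ _ (gamma / 16 * c)); last by rewrite ler_pM2l // divr_gt0.
  rewrite ler_pdivrMr //; have : 0 <= gamma * c by rewrite mulr_ge0 // ltW.
  have -> : gamma / 16 * c * (16 * (1 + c)) = gamma * c * (1 + c) by field.
  by move=> h; rewrite mulrDr mulr1 lerDl mulr_ge0 // ltW.
rewrite natrM => hQ.
have {}ks : k%:R <= 4 * s%:R :> R by rewrite -natrM ler_nat.
have lam0 : 0 <= lam by apply: le_trans cl; exact: ltW.
have Q0 : 0 <= Q%:R :> R by []. have s0 : 0 <= s%:R :> R by [].
have h1 : (3 + gamma) * (L * Q%:R) <= lam * ((3 + eps) * s%:R).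
  have := ler_wpM2l lam0 hQ; have := ler_wpM2r Q0 hL; lra.
have h2 : eps * s%:R <= gamma / 16 * lam * s%:R by apply: ler_wpM2r.
have h3 : lam * s%:R * eps <= lam * s%:R * (gamma / 16) by apply: ler_wpM2l; rewrite ?mulr_ge0.
have h4 : (3 + gamma) * L <= 4 * (lam * s%:R).
  by apply: le_trans hL _; rewrite mulrCA; apply: ler_wpM2l.
have h5 : (3 + gamma) * (eps * s%:R) <= 4 * (gamma / 16 * lam * s%:R).
  apply: ler_pM => //; [lra | | lra].
  by apply: mulr_ge0 => //; apply: divr_ge0; [apply: mulr_ge0|]; apply: ltW.
have h6 : gamma * ((3 + gamma) * L) <= gamma * (4 * (lam * s%:R)) by apply: ler_wpM2l => //; apply: ltW.
have h7 : 0 <= gamma * ((3 + gamma) * L) by rewrite !mulr_ge0 ?(ltW g0) //; lra.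
rewrite -(@ler_pM2l _ (3 + gamma)); last lra.
move: h1 h2 h3 h5 h6 h7; set x := s%:R; set y := Q%:R; lra.
Qed.

Lemma polynomial_factor (k : nat) : (0 < k)%N ->
  ((k * k).+1 * ((2 * k).+1 * ((2 * k).+1 * k.+2)) <= 54 * k ^ 5)%N.
Proof.
move=> k0; apply: (@leq_trans ((2 * (k * k)) * ((3 * k) * ((3 * k) * (3 * k)))));
  last by rewrite !expnS expn0; lia.
by repeat apply: leq_mul; nia.
Qed.

(** The sixth power of 1 + y <= exp y is taken, one more than the degree of the polynomial, so that
    a factor 1 / x remains. *)
Lemma power_le_exp (b x : R) : 0 < b -> 0 < x -> x ^+ 5 * expR (- (b * x)) <= (6 / b) ^+ 6 / x.
Proof.
move=> b0 x0; rewrite expRN ler_pdivrMr ?expR_gt0 // mulrAC ler_pdivlMr // -exprSr.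
have -> : b * x = (b / 6 * x) * 6%:R by field.
rewrite expRM_natr -exprMn lerXn2r ?nnegrE ?mulr_ge0 ?invr_ge0 ?expR_ge0 ?(ltW b0) ?(ltW x0) //.
apply: (@le_trans _ _ (6 / b * (b / 6 * x))).
  by rewrite mulrA -[6 / b]invf_div mulVf ?mul1r // lt0r_neq0 // divr_gt0.
rewrite ler_pM2l ?divr_gt0 //; apply: le_trans (expR_ge1Dx _); by rewrite lerDr.
Qed.

Lemma large_sumset_probability (gamma c : R) : 0 < gamma <= 1 -> 0 < c ->
  exists alpha C : R, 0 < alpha /\
    forall n delta d (T : measurableType d) (P : probability T R) (S : T -> set nat),
      1 <= ln n%:R :> R -> n%:R `^ (- alpha) < delta <= 1 - c ->
      random_subset P n delta S ->
      (P [set w | contains_large_sumset ((3 + gamma) * ln n%:R / ln (1 / delta)) (S w)] <=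
        (C / ln n%:R)%:E)%E.
Proof.
move=> hg c0; have [g0 g1] := andP hg.
pose eps := gamma * c / (16 * (1 + c)).
have c1 : 0 < 16 * (1 + c) by rewrite mulr_gt0 // addr_gt0.
have eps0 : 0 < eps by rewrite divr_gt0 // mulr_gt0.
have eps1 : eps <= 1 by rewrite ler_pdivrMr // mul1r; nra.
have [k0 main] := combinatorial_main eps0 eps1.
(* With this alpha, n^(-alpha) < delta means L / lam > k0 + 1, which puts k in the range of
   [combinatorial_main]. In the constant, 54 k^5 bounds the polynomial factors, and k <= (4 / c + 1)
   L because lam >= c. *)
exists k0.+1%:R^-1, (54 * (4 / c + 1) ^+ 5 * (6 / (gamma / 8)) ^+ 6).
split; first by rewrite invr_gt0.
move=> n delta d T P S; set L := ln n%:R => L1 /andP[d1 d2] hS.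
have n0 : (0 < n)%N.
  by case: (n) @L L1 => // L; rewrite /L ln0 // ler10.
have delta0 : 0 < delta by apply: le_lt_trans d1; apply: powR_ge0.
set lam := ln (1 / delta).
have lnd : ln delta = - lam by rewrite /lam div1r lnV ?opprK.
have cl : c <= lam.
  rewrite -lerN2 -lnd; apply: (@le_trans _ _ (ln (1 - c))).
    by rewrite ler_ln // posrE; apply: lt_le_trans d2.
  by apply: le_ln1Dx; rewrite ltrN2 -subr_gt0; apply: lt_le_trans d2.
have lam0 : 0 < lam by apply: lt_le_trans cl.
have lamL : lam * k0.+1%:R < L.
  rewrite -ltr_pdivlMr // mulrC -ltrN2 -lnd -mulNr -ln_powR ltr_ln // posrE.
  by rewrite powR_gt0 // ltr0n.
set kappa := (3 + gamma) * L / lam.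
have kappa0 : 0 <= kappa by rewrite divr_ge0 ?mulr_ge0 ?ltW //; lra.
have [k [hk kle]] := nat_ceil kappa0.
have kk : kappa <= k%:R by rewrite hk.
have k0k : (k0 < k)%N.
  rewrite -(ltr_nat R); apply: lt_le_trans kk; rewrite ltr_pdivlMr //.
  have : 0 <= k0%:R :> R by [].
  by move: lamL; rewrite -natr1; nra.
have kp : (0 < k)%N by apply: leq_trans k0k.
have [W [Q [Wcard WQ Wsize Wwit]]] := main k n (ltnW k0k) n0.
apply: le_trans (large_sumset_union_bound (ltW delta0) hS kp hk Wcard Wwit) _.
rewrite lee_fin.
set F := (2 * k).+1; pose F' := (F * (F * k.+2))%N.
have term s : (k <= 4 * s)%N -> (#|` W s|%fset)%:R * delta ^+ s <= F'%:R * expR (- (gamma / 8 * L)).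
  move=> ks; apply: (@le_trans _ _ (F'%:R * (expR (eps * s%:R) * n%:R ^+ Q s) * delta ^+ s)).
    by rewrite ler_wpM2r ?Wsize // exprn_ge0 // ltW.
  have -> : n%:R ^+ Q s = expR (L * (Q s)%:R) by rewrite expRM_natr lnK // posrE ltr0n.
  have -> : delta ^+ s = expR (- (lam * s%:R)).
    by rewrite -mulNr -lnd expRM_natr lnK // posrE.
  rewrite -mulrA -!expRD ler_wpM2l // ler_expR.
  apply: exponent_bound ks (WQ s); rewrite ?c0 // ?(le_trans _ L1) //.
  by rewrite [lam * _]mulrC -ler_pdivrMr.
apply: (@le_trans _ _ (\sum_(s < (k * k).+1 | (k <= 4 * s)%N) F'%:R * expR (- (gamma / 8 * L)))).
  by apply: ler_sum => s; apply: term.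
have E0 : 0 <= F'%:R * expR (- (gamma / 8 * L)) by rewrite mulr_ge0 // expR_ge0.
rewrite sumr_const; apply: (@le_trans _ _ ((F'%:R * expR (- (gamma / 8 * L))) *+ (k * k).+1)).
  rewrite -[X in X <= _]mulr_natl -[X in _ <= X]mulr_natl ler_wpM2r // ler_nat.
  by rewrite -[X in (_ <= X)%N]card_ord max_card.
rewrite -mulr_natl mulrA -natrM.
have L0 : 0 < L by apply: lt_le_trans L1.
apply: (@le_trans _ _ (54 * ((4 / c + 1) * L) ^+ 5 * expR (- (gamma / 8 * L)))).
  rewrite ler_wpM2r ?expR_ge0 //; apply: (@le_trans _ _ ((54 * k ^ 5)%N%:R)).
    by rewrite ler_nat; apply: polynomial_factor.
  rewrite natrM natrX ler_pM2l // lerXn2r ?nnegrE //.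
    by rewrite mulr_ge0 ?addr_ge0 ?divr_ge0 // ltW.
  apply: le_trans kle _; rewrite mulrDl mul1r lerD //.
  rewrite /kappa mulrAC; apply: ler_wpM2r; first exact: ltW.
  by rewrite ler_pM ?invr_ge0 ?lef_pV2 ?posrE // ?(ltW lam0) //; lra.
rewrite exprMn mulrA -[X in X <= _]mulrA -[X in _ <= X]mulrA ler_wpM2l //.
  by rewrite mulr_ge0 // exprn_ge0 // addr_ge0 // divr_ge0 // ltW.
by apply: power_le_exp => //; rewrite divr_gt0.
Qed.

End Asymptotics.

Theorem theorem1p3 (R : realType) (gamma c : R)
    (hgamma : 0 < gamma <= 1) (hc : 0 < c) :
  exists2 alpha : R, 0 < alpha &
    forall (delta : nat -> R)
      (hdelta : \forall n \near \oo, n%:R `^ (- alpha) < delta n <= 1 - c)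
      (d : nat -> measure_display) (T : forall n, measurableType (d n))
      (P : forall n, probability (T n) R) (S : forall n, T n -> set nat)
      (hS : \forall n \near \oo, random_subset (P n) n (delta n) (S n)),
    P n [set w | contains_large_sumset
                   ((3 + gamma) * ln n%:R / ln (1 / delta n)) (S n w)]
      @[n --> \oo] --> 0%E.
Proof.
have [alpha [C [alpha0 bound]]] := large_sumset_probability hgamma hc.
exists alpha => // delta hdelta d T P S hS.
have ln_large (A : R) : \forall n \near \oo, A <= ln n%:R.
  near=> n; rewrite -[A]expRK ler_ln ?posrE ?expR_gt0 //.
    by near: n; apply: nbhs_infty_ger.
  by rewrite ltr0n; near: n; apply: nbhs_infty_gt.
apply: (@squeeze_cvge _ _ _ _ (fun=> 0%E) _ (fun n => (C / ln n%:R)%:E)).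
- near=> n; rewrite measure_ge0 /=; apply: bound.
  + by near: n; apply: ln_large.
  + by near: n.
  + by near: n.
- exact: cvg_cst.
- apply: cvg_EFin; first by apply: nearW.
  rewrite -[X in _ --> X](mulr0 C); apply: cvgMr; apply/gtr0_cvgV0.
    by near=> n; apply: (@lt_le_trans _ _ 1) => //; near: n; apply: ln_large.
  by apply/cvgryPge.
Unshelve. all: by end_near.
Qed.
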